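(* Let $m\ge0$, $c\ge1$, $1\le k\le\ell$ and $0\le p\le\ell$ be integers, and put $d_i=m$ for $1\le i\le p$ and $d_i=m+1$ for $p<i\le\ell$. Let $\mathcal{R}^{p,k}_\ell(c,m)$ be the arrangement in $\mathbb{R}^\ell$ consisting of the hyperplanes: $x_i-x_j=0$ for $1\le i<j\le\ell$; $x_i-x_j=1$ and $x_i-x_j=-1$ for $1\le i<j\le\ell-k+1$; and $x_i=s$ for $1\le i\le\ell$ and integers $1-\mu_i-c\le s\le d_i+\mu_i-1$, where $\mu_i=\min\{\ell-i+1,k\}$. For $k\le\ell-1$, let $\widehat{\mathcal{R}}^{p,k}_\ell(c,m)$ be the arrangement in $\mathbb{R}^\ell$ consisting of the hyperplanes: $x_i-x_j=0$ for $1\le i<j\le\ell$; $x_i-x_j=\pm1$ for $1\le i<j\le\ell-k$; $x_{\ell-k+1}-x_i=1$ for $1\le i\le\ell-k$; and $x_i=s$ for $1\le i\le\ell$ and integers $-c-\min\{k,\ell-i\}\le s\le d_i+\min\{k-1,\ell-i\}$. Then the cones $\mathbf{c}\mathcal{R}^{p,k}_\ell(c,m)$ and (for $k\le\ell-1$) $\mathbf{c}\widehat{\mathcal{R}}^{p,k}_\ell(c,m)$ are ind-flag-accurate, both with exponents $$\big(1,\ q+\ell-p+1,\ q+2,\ q+3,\dots,\ q+\ell\big),\qquad q=m+\ell+c-1.$$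
   Context: For an affine arrangement $\mathcal{A}$ in $\mathbb{R}^\ell$, its cone $\mathbf{c}\mathcal{A}$ is the central arrangement in $V'=\mathbb{R}^{\ell+1}$ (extra coordinate $z$) consisting of the hyperplanes $a_1x_1+\dots+a_\ell x_\ell=dz$ for each hyperplane $a_1x_1+\dots+a_\ell x_\ell=d$ of $\mathcal{A}$, together with $z=0$. For a central arrangement $\mathcal{A}$ in $W=\mathbb{R}^N$: $L(\mathcal{A})$ is the set of intersections of subsets of $\mathcal{A}$ (including $W$); $\mathcal{A}^X=\{H\cap X:H\in\mathcal{A},X\not\subseteq H\}$; $\mathcal{A}$ is free if $D(\mathcal{A})=\{\theta\in\mathrm{Der}(S):\theta(\alpha_H)\in\alpha_HS\ \forall H\}$ is free over $S=\mathbb{R}[x_1,\dots,x_N]$, exponents being degrees of a homogeneous basis. Inductively free arrangements: smallest class containing empty arrangements and containing $\mathcal{A}$ whenever some $H\in\mathcal{A}$ has $\mathcal{A}\setminus\{H\}$ and $\mathcal{A}^H$ in the class with $\exp(\mathcal{A}^H)\subseteq\exp(\mathcal{A}\setminus\{H\})$. $\mathcal{A}$, free with exponents $e_1\le\dots\le e_N$, is ind-flag-accurate if it is inductively free and there is a flag $X_1\subseteq\dots\subseteq X_N=W$ in $L(\mathcal{A})$ with $\dim X_d=d$ and each $\mathcal{A}^{X_d}$ inductively free with exponents $(e_1,\dots,e_d)$. *)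

(* Defs.v *)
From HB Require Import structures.
From mathcomp Require Import all_boot all_order all_algebra.
From mathcomp Require Import finmap mpoly zify.

Set Implicit Arguments.
Unset Strict Implicit.
Unset Printing Implicit Defensive.

Import Order.TTheory GRing.Theory Num.Theory.

Local Open Scope fset_scope.
Local Open Scope ring_scope.

(* A central arrangement in a finite-dimensional space V is a finite set of
   linear subspaces of codimension 1.  The definitions below make sense for
   any A : {fset {vspace V}}; the condition [is_arrangement] is inherited by
   subsets of A and by the restrictions of A. *)
Definition is_arrangement (K : fieldType) (V : vectType K)
    (A : {fset {vspace V}}) : Prop :=
  forall H, H \in A -> (\dim H).+1 = \dim {:V}.

Definition in_lattice (K : fieldType) (V : vectType K)
    (A : {fset {vspace V}}) (X : {vspace V}) : Prop :=
  exists2 B : {fset {vspace V}}, B `<=` A & X = (\bigcap_(H <- B) H)%VS.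

(* The ambient space of the restriction to X is X itself, as a vector space:
   H :&: X is represented by its preimage under the inclusion of X in V. *)
Definition restriction (K : fieldType) (V : vectType K)
    (A : {fset {vspace V}}) (X : {vspace V}) : {fset {vspace subvs_of X}} :=
  [fset (linfun (vsval : subvs_of X -> V) @^-1: H)%VS
     | H in A & ~~ (X <= H)%VS].

(* The coordinate ring of V is {mpoly K[\dim {:V}]}, in the linear coordinates
   given by the basis vbasis {:V}; freeness and exponents do not depend on
   this choice of basis. *)
Definition defining_form (K : fieldType) (V : vectType K)
    (H : {vspace V}) (alpha : {mpoly K[\dim {:V}]}) : Prop :=
  alpha \is 1.-homog
  /\ forall v : V, (v \in H) = (alpha.@[fun i => coord (vbasis {:V}) i v] == 0).

Definition derivation (K : fieldType) (n : nat)
    (theta : {mpoly K[n]} -> {mpoly K[n]}) : Prop :=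
  linear theta
  /\ forall f g, theta (f * g) = theta f * g + f * theta g.

Definition log_derivation (K : fieldType) (V : vectType K)
    (A : {fset {vspace V}})
    (theta : {mpoly K[\dim {:V}]} -> {mpoly K[\dim {:V}]}) : Prop :=
  derivation theta
  /\ forall H alpha, H \in A -> defining_form H alpha ->
       exists g, theta alpha = alpha * g.

(* theta = sum_i f_i d/dx_i is homogeneous of (polynomial) degree d when all
   the f_i = theta x_i are. *)
Definition homog_derivation (K : fieldType) (n d : nat)
    (theta : {mpoly K[n]} -> {mpoly K[n]}) : Prop :=
  forall i : 'I_n, theta 'X_i \is d.-homog.

(* D(A) is free over S, with a homogeneous basis of degrees es; the order of
   es is irrelevant. *)
Definition free_with_exponents (K : fieldType) (V : vectType K)
    (A : {fset {vspace V}}) (es : seq nat) : Prop :=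
  exists theta : 'I_(size es) ->
                 {mpoly K[\dim {:V}]} -> {mpoly K[\dim {:V}]},
  [/\ forall j, log_derivation A (theta j),
      forall j : 'I_(size es), homog_derivation (nth 0%N es j) (theta j)
    & forall eta, log_derivation A eta ->
        exists! g : {ffun 'I_(size es) -> {mpoly K[\dim {:V}]}},
          forall f, eta f = \sum_j g j * theta j f].

Definition multiset_incl (s t : seq nat) : Prop :=
  forall e : nat, (count_mem e s <= count_mem e t)%N.

Inductive inductively_free (K : fieldType) :
    forall V : vectType K, {fset {vspace V}} -> Prop :=
| IF_empty (V : vectType K) : inductively_free (fset0 : {fset {vspace V}})
| IF_add (V : vectType K) (A : {fset {vspace V}}) (H : {vspace V})
    (es es' : seq nat) :
    H \in A ->
    inductively_free (A `\ H) ->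
    inductively_free (restriction A H) ->
    free_with_exponents (A `\ H) es ->
    free_with_exponents (restriction A H) es' ->
    multiset_incl es' es ->
    inductively_free A.

Definition ind_flag_accurate (K : fieldType) (V : vectType K)
    (A : {fset {vspace V}}) : Prop :=
  is_arrangement A /\
  exists es : seq nat,
  [/\ sorted leq es,
      free_with_exponents A es,
      inductively_free A
    & exists X : nat -> {vspace V},
      [/\ X (\dim {:V}) = fullv,
          forall d, (1 <= d < \dim {:V})%N -> (X d <= X d.+1)%VS
        & forall d, (1 <= d <= \dim {:V})%N ->
            [/\ in_lattice A (X d),
                \dim (X d) = d,
                inductively_free (restriction A (X d))
              & free_with_exponents (restriction A (X d)) (take d es)]]].

(* An affine arrangement in K^l is given by a list of pairs (a, d), one for
   each hyperplane a_1 x_1 + ... + a_l x_l = d. *)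
Definition affine_arrangement (K : fieldType) (l : nat) : Type :=
  seq ('rV[K]_l * K).

Definition kernel_hyperplane (K : fieldType) (n : nat) (u : 'rV[K]_n) :
    {vspace 'rV[K]_n} :=
  lker (linfun (mulmxr u^T : 'rV[K]_n -> 'rV[K]_1)).

(* The extra coordinate z is the last one. *)
Definition cone (K : fieldType) (l : nat) (A : affine_arrangement K l) :
    {fset {vspace 'rV[K]_(l + 1)}} :=
  kernel_hyperplane (row_mx 0 1) |`
    [fset kernel_hyperplane (row_mx e.1 (- e.2)%:M) | e in A].

Definition int_range (a b : int) : seq int :=
  if a <= b then [seq a + j%:Z | j <- iota 0 `|b - a|.+1] else [::].

Lemma mem_int_range (a b s : int) : (s \in int_range a b) = (a <= s <= b).
Proof.
rewrite /int_range; case: ifPn => [ab|nab]; last by rewrite in_nil; lia.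
apply/mapP/idP => [[j]|asb]; first by rewrite mem_iota => jb ->; lia.
by exists `|s - a|%N; [rewrite mem_iota|]; lia.
Qed.

(* The coordinates of K^l are numbered x_1, ..., x_l. *)
Definition x_ (K : fieldType) (l i : nat) : 'rV[K]_l :=
  \row_(j < l) (j.+1 == i)%:R.

Definition hyp_coord (K : fieldType) (l i : nat) (s : int) : 'rV[K]_l * K :=
  (x_ K l i, s%:~R).

Definition hyp_diff (K : fieldType) (l i j : nat) (s : int) : 'rV[K]_l * K :=
  (x_ K l i - x_ K l j, s%:~R).

Definition d_ (p m i : nat) : nat := if (i <= p)%N then m else m.+1.

Definition mu_ (l k i : nat) : nat := minn (l - i + 1) k.

Definition arr_R (K : fieldType) (l p k c m : nat) : affine_arrangement K l :=
  [seq hyp_diff K l i j 0 | j <- index_iota 1 l.+1, i <- index_iota 1 j]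
  ++ [seq hyp_diff K l i j 1
       | j <- index_iota 1 (l - k + 1).+1, i <- index_iota 1 j]
  ++ [seq hyp_diff K l i j (-1)
       | j <- index_iota 1 (l - k + 1).+1, i <- index_iota 1 j]
  ++ [seq hyp_coord K l i s
       | i <- index_iota 1 l.+1,
         s <- int_range (1 - (mu_ l k i)%:Z - c%:Z)
                        ((d_ p m i)%:Z + (mu_ l k i)%:Z - 1)].

Definition arr_Rhat (K : fieldType) (l p k c m : nat) :
    affine_arrangement K l :=
  [seq hyp_diff K l i j 0 | j <- index_iota 1 l.+1, i <- index_iota 1 j]
  ++ [seq hyp_diff K l i j 1
       | j <- index_iota 1 (l - k).+1, i <- index_iota 1 j]
  ++ [seq hyp_diff K l i j (-1)
       | j <- index_iota 1 (l - k).+1, i <- index_iota 1 j]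
  ++ [seq hyp_diff K l (l - k + 1) i 1 | i <- index_iota 1 (l - k).+1]
  ++ [seq hyp_coord K l i s
       | i <- index_iota 1 l.+1,
         s <- int_range (- c%:Z - (minn k (l - i))%:Z)
                        ((d_ p m i)%:Z + (minn (k - 1) (l - i))%:Z)].

Definition cone_exponents (l p c m : nat) : seq nat :=
  let q := (m + l + c - 1)%N in
  1%N :: (q + l - p + 1)%N :: [seq (q + j)%N | j <- index_iota 2 l.+1].

(* Main.v *)
Require Import Defs.
From mathcomp Require Import all_boot all_order all_algebra.
From mathcomp Require Import reals.
From HB Require Import structures.
From mathcomp Require Import finmap mpoly zify ring.
From mathcomp Require boolp.

(** All the freeness statements come from Terao's addition theorem.  Over an
    infinite field, D(A) is the module of polynomial vector fields tangent to
    the hyperplanes of A, which makes it coordinate-free.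

    The arrangements involved are affine gain graphs: hyperplanes
    x_i - x_j = t z on the vertices 0, ..., l with x_0 = 0, plus z = 0, and the
    restriction to one of them contracts the corresponding edge.  For the
    Catalan-like arrangement on n vertices with differences 0, 1, -1 and with
    each x_i in an interval of N integers, adding the next integer to the range
    of one coordinate restricts to the same family on n - 1 vertices with
    intervals of N + 2 integers; hence the exponents 1, N+n-1, ..., N+2n-2 by
    induction.  The other coordinates are joined by modular extensions, except
    that in the hat case the vertex r + 1 may need one last addition.

    For the flag, the coordinates are fixed one after the other, x_1 first, each
    at the lower end of its range: every restriction is again of the same shape
    and loses precisely its largest exponent. *)

Set Implicit Arguments.
Unset Strict Implicit.
Unset Printing Implicit Defensive.

Import Order.TTheory GRing.Theory Num.Theory.

Local Open Scope fset_scope.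
Local Open Scope ring_scope.

(** * Polynomial functions *)

(** Fixing a coordinate has to remove one exponent and leave the others unchanged. Inside the block
    with differences 0, 1, -1, fixing a coordinate at the lower end t0 of its interval creates t0 -
    1 as the only new value of the other block coordinates: N values on n vertices become N + 1
    values on n - 1 vertices, and N + n does not move. A coordinate outside the block loses its edge
    to the fixed vertex and inherits the value t0. The inherited values form the second interval of
    [fam_coord]: it grows downwards while the block is being eliminated and upwards afterwards. A
    vertex can be joined modularly when any two of its edges differ by an edge already present.
    Ranges shrinking with the index guarantee this, but the top value of the vertex r + 1 in the hat
    case can violate it when p <= r, because the block coordinates with index at most p do not reach
    that value. The parameter p enters as a partial step of the Catalan induction: each block index
    above p owns one more hyperplane, and all these hyperplanes raise the same exponent. *)

Section PolynomialFunctions.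
Variable K : numFieldType.
Implicit Types U V W : vectType K.

Definition lin V (f : V -> K) : Prop := forall a u v, f (a *: u + v) = a * f u + f v.

(** Generated by constants and linear forms rather than by coordinates, so that pulling back along a
    linear map needs no choice of basis. [polyfun_ext] stands in for function extensionality. *)
Inductive polyfun V : (V -> K) -> Prop :=
| polyfun_const c : polyfun (fun _ => c)
| polyfun_lin f : lin f -> polyfun f
| polyfunD f g : polyfun f -> polyfun g -> polyfun (fun v => f v + g v)
| polyfunM f g : polyfun f -> polyfun g -> polyfun (fun v => f v * g v)
| polyfun_ext f g : f =1 g -> polyfun f -> polyfun g.

Definition polymap U V (phi : U -> V) : Prop :=
  forall f : V -> K, lin f -> polyfun (fun u => f (phi u)).

Lemma lin0 V (f : V -> K) : lin f -> f 0 = 0.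
Proof. by move=> hf; have := hf (-1) 0 0; rewrite scaler0 addr0 mulN1r addNr. Qed.

Lemma linD V (f : V -> K) u v : lin f -> f (u + v) = f u + f v.
Proof. by move=> hf; rewrite -[u in LHS]scale1r hf mul1r. Qed.

Lemma linZ V (f : V -> K) a u : lin f -> f (a *: u) = a * f u.
Proof. by move=> hf; rewrite -[a *: u]addr0 hf (lin0 hf) addr0. Qed.

Lemma linB V (f : V -> K) u v : lin f -> f (u - v) = f u - f v.
Proof. by move=> hf; rewrite linD // -scaleN1r linZ // mulN1r. Qed.

Lemma lin_sum V (f : V -> K) I (r : seq I) (F : I -> V) : lin f ->
  f (\sum_(i <- r) F i) = \sum_(i <- r) f (F i).
Proof.
move=> hf; elim: r => [|i r IH]; first by rewrite !big_nil lin0.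
by rewrite !big_cons linD // IH.
Qed.

Lemma lin_comp U V (L : {linear U -> V}) (f : V -> K) : lin f -> lin (fun u => f (L u)).
Proof. by move=> hf a u v; rewrite linearP hf. Qed.

Lemma lin_coord V n (b : n.-tuple V) i : lin (fun v => coord b i v : K).
Proof. by move=> a u v; rewrite linearP. Qed.

Lemma polyfunN V (f : V -> K) : polyfun f -> polyfun (fun v => - f v).
Proof.
move=> hf; apply: (polyfun_ext (f := fun v => -1 * f v)); first by move=> v; rewrite mulN1r.
exact: (polyfunM (polyfun_const _ _)).
Qed.

Lemma polyfunB V (f g : V -> K) : polyfun f -> polyfun g -> polyfun (fun v => f v - g v).
Proof. by move=> hf hg; apply: polyfunD => //; apply: polyfunN. Qed.

Lemma polyfun_sum V I (r : seq I) (F : I -> V -> K) :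
  (forall i, polyfun (F i)) -> polyfun (fun v => \sum_(i <- r) F i v).
Proof.
move=> hF; elim: r => [|i r IH].
  by apply: (polyfun_ext (f := fun=> 0)) => [v|]; [rewrite big_nil|exact: polyfun_const].
apply: (polyfun_ext (f := fun v => F i v + \sum_(j <- r) F j v)) => [v|]; first by rewrite big_cons.
exact: polyfunD.
Qed.

Lemma polyfun_prod V I (r : seq I) (F : I -> V -> K) :
  (forall i, polyfun (F i)) -> polyfun (fun v => \prod_(i <- r) F i v).
Proof.
move=> hF; elim: r => [|i r IH].
  by apply: (polyfun_ext (f := fun=> 1)) => [v|]; [rewrite big_nil|exact: polyfun_const].
apply: (polyfun_ext (f := fun v => F i v * \prod_(j <- r) F j v)) => [v|]; first by rewrite big_cons.
exact: polyfunM.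
Qed.

Lemma polyfunX V (f : V -> K) n : polyfun f -> polyfun (fun v => f v ^+ n).
Proof.
move=> hf; elim: n => [|n IH].
  by apply: (polyfun_ext (f := fun=> 1)) => [v|]; [rewrite expr0|exact: polyfun_const].
by apply: (polyfun_ext (f := fun v => f v * f v ^+ n)) => [v|]; [rewrite exprS|exact: polyfunM].
Qed.

Lemma polyfun_comp U V (phi : U -> V) (f : V -> K) :
  polymap phi -> polyfun f -> polyfun (fun u => f (phi u)).
Proof.
move=> hphi; elim=> {f} [c|f hf|f g _ IHf _ IHg|f g _ IHf _ IHg|f g fg _ IHf].
- exact: polyfun_const.
- exact: hphi.
- exact: polyfunD.
- exact: polyfunM.
- by apply: polyfun_ext IHf => u; apply: fg.
Qed.

Lemma polymap_linear U V (L : {linear U -> V}) : polymap L.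
Proof. by move=> f hf; apply: polyfun_lin; apply: lin_comp. Qed.

Lemma polymap_id V : polymap (fun v : V => v).
Proof. by move=> f hf; apply: polyfun_lin. Qed.

Lemma polymap_const U V (k : V) : polymap (fun _ : U => k).
Proof. by move=> f hf; apply: polyfun_const. Qed.

Lemma polymap_ext U V (phi psi : U -> V) : phi =1 psi -> polymap phi -> polymap psi.
Proof. by move=> e h f hf; apply: polyfun_ext (h f hf) => u; rewrite e. Qed.

Lemma polymapD U V (phi psi : U -> V) :
  polymap phi -> polymap psi -> polymap (fun u => phi u + psi u).
Proof.
move=> h1 h2 f hf; apply: (polyfun_ext (f := fun u => f (phi u) + f (psi u))).
  by move=> u; rewrite linD.
by apply: polyfunD; [apply: h1|apply: h2].
Qed.

Lemma polymapZ U V (g : U -> K) (phi : U -> V) :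
  polyfun g -> polymap phi -> polymap (fun u => g u *: phi u).
Proof.
move=> hg h f hf; apply: (polyfun_ext (f := fun u => g u * f (phi u))).
  by move=> u; rewrite linZ.
by apply: polyfunM => //; apply: h.
Qed.

Lemma polymap_sum U V I (r : seq I) (F : I -> U -> V) :
  (forall i, polymap (F i)) -> polymap (fun u => \sum_(i <- r) F i u).
Proof.
move=> hF f hf; apply: (polyfun_ext (f := fun u => \sum_(i <- r) f (F i u))).
  by move=> u; rewrite lin_sum.
by apply: polyfun_sum => i; apply: hF.
Qed.

Lemma polymap_comp U V W (phi : U -> V) (psi : V -> W) :
  polymap phi -> polymap psi -> polymap (fun u => psi (phi u)).
Proof. by move=> h1 h2 f hf; exact: (polyfun_comp h1 (h2 _ hf)). Qed.

Lemma poly_horner_eq0 (p : {poly K}) : (forall t, p.[t] = 0) -> p = 0.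
Proof.
move=> hp; apply/eqP/negPn/negP => p0.
have := max_poly_roots p0 (rs := [seq i%:R | i <- iota 0 (size p)]).
rewrite size_map size_iota ltnn => h; suff: false by []; apply: h.
  by apply/allP => _ /mapP[i _ ->]; rewrite /root hp.
by rewrite map_inj_uniq ?iota_uniq // => i j /eqP; rewrite eqr_nat => /eqP.
Qed.

Lemma poly_horner_inj (p q : {poly K}) : (forall t, p.[t] = q.[t]) -> p = q.
Proof.
by move=> h; apply/eqP; rewrite -subr_eq0; apply/eqP/poly_horner_eq0 => t; rewrite hornerD hornerN h subrr.
Qed.

(** Along the pencil [phi0 u + t *: phi1 u], [f] is a polynomial in t whose coefficients are
    polynomial in u. The degree bound is uniform in u, so the expansion can be summed over a fixed
    index set. *)
Lemma polyfun_pencil U V (phi0 phi1 : U -> V) (f : V -> K) :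
  polymap phi0 -> polymap phi1 -> polyfun f ->
  exists (P : U -> {poly K}) (n : nat),
  [/\ forall u t, f (phi0 u + t *: phi1 u) = (P u).[t],
      forall k, polyfun (fun u => (P u)`_k) & forall u, (size (P u) <= n)%N].
Proof.
move=> h0 h1; elim=> {f} [c|f hf|f g _ [P [n [P1 P2 P3]]] _ [Q [m [Q1 Q2 Q3]]]
   |f g _ [P [n [P1 P2 P3]]] _ [Q [m [Q1 Q2 Q3]]]|f g fg _ [P [n [P1 P2 P3]]]].
- exists (fun=> c%:P), 1%N; split=> [u t|k|u]; [by rewrite hornerC|exact: polyfun_const|].
  by rewrite size_polyC; case: eqP.
- exists (fun u => (f (phi0 u))%:P + (f (phi1 u))%:P * 'X), 2%N; split=> [u t|k|u].
  + by rewrite !hornerE linD // linZ // mulrC.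
  + apply: (polyfun_ext (f := fun u => f (phi0 u) *+ (k == 0)%N + f (phi1 u) *+ (k == 1)%N)).
      move=> u; rewrite coefD coefC coefMX coefC.
      by case: k => [|[|k]] /=; rewrite ?mulr0n ?mulr1n.
    by apply: polyfunD; case: eqP => _; rewrite ?mulr0n ?mulr1n;
      first [exact: h0 | exact: h1 | exact: polyfun_const].
  + apply: (leq_trans (size_polyD _ _)); rewrite geq_max; apply/andP; split.
      by rewrite size_polyC; case: eqP.
    by apply: (leq_trans (size_polyMleq _ _)); rewrite size_polyX size_polyC; case: eqP.
- exists (fun u => P u + Q u), (maxn n m); split=> [u t|k|u].
  + by rewrite hornerD P1 Q1.
  + apply: (polyfun_ext (f := fun u => (P u)`_k + (Q u)`_k)) => [u|]; first by rewrite coefD.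
    exact: polyfunD.
  + by apply: (leq_trans (size_polyD _ _)); rewrite geq_max !leq_max P3 Q3 orbT.
- exists (fun u => P u * Q u), (n + m)%N; split=> [u t|k|u].
  + by rewrite hornerM P1 Q1.
  + apply: (polyfun_ext (f := fun u => \sum_(i < k.+1) (P u)`_i * (Q u)`_(k - i))) => [u|].
      by rewrite coefM.
    by apply: polyfun_sum => i; apply: polyfunM.
  + by apply: (leq_trans (size_polyMleq _ _)); apply: (leq_trans (leq_pred _)); apply: leq_add.
- by exists P, n; split=> // u t; rewrite -fg.
Qed.

Lemma polyfun_line V (f : V -> K) u w : polyfun f ->
  exists p : {poly K}, forall t, f (u + t *: w) = p.[t].
Proof.
move=> hf; have [P [n [hP _ _]]] := polyfun_pencil (polymap_const V u) (polymap_const V w) hf.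
by exists (P 0) => t; rewrite -hP.
Qed.

(** Polynomial functions on a subspace form a domain: on the line from [v0] to [v] the product of
    two one-variable polynomials vanishes while the first factor is nonzero. *)
Lemma polyfun_domain V (H : {vspace V}) (f g : V -> K) v0 :
  polyfun f -> polyfun g -> (forall v, v \in H -> f v * g v = 0) ->
  v0 \in H -> f v0 != 0 -> forall v, v \in H -> g v = 0.
Proof.
move=> hf hg fg0 v0H fv0 v vH.
have [p hp] := polyfun_line v0 (v - v0) hf; have [q hq] := polyfun_line v0 (v - v0) hg.
have pq0 : p * q = 0.
  apply: poly_horner_eq0 => t; rewrite hornerM -hp -hq; apply: fg0.
  by rewrite memvD // memvZ // memvB.
have p0 : p != 0 by apply/eqP => p0; move: fv0; rewrite -[v0]addr0 -(scale0r (v - v0)) hp p0 horner0 eqxx.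
move/eqP: pq0; rewrite mulf_eq0 (negPf p0) /= => /eqP q0.
by have := hq 1; rewrite scale1r subrKC q0 horner0.
Qed.

(** [v - al v *: e] is the projection to the kernel of [al] along [e]. The quotient is built by
    induction on [f]; for products it comes from fg - f'g' = (f - f')g + f'(g - g'). *)
Lemma polyfun_div V (al : V -> K) e (f : V -> K) : lin al -> al e = 1 -> polyfun f ->
  exists2 g, polyfun g & forall v, f v - f (v - al v *: e) = al v * g v.
Proof.
move=> hal ale.
pose pr v := v - al v *: e.
have hpr : polymap pr.
  move=> h hh; apply: (polyfun_ext (f := fun v => h v - al v * h e)).
    by move=> v; rewrite linB // linZ.
  by apply: polyfunB; [exact: polyfun_lin|apply: polyfunM; [exact: polyfun_lin|exact: polyfun_const]].
elim=> {f} [c|f hf|f g _ [F hF F1] _ [G hG G1]|f g pf [F hF F1] pg [G hG G1]|f g fg _ [F hF F1]].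
- by exists (fun=> 0) => [|v]; [exact: polyfun_const|rewrite subrr mulr0].
- by exists (fun=> f e) => [|v]; [exact: polyfun_const|rewrite linB // linZ //; ring].
- exists (fun v => F v + G v) => [|v]; first exact: polyfunD.
  by rewrite mulrDr -F1 -G1; ring.
- exists (fun v => F v * g v + f (pr v) * G v) => [|v].
    by apply: polyfunD; apply: polyfunM => //; apply: (polyfun_comp hpr).
  by rewrite mulrDr mulrA -F1 mulrCA -G1 /pr; ring.
- by exists F => // v; rewrite -F1 !fg.
Qed.

Lemma polyfun_div_ker V (al : V -> K) e (f : V -> K) : lin al -> al e = 1 -> polyfun f ->
  (forall v, al v = 0 -> f v = 0) -> exists2 g, polyfun g & forall v, f v = al v * g v.
Proof.
move=> hal ale hf f0; have [g hg fg] := polyfun_div hal ale hf; exists g => // v.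
by rewrite -fg (f0 (v - _)) ?subr0 // linB // linZ // ale mulr1 subrr.
Qed.

Lemma vbasis_expand V (v : V) : v = \sum_i coord (vbasis {:V}) i v *: (vbasis {:V})`_i.
Proof. by rewrite {1}(coord_vbasis (memvf v)). Qed.

Lemma polymap_div_ker U V (al : U -> K) e (phi : U -> V) : lin al -> al e = 1 -> polymap phi ->
  (forall v, al v = 0 -> phi v = 0) -> exists2 psi, polymap psi & forall v, phi v = al v *: psi v.
Proof.
move=> hal ale hf f0.
have: forall i, exists g : U -> K, polyfun g /\ forall v, coord (vbasis {:V}) i (phi v) = al v * g v.
  move=> i; have [|g hg e1] := polyfun_div_ker hal ale (hf _ (lin_coord (vbasis {:V}) i)).
    by move=> v /f0 ->; rewrite linear0.
  by exists g.
move=> /fin_all_exists[g hg].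
exists (fun u => \sum_i g i u *: (vbasis {:V})`_i).
  by apply: polymap_sum => i; apply: polymapZ; [case: (hg i)|apply: polymap_const].
move=> v; rewrite [LHS]vbasis_expand scaler_sumr; apply: eq_bigr => i _.
by case: (hg i) => _ ->; rewrite scalerA.
Qed.

Definition homogeneous V W (d : nat) (f : V -> W) : Prop := forall c v, f (c *: v) = c ^+ d *: f v.
Definition homfun V (d : nat) (f : V -> K) : Prop := forall c v, f (c *: v) = c ^+ d * f v.

(** The coefficient of t^k in f(tv) is the homogeneous component of degree k of f; homogeneity
    follows by comparing f(t(cv)) with f((tc)v). *)
Lemma homfun_part V (f : V -> K) : polyfun f -> exists P : V -> {poly K},
  [/\ forall k, polyfun (fun v => (P v)`_k), forall k, homfun k (fun v => (P v)`_k)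
    & forall v t, f (t *: v) = (P v).[t]].
Proof.
move=> hf; have [P [n [P1 P2 _]]] := polyfun_pencil (polymap_const V 0) (@polymap_id V) hf.
exists P; split=> // [k c v|v t]; last by rewrite -[t *: v]add0r P1.
suff -> : P (c *: v) = P v \Po (c *: 'X).
  rewrite comp_polyE coef_sum.
  rewrite (eq_bigr (fun i : 'I__ => (P v)`_i * c ^+ i * (k == i)%:R)); last first.
    by move=> i _; rewrite exprZn scalerA coefZ coefXn.
  case: (ltnP k (size (P v))) => kP.
    rewrite (bigD1 (Ordinal kP)) //= eqxx mulr1 big1 ?addr0 1?mulrC // => i /eqP ik.
    by rewrite (_ : (k == i) = false) ?mulr0 //; apply/eqP => e; apply: ik; apply: val_inj.
  rewrite nth_default // mulr0 big1 // => i _.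
  by rewrite (_ : (k == i) = false) ?mulr0 //; apply/eqP => e; move: (ltn_ord i); rewrite -e ltnNge kP.
apply: poly_horner_inj => t; rewrite horner_comp !hornerE -!P1 !add0r scalerA mulrC //.
Qed.

End PolynomialFunctions.

(** * Logarithmic vector fields *)

Section Mpoly.
Variable K : numFieldType.

Lemma mpoly_ring_ind n (Q : {mpoly K[n]} -> Prop) :
  (forall c, Q c%:MP) -> (forall i, Q 'X_i) -> (forall p q, Q p -> Q q -> Q (p + q)) ->
  (forall p q, Q p -> Q q -> Q (p * q)) -> forall p, Q p.
Proof.
move=> QC QX QD QM p; rewrite [p]mpolyE; apply: big_ind => [|//|m _].
  by rewrite -mpolyC0.
rewrite -mul_mpolyC; apply: (QM) => //; rewrite mpolyXE_id.
apply: big_ind => [|//|i _]; first by rewrite -mpolyC1.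
elim: (m i) => [|k IH]; first by rewrite expr0 -mpolyC1.
by rewrite exprS; apply: QM.
Qed.

Lemma digits_inj n N (f g : 'I_n -> nat) :
  (forall i, f i < N)%N -> (forall i, g i < N)%N ->
  (\sum_i f i * N ^ i = \sum_i g i * N ^ i)%N -> f =1 g.
Proof.
elim: n f g => [|n IH] f g hf hg; first by move=> _ [].
have e (h : 'I_n.+1 -> nat) :
    (\sum_i h i * N ^ i = (\sum_(i < n) h (lift ord0 i) * N ^ i) * N + h ord0)%N.
  rewrite big_ord_recl /= expn0 muln1 addnC big_distrl /=; congr (_ + _)%N.
  by apply: eq_bigr => i _; rewrite /bump /= add1n expnSr mulnA.
rewrite !e => fg.
have fg0 : f ord0 = g ord0.
  by have := congr1 (modn^~ N) fg; rewrite !modnMDl !modn_small.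
move: fg; rewrite fg0 => /eqP; rewrite eqn_add2r eqn_pmul2r; last first.
  by apply: leq_ltn_trans (hf ord0).
move=> /eqP /IH h i; case: (unliftP ord0 i) => [j|] -> //.
by apply: h => j'.
Qed.

(** Kronecker substitution: with N above every exponent in the support, x_i = t^(N^i) sends distinct
    monomials to distinct powers of t, by uniqueness of digits in base N. *)
Lemma mpoly_eval_eq0 n (p : {mpoly K[n]}) : (forall c, p.@[c] = 0) -> p = 0.
Proof.
move=> hp.
pose N := (\max_(m <- msupp p) \max_i m i).+1.
have mN m i : m \in msupp p -> (m i < N)%N.
  move=> mp; rewrite ltnS (bigD1_seq m) ?msupp_uniq //=.
  by rewrite (leq_trans _ (leq_maxl _ _)) // leq_bigmax.
pose kap (m : 'X_{1..n}) := (\sum_i m i * N ^ i)%N.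
pose q : {poly K} := \sum_(m <- msupp p) p@_m *: 'X^(kap m).
have q0 : q = 0.
  apply: poly_horner_eq0 => t; rewrite -(hp (fun i => t ^+ (N ^ i))) mevalE horner_sum.
  apply: eq_bigr => m _; rewrite hornerZ hornerXn; congr (_ * _).
  rewrite /kap (big_morph _ (exprD t) (expr0 t)).
  by apply: eq_bigr => i _; rewrite -exprM mulnC.
apply/mpolyP => m; rewrite mcoeff0.
case: (boolP (m \in msupp p)) => mp; last by rewrite memN_msupp_eq0.
have := congr1 (fun r : {poly K} => r`_(kap m)) q0.
rewrite coef0 coef_sum (bigD1_seq m) ?msupp_uniq //= coefZ coefXn eqxx mulr1 big_seq_cond big1 ?addr0 //.
move=> m' /andP[m'p /eqP m'm]; rewrite coefZ coefXn; case: eqP => [e|]; rewrite ?mulr0 //.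
case: m'm; apply/mnmP => i; apply: (@digits_inj n N (fun i => m' i) (fun i => m i)) => // j; exact: mN.
Qed.

Lemma mpoly_linear_form n (p : {mpoly K[n]}) : p \is 1.-homog ->
  p = \sum_i p@_U_(i) *: 'X_i.
Proof.
move=> /dhomogP hp; apply/mpolyP => m; rewrite raddf_sum /=.
rewrite (eq_bigr (fun i => p@_U_(i) * (U_(i) == m)%MM%:R)); last first.
  by move=> i _; rewrite mcoeffZ mcoeffX.
case: (boolP (m \in msupp p)) => [/hp /eqP|mp].
  rewrite /= mdeg_eq1 => /existsP[i /eqP ->].
  rewrite (bigD1 i) //= eqxx mulr1 big1 ?addr0 // => j ji.
  by rewrite eq_mnm1 (negPf ji) mulr0.
rewrite memN_msupp_eq0 // big1 // => i _; case: eqP => [e|]; rewrite ?mulr0 //.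
by rewrite e memN_msupp_eq0 // mul0r.
Qed.

End Mpoly.

(** * Derivations as polynomial vector fields *)

Section VectorFields.
Variables (K : numFieldType) (V : vectType K).
Local Notation n := (\dim {:V}).
Local Notation b := (vbasis {:V}).
Local Notation crd v := (fun i => coord b i v).
Local Notation ev p v := (p.@[crd v]).
Implicit Types (p q : {mpoly K[n]}) (th : {mpoly K[n]} -> {mpoly K[n]}).

Definition vfield th (v : V) : V := \sum_i ev (th 'X_i) v *: b`_i.

Lemma polyfun_ev p : polyfun (fun v : V => ev p v).
Proof.
elim/mpoly_ring_ind: p => [c|i|p q hp hq|p q hp hq].
- by apply: (polyfun_ext _ (polyfun_const V c)) => v; rewrite mevalC.
- by apply: (polyfun_ext _ (polyfun_lin (lin_coord b i))) => v; rewrite mevalXU.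
- by apply: (polyfun_ext _ (polyfunD hp hq)) => v; rewrite mevalD.
- by apply: (polyfun_ext _ (polyfunM hp hq)) => v; rewrite mevalM.
Qed.

Lemma coord_comb (c : 'I_n -> K) i : coord b i (\sum_j c j *: b`_j) = c i.
Proof. by rewrite coord_sum_free // (basis_free (vbasisP _)). Qed.

Lemma ev_eq0 p : (forall v, ev p v = 0) -> p = 0.
Proof.
move=> h; apply: mpoly_eval_eq0 => c; rewrite -(h (\sum_j c j *: b`_j)).
by apply: meval_eq => i; rewrite coord_comb.
Qed.

Lemma ev_inj p q : (forall v, ev p v = ev q v) -> p = q.
Proof.
by move=> h; apply/eqP; rewrite -subr_eq0; apply/eqP/ev_eq0 => v; rewrite mevalB h subrr.
Qed.

Definition form_of (al : V -> K) : {mpoly K[n]} := \sum_(i < n) al b`_i *: 'X_i.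

Lemma ev_form_of al v : lin al -> ev (form_of al) v = al v.
Proof.
move=> hal; rewrite /form_of raddf_sum /= [in RHS](vbasis_expand v) lin_sum //.
by apply: eq_bigr => i _; rewrite mevalZ mevalXU linZ // mulrC.
Qed.

Lemma polyfun_mpoly f : polyfun f -> exists p, forall v, f v = ev p v.
Proof.
elim=> {f} [c|f hf|f g _ [p hp] _ [q hq]|f g _ [p hp] _ [q hq]|f g fg _ [p hp]].
- by exists c%:MP => v; rewrite mevalC.
- by exists (form_of f) => v; rewrite ev_form_of.
- by exists (p + q) => v; rewrite mevalD hp hq.
- by exists (p * q) => v; rewrite mevalM hp hq.
- by exists p => v; rewrite -fg.
Qed.

Lemma derivation_chain th p : derivation th -> th p = \sum_i th 'X_i * p^`M(i).
Proof.
move=> [hlin hM].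
have thD p1 p2 : th (p1 + p2) = th p1 + th p2 by have := hlin 1 p1 p2; rewrite !scale1r.
have th0 : th 0 = 0 by have := thD 0 0; rewrite addr0 -{1}[th 0]addr0 => /addrI.
have thZ a p1 : th (a *: p1) = a *: th p1 by have := hlin a p1 0; rewrite !addr0 th0 addr0.
have th1 : th 1 = 0.
  by have := hM 1 1; rewrite !mul1r !mulr1 -{1}[th 1]addr0 => /addrI.
elim/mpoly_ring_ind: p => [c|i|p q hp hq|p q hp hq].
- rewrite -[c%:MP]mulr1 mul_mpolyC thZ th1 scaler0 big1 // => i _.
  by rewrite -mul_mpolyC mulr1 mderivC mulr0.
- rewrite (bigD1 i) //= mderivX mnm1E eqxx scale1r.
  rewrite (_ : (U_(i) - U_(i))%MM = 0%MM); last by apply/mnmP => j; rewrite mnmBE subnn mnm0E.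
  rewrite mpolyX0 mulr1 big1 ?addr0 // => j ji.
  by rewrite mderivX mnm1E eq_sym (negPf ji) scale0r mulr0.
- by rewrite thD hp hq -big_split; apply: eq_bigr => i _; rewrite mderivD mulrDr.
- rewrite hM hp hq mulr_suml mulr_sumr -big_split; apply: eq_bigr => i _.
  by rewrite mderivM /=; ring.
Qed.

Definition der_of (P : 'I_n -> {mpoly K[n]}) p : {mpoly K[n]} := \sum_i P i * p^`M(i).

Lemma der_of_derivation P : derivation (der_of P).
Proof.
split=> [a p q|p q]; rewrite /der_of.
  rewrite scaler_sumr -big_split; apply: eq_bigr => i _.
  by rewrite mderivD mderivZ mulrDr scalerAr.
rewrite mulr_suml mulr_sumr -big_split; apply: eq_bigr => i _.
by rewrite mderivM /=; ring.
Qed.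

Lemma mderivXU (i j : 'I_n) : ('X_j : {mpoly K[n]})^`M(i) = (i == j)%:R.
Proof.
rewrite mderivX mnm1E eq_sym; case: eqP => [->|_]; last by rewrite scale0r.
rewrite scale1r (_ : (U_(j) - U_(j))%MM = 0%MM) ?mpolyX0 //.
by apply/mnmP => k; rewrite mnmBE subnn mnm0E.
Qed.

Lemma der_ofX P i : der_of P 'X_i = P i.
Proof.
rewrite /der_of (bigD1 i) //= mderivXU eqxx mulr1 big1 ?addr0 // => j ji.
by rewrite mderivXU (negPf ji) mulr0.
Qed.

Lemma vfield_polymap th : polymap (vfield th).
Proof.
apply: polymap_sum => i; apply: polymapZ; [exact: polyfun_ev|exact: polymap_const].
Qed.

Lemma polymap_der_of (phi : V -> V) : polymap phi ->
  exists P, vfield (der_of P) =1 phi.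
Proof.
move=> hphi.
have: forall i, exists p, forall v, coord b i (phi v) = ev p v.
  by move=> i; apply: polyfun_mpoly; apply: hphi; apply: lin_coord.
move=> /fin_all_exists[P hP]; exists P => v.
by rewrite [RHS]vbasis_expand; apply: eq_bigr => i _; rewrite der_ofX hP.
Qed.

(** A linear form has constant partial derivatives, so applying the derivation to it amounts to
    evaluating the form on the vector field. This turns divisibility conditions into tangency. *)
Lemma ev_derivation_form th al p v : derivation th -> lin al -> p \is 1.-homog ->
  (forall v, ev p v = al v) -> ev (th p) v = al (vfield th v).
Proof.
move=> hth hal hp pal; have -> : p = form_of al by apply: ev_inj => w; rewrite ev_form_of.
rewrite (derivation_chain _ hth) raddf_sum /= lin_sum //.
apply: eq_bigr => i _; rewrite mevalM linZ //; congr (_ * _).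
suff -> : (form_of al)^`M(i) = (al b`_i)%:MP by rewrite mevalC.
rewrite /form_of raddf_sum /= (bigD1 i) //= big1 ?addr0.
  by rewrite mderivZ mderivXU eqxx -mul_mpolyC mulr1.
by move=> j ji; rewrite mderivZ mderivXU eq_sym (negPf ji) scaler0.
Qed.

Lemma lin_dual (e : V) : e != 0 -> exists2 f : V -> K, lin f & f e = 1.
Proof.
rewrite -seq1_free => e_free; exists (fun v => coord [tuple e] ord0 v); first exact: lin_coord.
by rewrite (coord_free ord0 ord0 e_free) eqxx.
Qed.

Lemma hyperplane_form (H : {vspace V}) : (\dim H).+1 = n ->
  exists al e, [/\ lin al, al e = 1 & forall v : V, (v \in H) = (al v == 0)].
Proof.
move=> dH; set U := (H^C)%VS.
have dU : \dim U = 1%N by rewrite dimv_compl -dH subSnn.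
set e := vpick U.
have e0 : e != 0 by rewrite vpick0 -dimv_eq0 dU.
have Ue : U = <[e]>%VS.
  apply/eqP; rewrite eq_sym eqEdim dU dim_vline e0 leqnn andbT.
  by rewrite -memvE memv_pick.
have HU : (H :&: U = 0)%VS by exact: capv_compl.
have UH : (U :&: H = 0)%VS by rewrite capvC.
have [f fl fe] := lin_dual e0.
pose al v := f (daddv_pi U H v).
have alE v : daddv_pi U H v = al v *: e.
  have := memv_pi U H v; rewrite {2}Ue => /vlineP[c hc].
  by rewrite /al hc linZ // fe mulr1.
exists al, e; split=> [||v].
- by apply: lin_comp.
- by rewrite /al daddv_pi_id //; exact: memv_pick.
- have wE : al v *: e + daddv_pi H U v = v.
    by rewrite -alE daddv_pi_add // addvC addv_complf memvf.
  apply/idP/eqP => [vH|al0]; last by rewrite -wE al0 scale0r add0r memv_pi.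
  have : al v *: e \in (H :&: U)%VS.
    rewrite memv_cap; apply/andP; split; last by rewrite memvZ // memv_pick.
    by rewrite -[al v *: e](addrK (daddv_pi H U v)) wE memvB // memv_pi.
  by rewrite HU memv0 scaler_eq0 (negPf e0) orbF => /eqP.
Qed.

Lemma form_of_defining (H : {vspace V}) al : lin al ->
  (forall v : V, (v \in H) = (al v == 0)) -> defining_form H (form_of al).
Proof.
move=> hal hH; split=> [|v]; last by rewrite ev_form_of.
apply: rpred_sum => i _; apply: dhomogZ; by rewrite dhomogX /= mdeg1.
Qed.

Definition logvf (A : {fset {vspace V}}) (phi : V -> V) : Prop :=
  polymap phi /\ forall H, H \in A -> forall v, v \in H -> phi v \in H.

(* Over an infinite field a polynomial is divisible by a linear form as soon as
   it vanishes on its kernel: D(A) consists of the polynomial vector fields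
   that are tangent to every hyperplane. *)
Lemma log_derivationP (A : {fset {vspace V}}) th : is_arrangement A -> derivation th ->
  (log_derivation A th <-> logvf A (vfield th)).
Proof.
move=> hA hth; split=> [[_ h]|[_ h]]; split=> //.
- exact: vfield_polymap.
- move=> H HA v vH; have [al [e [hal ale Hal]]] := hyperplane_form (hA _ HA).
  have hdef := form_of_defining hal Hal.
  have [g hg] := h _ _ HA hdef.
  rewrite Hal -(ev_derivation_form v hth hal hdef.1) => [|w]; last by rewrite ev_form_of.
  by rewrite hg mevalM ev_form_of //; move: vH; rewrite Hal => /eqP ->; rewrite mul0r.
- move=> H p HA [hp Hp]; have [al [e [hal ale Hal]]] := hyperplane_form (hA _ HA).
  have lp : lin (fun v => ev p v).
    rewrite (mpoly_linear_form hp) => a u v; rewrite !raddf_sum /= mulr_sumr -big_split.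
    by apply: eq_bigr => i _; rewrite !mevalZ !mevalXU linearP /= mulrDr mulrCA.
  have e0 : ev p e != 0 by rewrite -Hp Hal ale oner_eq0.
  have [|v p0|g hg] := @polyfun_div_ker _ _ (fun v => ev p v) ((ev p e)^-1 *: e) (fun v => ev (th p) v) lp _ (polyfun_ev _).
  + by rewrite (linZ _ _ lp) mulVf.
  + have vH : v \in H by rewrite Hp p0.
    by rewrite (ev_derivation_form v hth lp hp) //; apply/eqP; rewrite -Hp; apply: h.
  + move=> pg; have [q hq] := polyfun_mpoly hg; exists q; apply: ev_inj => v.
    by rewrite mevalM -hq.
Qed.

Lemma homog_evP d p : p \is d.-homog <-> homfun d (fun v : V => ev p v).
Proof.
split=> [/dhomogP hp c v|hp].
  rewrite !mevalE mulr_sumr big_seq [RHS]big_seq; apply: eq_bigr => m /hp hm.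
  rewrite mulrCA; congr (_ * _); rewrite -hm /= mdegE (big_morph _ (exprD c) (expr0 c)) -big_split.
  by apply: eq_bigr => i _; rewrite linearZ /= exprMn.
(* Comparing p(2v) with 2^d p(v) shows that this polynomial vanishes; in characteristic 0 a monomial
   survives in [p] only if 2 to its degree equals 2^d. *)
pose q : {mpoly K[n]} := \sum_(m <- msupp p) (p@_m * (2%:R ^+ mdeg m - 2%:R ^+ d)) *: 'X_[m].
have q0 : q = 0.
  apply: ev_eq0 => v; rewrite raddf_sum /=.
  have := hp 2%:R v; rewrite !mevalE mulr_sumr => /eqP; rewrite -subr_eq0 -sumrB => /eqP e.
  rewrite -[RHS]e; apply: eq_bigr => m _.
  rewrite mevalZ mevalX mdegE (big_morph _ (exprD _) (expr0 _)).
  rewrite mulrBr mulrBl; congr (_ - _); last by rewrite mulrAC mulrC.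
  rewrite -mulrA -big_split; congr (_ * _).
  by apply: eq_bigr => i _; rewrite linearZ /= exprMn.
apply/dhomogP => m mp /=.
have := congr1 (mcoeff m) q0; rewrite mcoeff0 raddf_sum /= (bigD1_seq m) ?msupp_uniq //=.
rewrite mcoeffZ mcoeffX eqxx mulr1 big1 ?addr0; last first.
  by move=> m' m'm; rewrite mcoeffZ mcoeffX (negPf m'm) mulr0.
move=> /eqP; rewrite mulf_eq0 mcoeff_eq0 mp /= subr_eq0 -!natrX eqr_nat eqn_exp2l //.
by move=> /eqP.
Qed.

(** Indexed by any finite type, so that replacing a basis element, or adding one with index [None],
    requires no renumbering. *)
Definition fbasis (I : finType) (d : I -> nat) (A : {fset {vspace V}}) (phi : I -> V -> V) : Prop :=
  [/\ forall i, logvf A (phi i), forall i, homogeneous (d i) (phi i),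
      forall eta, logvf A eta -> exists g : I -> V -> K,
        (forall i, polyfun (g i)) /\ forall v, eta v = \sum_i g i v *: phi i v
    & forall g : I -> V -> K, (forall i, polyfun (g i)) ->
        (forall v, \sum_i g i v *: phi i v = 0) -> forall i v, g i v = 0].

Lemma free_fbasis A es : is_arrangement A -> free_with_exponents A es ->
  exists phi, @fbasis 'I_(size es) (fun j => nth 0%N es j) A phi.
Proof.
move=> hA [th [h1 h2 h3]].
have hd j : derivation (th j) := (h1 j).1.
exists (fun j => vfield (th j)); split.
- by move=> j; apply/log_derivationP.
- move=> j c v; rewrite /vfield scaler_sumr; apply: eq_bigr => i _.
  by rewrite ((homog_evP _ _).1 (h2 j i)) scalerA.
- move=> eta heta; have [P hP] := polymap_der_of heta.1.
  have [|g [hg _]] := h3 (der_of P).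
    apply/log_derivationP => //; first exact: der_of_derivation.
    by split=> [|H HA v vH]; [exact: vfield_polymap|rewrite hP; apply: heta.2].
  exists (fun j v => ev (g j) v); split=> [j|v]; first exact: polyfun_ev.
  rewrite -hP /vfield; under eq_bigr do rewrite hg raddf_sum /= scaler_suml.
  rewrite exchange_big; apply: eq_bigr => j _; rewrite scaler_sumr; apply: eq_bigr => i _.
  by rewrite mevalM scalerA.
- move=> g hg g0.
  have /fin_all_exists[P hP] : forall j, exists p, forall v, g j v = ev p v.
    by move=> j; apply: polyfun_mpoly.
  (* Independence is obtained from uniqueness of coefficients for the zero derivation, which both
     the zero family and [P] represent. *)
  have d0 : derivation (fun _ : {mpoly K[n]} => 0 : {mpoly K[n]}).
    by split=> [a p q|p q]; rewrite ?scaler0 ?mul0r ?mulr0 addr0.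
  have [|g' [_ uni]] := h3 (fun _ => 0).
    by split=> // H al _ _; exists 0; rewrite mulr0.
  have e1 : g' = [ffun=> 0].
    by apply: uni => f; rewrite big1 // => j _; rewrite ffunE mul0r.
  have e2 : g' = [ffun j => P j].
    apply: uni => f; rewrite (eq_bigr (fun j => \sum_i P j * th j 'X_i * f^`M(i))); last first.
      by move=> j _; rewrite ffunE (derivation_chain f (hd j)) mulr_sumr; apply: eq_bigr => i _; rewrite mulrA.
    rewrite exchange_big big1 // => i _; rewrite -mulr_suml.
    suff -> : \sum_j P j * th j 'X_i = 0 by rewrite mul0r.
    apply: ev_eq0 => v; rewrite raddf_sum /=.
    have := congr1 (fun w => coord b i w) (g0 v); rewrite linear0 linear_sum /= => e.
    rewrite -[RHS]e; apply: eq_bigr => j _.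
    by rewrite mevalM -hP linearZ /= /vfield coord_comb.
  move=> j v; rewrite hP; have := congr1 (fun G : {ffun _} => G j) e2; rewrite e1 !ffunE => <-.
  by rewrite meval0.
Qed.

Lemma fbasis_free_ord A es phi : is_arrangement A ->
  @fbasis 'I_(size es) (fun j => nth 0%N es j) A phi -> free_with_exponents A es.
Proof.
move=> hA [h1 h2 h3 h4].
have: forall j, exists P, vfield (der_of P) =1 phi j.
  by move=> j; apply: polymap_der_of; case: (h1 j).
move=> /fin_all_exists[P hP].
exists (fun j => der_of (P j)); split.
- move=> j; apply/log_derivationP => //; first exact: der_of_derivation.
  by split=> [|H HA v vH]; [exact: vfield_polymap|rewrite hP; apply: (h1 j).2].
- move=> j i; apply/homog_evP => c v.
  have hc w : ev (der_of (P j) 'X_i) w = coord b i (phi j w) by rewrite -hP coord_comb.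
  by rewrite !hc h2 linearZ.
- move=> eta heta; have he : derivation eta := heta.1.
  have [g [hg ge]] := h3 _ ((log_derivationP hA he).1 heta).
  have /fin_all_exists[G hG] : forall j, exists p, forall v, g j v = ev p v.
    by move=> j; apply: polyfun_mpoly.
  have hX j i w : ev (der_of (P j) 'X_i) w = coord b i (phi j w) by rewrite -hP coord_comb.
  exists [ffun j => G j]; split.
    move=> f; rewrite (derivation_chain f he).
    rewrite (eq_bigr (fun i => \sum_j G j * der_of (P j) 'X_i * f^`M(i))).
      rewrite exchange_big; apply: eq_bigr => j _; rewrite ffunE.
      rewrite (derivation_chain f (der_of_derivation (P j))) mulr_sumr.
      by apply: eq_bigr => i _; rewrite mulrA.
    move=> i _; rewrite -mulr_suml; congr (_ * _); apply: ev_inj => v.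
    have -> : ev (eta 'X_i) v = coord b i (vfield eta v) by rewrite coord_comb.
    rewrite ge linear_sum raddf_sum /=; apply: eq_bigr => j _.
    by rewrite linearZ /= mevalM hX hG.
  move=> g' hg'; apply/ffunP => j; rewrite ffunE; apply/eqP; rewrite -subr_eq0; apply/eqP/ev_eq0 => v.
  pose D j v := g j v - ev (g' j) v.
  suff D0 : D j v = 0 by rewrite mevalB -hG.
  apply: (h4 D) => {j v} [j|v].
    by apply: polyfunB; [exact: hg|exact: polyfun_ev].
  rewrite /D; under eq_bigr do rewrite scalerBl.
  rewrite sumrB -ge; apply/eqP; rewrite subr_eq0; apply/eqP.
  rewrite /vfield; under eq_bigr do rewrite hg' raddf_sum /= scaler_suml.
  rewrite exchange_big; apply: eq_bigr => j _.
  rewrite -hP /vfield scaler_sumr; apply: eq_bigr => i _.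
  by rewrite mevalM scalerA.
Qed.

Lemma fbasis_reindex (I J : finType) (h : J -> I) d A phi : bijective h ->
  fbasis d A phi -> fbasis (fun j => d (h j)) A (fun j => phi (h j)).
Proof.
move=> hb [h1 h2 h3 h4]; have [k hk kh] := hb.
have hbi : {on [pred i | true], bijective h} by apply: onW_bij.
split=> // [eta /h3[g [hg ge]]|g hg g0 j v].
  exists (fun j => g (h j)); split=> // v.
  by rewrite ge (reindex h).
have := h4 (fun i => g (k i)) (fun i => hg (k i)) _ (h j) v; rewrite hk; apply=> w.
by rewrite (reindex h) // -[RHS](g0 w); apply: eq_bigr => i _; rewrite hk.
Qed.

Lemma fbasis_free (I : finType) (d : I -> nat) A phi es : is_arrangement A ->
  fbasis d A phi -> perm_eq es [seq d i | i <- enum I] -> free_with_exponents A es.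
Proof.
move=> hA hphi hperm.
have [s hs esE] : exists2 s, perm_eq s (enum I) & es = map d s.
  have /(perm_iotaP 0%N)[Is] := hperm; rewrite size_map => hIs esE.
  case eI: (enum I) => [|i0 r].
    by exists [::] => //; move: hperm; rewrite eI => /perm_nilP.
  exists (map (nth i0 (enum I)) Is).
    rewrite -eI -[X in perm_eq _ X](mkseq_nth i0 (enum I)); exact: perm_map.
  rewrite esE -map_comp; apply/eq_in_map => k.
  by rewrite (perm_mem hIs) mem_iota add0n /= => hk; rewrite (nth_map i0).
have e : size es = size s by rewrite esE size_map.
have hbij : bijective (fun j : 'I_(size es) => tnth (in_tuple s) (cast_ord e j)).
  have si i : (index i s < size s)%N by rewrite index_mem (perm_mem hs) mem_enum.
  exists (fun i => cast_ord (esym e) (Ordinal (si i))) => [j|i].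
    apply: val_inj; rewrite /= (tnth_nth (tnth (in_tuple s) (cast_ord e j))) /= index_uniq -?e //.
    by rewrite (perm_uniq hs) enum_uniq.
  by rewrite (tnth_nth i) /= nth_index // (perm_mem hs) mem_enum.
have [h1 h2 h3 h4] := fbasis_reindex hbij hphi.
apply: (fbasis_free_ord hA (phi := fun j => phi (tnth (in_tuple s) (cast_ord e j)))).
split=> // j; have := h2 j; congr homogeneous.
set i0 := tnth _ _.
by rewrite (congr1 (fun l => nth 0%N l j) esE) (nth_map i0) -?e // {1}/i0 (tnth_nth i0).
Qed.

End VectorFields.

(** * The addition theorem *)

Section Dependence.
Variables (K : numFieldType) (W : vectType K) (I J : finType).

(** Gaussian elimination without division, over the domain of polynomial functions: more rows than
    columns admit a nontrivial syzygy. A pivot in column [j0] clears that column by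
    cross-multiplication, and induction handles the remaining columns. *)
Lemma polyfun_dependence (g : I -> J -> W -> K) (P : {set I}) (Q : {set J}) :
  (forall i j, polyfun (g i j)) -> (#|Q| < #|P|)%N ->
  exists c : I -> W -> K,
  [/\ forall i, polyfun (c i), exists i v, c i v != 0,
      forall i v, i \notin P -> c i v = 0
    & forall j v, j \in Q -> \sum_i c i v * g i j v = 0].
Proof.
move: {2}#|Q| (erefl #|Q|) => n; elim: n Q g P => [|n IH] Q g P hQ hg.
  rewrite hQ => /card_gt0P[i0 i0P]; exists (fun i _ => (i == i0)%:R); split.
  - by move=> i; apply: polyfun_const.
  - by exists i0, 0; rewrite eqxx oner_eq0.
  - by move=> i v; case: eqP => // ->; rewrite i0P.
  - by move=> j v; rewrite (cards0_eq hQ) inE.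
move=> PQ; have /card_gt0P[j0 j0Q] : (0 < #|Q|)%N by rewrite hQ.
have hQ' : #|Q :\ j0| = n by move: hQ; rewrite (cardsD1 j0) j0Q => -[].
have [[i0 [i0P [v0 gv0]]]|no] := boolp.pselect (exists i0, i0 \in P /\ exists v, g i0 j0 v != 0); last first.
  have [|c [c1 c2 c3 c4]] := IH _ g P hQ' hg; first by move: PQ; rewrite hQ hQ'; apply: ltnW.
  exists c; split=> // j v jQ; have [->|jj0] := eqVneq j j0; last by apply: c4; rewrite !inE jj0.
  apply: big1 => i _; case: (boolP (i \in P)) => iP; last by rewrite c3 // mul0r.
  have [->|gi] := eqVneq (g i j0 v) 0; first by rewrite mulr0.
  by case: no; exists i; split=> //; exists v.
pose g' i j v := g i0 j0 v * g i j v - g i j0 v * g i0 j v.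
have [i j||c [c1 [i1 [v1 cv1]] c3 c4]] := IH _ g' (P :\ i0) hQ'.
- by apply: polyfunB; apply: polyfunM.
- by move: PQ; rewrite hQ hQ' (cardsD1 i0 P) i0P.
have i10 : i1 != i0.
  by apply/eqP => e; move: cv1; rewrite c3 ?eqxx // e !inE eqxx.
(* The other rows are scaled by the pivot, and the pivot row receives the coefficient that cancels
   column [j0]. The scaled family stays nonzero because [c i1] and the pivot are nonzero elements of
   a domain. *)
exists (fun i v => c i v * g i0 j0 v - (i == i0)%:R * \sum_k c k v * g k j0 v); split.
- move=> i; apply: polyfunB; apply: polyfunM => //; first exact: polyfun_const.
  by apply: polyfun_sum => k; apply: polyfunM.
- apply: boolp.contrapT => no; move/negP: gv0; apply; apply/eqP.
  apply: (polyfun_domain (c1 i1) (hg i0 j0) _ (memvf v1) cv1 (memvf v0)) => v _.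
  apply/eqP; apply: boolp.contrapT => /negP h; apply: no; exists i1, v.
  by rewrite (negPf i10) mul0r subr0.
- move=> i v iP; rewrite c3 ?inE ?(negPf iP) ?andbF // mul0r sub0r.
  by case: eqP => [e|]; [move: iP; rewrite e i0P|rewrite mul0r oppr0].
- move=> j v jQ.
  rewrite (eq_bigr (fun i => c i v * g i0 j0 v * g i j v -
      (i == i0)%:R * (\sum_k c k v * g k j0 v) * g i j v)); last by move=> i _; rewrite mulrBl.
  set X := \sum_k c k v * g k j0 v.
  have X0 : \sum_i (i == i0)%:R * X * g i j v = X * g i0 j v.
    rewrite (bigD1 i0) //= eqxx mul1r big1 ?addr0 // => i /negPf ->.
    by rewrite !mul0r.
  rewrite sumrB X0 /X.
  have [->|jj0] := eqVneq j j0.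
    by rewrite mulr_suml -sumrB big1 // => i _; ring.
  rewrite -[RHS](c4 j v); last by rewrite !inE jj0.
  by rewrite mulr_suml -sumrB; apply: eq_bigr => i _; rewrite /g'; ring.
Qed.

End Dependence.

Section Hyperplanes.
Variables (K : numFieldType).
Implicit Types U V W : vectType K.

Lemma form_hyperplane V (H : {vspace V}) (al : V -> K) e : lin al -> al e != 0 ->
  (forall v : V, (v \in H) = (al v == 0)) -> (\dim H).+1 = \dim {:V}.
Proof.
move=> hal ale hH.
have e0 : e != 0 by apply: contraNneq ale => ->; rewrite lin0.
have d0 : (H :&: <[e]> = 0)%VS.
  apply/eqP; rewrite -subv0; apply/subvP => v; rewrite memv_cap => /andP[vH /vlineP[c vE]].
  move: vH; rewrite vE hH linZ // mulf_eq0 (negPf ale) orbF => /eqP ->.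
  by rewrite scale0r mem0v.
have f : (H + <[e]> = fullv)%VS.
  apply/vspaceP => v; rewrite memvf.
  rewrite -[v](subrK (al v / al e *: e)); apply: memv_add; last by rewrite memvZ // memv_line.
  by rewrite hH linB // linZ // divfK // subrr.
by rewrite -f dimv_disjoint_sum // dim_vline e0 addn1.
Qed.

Lemma hyperplane_sub V (H H' : {vspace V}) :
  (\dim H).+1 = \dim {:V} -> (\dim H').+1 = \dim {:V} -> (H <= H')%VS -> H = H'.
Proof. by move=> h h' s; apply/eqP; rewrite eqEdim s -ltnS h h' /=. Qed.

Lemma seq_choice (T : eqType) (S : Type) (y0 : S) (P : T -> S -> Prop) (s : seq T) :
  (forall x, x \in s -> exists y, P x y) -> exists f, forall x, x \in s -> P x (f x).
Proof.
elim: s => [|x s IH] h; first by exists (fun=> y0).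
have [f hf] := IH (fun x' hx => h x' (mem_behead (s := x :: s) hx)).
have [y hy] := h x (mem_head _ _).
exists (fun x' => if x' == x then y else f x') => x'; rewrite inE.
by case: eqP => [->|_] //= /hf.
Qed.

(** Taking the coefficient of t^D at the point tv replaces each [g i] by its component of degree D -
    d i, and by 0 when d i exceeds D. *)
Lemma homogeneous_coef V W (I : finType) (d : I -> nat) D (phi : I -> V -> W) (eta : V -> W)
    (g : I -> V -> K) :
  homogeneous D eta -> (forall i, homogeneous (d i) (phi i)) -> (forall i, polyfun (g i)) ->
  (forall v, eta v = \sum_i g i v *: phi i v) ->
  exists g' : I -> V -> K, [/\ forall i, polyfun (g' i),
    forall i v, (D < d i)%N -> g' i v = 0 & forall v, eta v = \sum_i g' i v *: phi i v].
Proof.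
move=> heta hphi hg etaE.
have /fin_all_exists[P hP] : forall i, exists P : V -> {poly K},
  [/\ forall k, polyfun (fun v => (P v)`_k), forall k, homfun k (fun v => (P v)`_k)
    & forall v t, g i (t *: v) = (P v).[t]] by move=> i; apply: homfun_part.
exists (fun i v => if (D < d i)%N then 0 else (P i v)`_(D - d i)); split.
- by move=> i; case: ltnP => _; [exact: polyfun_const|case: (hP i)].
- by move=> i v ->.
move=> v; rewrite [LHS]vbasis_expand [RHS]vbasis_expand; apply: eq_bigr => k _; congr (_ *: _).
set b := vbasis _; have := @poly_horner_inj _ ((coord b k (eta v))%:P * 'X^D)
  (\sum_i 'X^(d i) * P i v * (coord b k (phi i v))%:P).
move=> /(_ _)/(congr1 (fun p : {poly K} => p`_D)); rewrite coefMXn ltnn subnn coefC eqxx => ->.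
  rewrite coef_sum linear_sum /=; apply: eq_bigr => i _.
  by rewrite coefMC coefXnM linearZ.
move=> t; rewrite horner_sum hornerM hornerC hornerXn mulrC.
have := congr1 (coord b k) (etaE (t *: v)); rewrite heta linearZ /= => ->.
rewrite linear_sum /=; apply: eq_bigr => i _.
rewrite !hornerM hornerXn hornerC hphi linearZ /= linearZ /=.
by case: (hP i) => _ _ ->; ring.
Qed.

(** Same comparison of coefficients of t^D, along lines through the origin, which stay in [H]. The
    truncated difference [D - b] is harmless: for D < b the quotient is 0. *)
Lemma homfun_quotient V (H : {vspace V}) D b (f u B : V -> K) :
  homfun D f -> homfun b B -> polyfun u -> (forall v, v \in H -> f v = u v * B v) ->
  exists u', [/\ polyfun u', homfun (D - b) u', forall v, v \in H -> f v = u' v * B v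
    & (D < b)%N -> forall v, u' v = 0].
Proof.
move=> hf hB hu fE; have [P [P1 P2 P3]] := homfun_part hu.
exists (fun v => if (D < b)%N then 0 else (P v)`_(D - b)); split.
- by case: ltnP => _; [exact: polyfun_const|].
- by case: ltnP => // _ c v; rewrite mulr0.
- move=> v vH; have := @poly_horner_inj _ ((f v)%:P * 'X^D) ('X^b * P v * (B v)%:P).
  move=> /(_ _)/(congr1 (fun p : {poly K} => p`_D)); rewrite coefMXn ltnn subnn coefC eqxx => ->.
    by rewrite coefMC coefXnM.
  move=> t; rewrite !hornerM !hornerC !hornerXn mulrC -hf fE ?memvZ // hB P3; ring.
- by move=> ->.
Qed.

(** A subspace is not covered by the zero sets of finitely many polynomial functions, each nonzero
    somewhere on it. *)
Lemma prod_neq0_on V (H : {vspace V}) (T : eqType) (L : seq T) (f : T -> V -> K) :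
  (forall x, polyfun (f x)) -> (forall x, x \in L -> exists2 v, v \in H & f x v != 0) ->
  exists2 v, v \in H & \prod_(x <- L) f x v != 0.
Proof.
move=> hf; elim: L => [|x L IH] h; first by exists 0; rewrite ?mem0v // big_nil oner_eq0.
have [v1 v1H e1] := h x (mem_head _ _).
have [v2 v2H e2] := IH (fun y hy => h y (mem_behead (s := x :: L) hy)).
apply: boolp.contrapT => no; move/negP: e2; apply; apply/eqP.
apply: (polyfun_domain (hf x) (polyfun_prod L hf) _ v1H e1 v2H) => v vH.
apply/eqP; apply: boolp.contrapT => /negP ne; apply: no; exists v => //.
by rewrite big_cons.
Qed.

End Hyperplanes.

Section Restriction.
Variables (K : numFieldType) (V : vectType K).
Implicit Types (A : {fset {vspace V}}) (H X : {vspace V}).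

Definition form_for H (al : V -> K) : Prop :=
  exists e, [/\ lin al, al e = 1 & forall v : V, (v \in H) = (al v == 0)].

Lemma mem_restriction A X (Y : {vspace subvs_of X}) :
  Y \in restriction A X <->
  exists H, [/\ H \in A, ~~ (X <= H)%VS & Y = (linfun (vsval : subvs_of X -> V) @^-1: H)%VS].
Proof.
split=> [/imfsetP[H /=]|[H [HA XH ->]]].
  by rewrite !inE => /andP[HA XH] ->; exists H.
by apply/imfsetP; exists H => //=; rewrite !inE HA XH.
Qed.

Lemma mem_vsval_preim X H (u : subvs_of X) :
  (u \in (linfun (vsval : subvs_of X -> V) @^-1: H)%VS) = (vsval u \in H).
Proof. by rewrite -memv_preim lfunE. Qed.

Lemma vsval_preim_eq X H1 H2 :
  (linfun (vsval : subvs_of X -> V) @^-1: H1)%VS = (linfun (vsval : subvs_of X -> V) @^-1: H2)%VS ->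
  forall v, v \in X -> (v \in H1) = (v \in H2).
Proof. by move=> e v vX; rewrite -(vsprojK vX) -!mem_vsval_preim e. Qed.

Lemma is_arrangement_restriction A X : is_arrangement A -> is_arrangement (restriction A X).
Proof.
move=> hA Y /mem_restriction[H [/hA dH XH ->]].
have [al [e [hal ale hH]]] := hyperplane_form dH.
have /subvPn[v vX vH] := XH.
apply: (form_hyperplane (al := fun u => al (vsval u)) (e := vsproj X v)).
- by move=> a u w; rewrite linearP hal.
- by rewrite vsprojK // -hH.
- by move=> u; rewrite mem_vsval_preim hH.
Qed.

Lemma forms_choice A : is_arrangement A ->
  exists F : {vspace V} -> V -> K, (forall H, polyfun (F H)) /\ forall H, H \in A -> form_for H (F H).
Proof.
move=> hA; have [|F hF] := @seq_choice _ _ (fun=> 0) (fun H al => form_for H al) A.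
  by move=> H /hA /hyperplane_form.
exists (fun H => if H \in A then F H else fun=> 0); split=> H.
  by case: ifP => [/hF[e [h _ _]]|_]; [exact: polyfun_lin|exact: polyfun_const].
by move=> HA; rewrite HA; apply: hF.
Qed.

Lemma form_div_on (H X : {vspace V}) al (f : V -> K) : form_for H al -> ~~ (X <= H)%VS -> polyfun f ->
  (forall v, v \in X -> v \in H -> f v = 0) ->
  exists2 g, polyfun g & forall v, v \in X -> f v = al v * g v.
Proof.
move=> [e [hal _ hH]] /subvPn[w wX]; rewrite hH => alw hf f0.
have ale : al ((al w)^-1 *: w) = 1 by rewrite linZ // mulVf.
have [g hg ge] := polyfun_div hal ale hf; exists g => // v vX.
rewrite -ge (f0 (v - _)) ?subr0 //; first by rewrite memvB // memvZ // memvZ.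
by rewrite hH linB // linZ // ale mulr1 subrr.
Qed.

Variable F : {vspace V} -> V -> K.
Hypothesis hF : forall H, polyfun (F H).

(** Divide by one form at a time: the product of the remaining forms is not identically zero on the
    next hyperplane, so the quotient itself must vanish there. *)
Lemma vanish_prod A (L : seq {vspace V}) (f : V -> K) :
  is_arrangement A -> (forall H, H \in A -> form_for H (F H)) ->
  uniq L -> {subset L <= A} -> polyfun f ->
  (forall H v, H \in L -> v \in H -> f v = 0) ->
  exists2 k, polyfun k & forall v, f v = k v * \prod_(H <- L) F H v.
Proof.
move=> hA hform; elim: L => [|H L IH] /=; first by exists f => // v; rewrite big_nil mulr1.
move=> /andP[HL uL] LA hf f0.
have sub x : x \in L -> x \in H :: L by move=> xL; rewrite inE xL orbT.
have [k hk fk] := IH uL (fun x xL => LA x (sub x xL)) hf (fun H v h => f0 H v (sub H h)).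
have HA : H \in A by apply: LA; rewrite mem_head.
have [|w wH w0] := prod_neq0_on (H := H) hF (L := L).
  move=> x xL; have xA : x \in A by apply: LA; rewrite inE xL orbT.
  have [e [_ _ hx]] := hform _ xA.
  have /subvPn[v vH vx] : ~~ (H <= x)%VS.
    apply: contra HL => s; have -> // : H = x by apply: hyperplane_sub s; apply: hA.
  by exists v; rewrite // -hx.
have k0 v : v \in H -> k v = 0.
  apply: (polyfun_domain (polyfun_prod L hF) hk _ wH w0) => u uH.
  by rewrite mulrC -fk (f0 H) ?mem_head.
have [e [hl ale hH]] := hform _ HA.
have [|g hg kg] := polyfun_div_ker hl ale hk; first by move=> v av; apply: k0; rewrite hH av.
by exists g => // v; rewrite big_cons fk kg; ring.
Qed.

(* The forms F H, for H in L, restrict on X to multiples of one form, which does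
   not divide G. *)
Lemma cancel_prod (X Y : {vspace V}) (L : seq {vspace V}) (f G k : V -> K) :
  (forall H, H \in L -> form_for H (F H) /\ ~~ (X <= H)%VS) ->
  (forall H v, H \in L -> v \in X -> v \in H -> v \in Y) ->
  polyfun f -> polyfun G -> polyfun k ->
  (forall H, H \in L -> exists v, [/\ v \in X, v \in H & G v != 0]) ->
  (forall v, v \in X -> f v * G v = k v * \prod_(H <- L) F H v) ->
  exists2 g, polyfun g & forall v, v \in X -> f v = g v * \prod_(H <- L) F H v.
Proof.
elim: L f k => [|H L IH] f k hL hY hf hG hk hG0 fG.
  by exists f => // v; rewrite big_nil mulr1.
have [hH XH] := hL _ (mem_head _ _).
have [w [wX wH w0]] := hG0 _ (mem_head _ _).
have [e [hl ale hHE]] := hH.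
have f0 v : v \in X -> v \in H -> f v = 0.
  move=> vX vH; apply: (polyfun_domain (H := (X :&: H)%VS) hG hf _ _ w0); rewrite ?memv_cap ?wX ?vX //.
  move=> u; rewrite memv_cap => /andP[uX uH]; rewrite mulrC fG // big_cons.
  by move: uH; rewrite hHE => /eqP ->; rewrite mul0r mulr0.
have [g hg fg] := form_div_on hH XH hf f0.
have sub x : x \in L -> x \in H :: L by move=> xL; rewrite inE xL orbT.
have [v vX|g' hg' gE] := IH g k (fun x xL => hL x (sub x xL)) (fun x v xL => hY x v (sub x xL))
    hg hG hk (fun x xL => hG0 x (sub x xL)).
- have /subvPn[u uX] := XH; rewrite hHE => u0.
  apply/eqP; rewrite -subr_eq0; apply/eqP.
  apply: (polyfun_domain (f := F H) (g := fun v => g v * G v - k v * \prod_(H <- L) F H v) _ _ _ uX u0 vX) => //.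
    by apply: polyfunB; apply: polyfunM => //; apply: polyfun_prod.
  move=> y yX; have := fG y yX; rewrite fg // big_cons => e1.
  by rewrite mulrBr mulrA e1; ring.
- by exists g' => // v vX; rewrite fg // big_cons gE //; ring.
Qed.

End Restriction.

(** * Terao's polynomial *)

Section Terao.
Variables (K : numFieldType) (V : vectType K) (A : {fset {vspace V}}) (H : {vspace V}).
Hypothesis hA : is_arrangement (H |` A).
Hypothesis HA : H \notin A.
Local Notation W := (subvs_of H).
Local Notation AH := (restriction (H |` A) H).
Local Notation pre X := (linfun (vsval : W -> V) @^-1: X)%VS.

Let dH : (\dim H).+1 = \dim {:V}. Proof. by apply: hA; rewrite !inE eqxx. Qed.

Let hA' : is_arrangement A. Proof. by move=> X XA; apply: hA; rewrite !inE XA orbT. Qed.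

Let AneH X : X \in A -> ~~ (X <= H)%VS.
Proof. by move=> XA; apply: contra HA => s; rewrite -(hyperplane_sub (hA' XA) dH s). Qed.

Let HneA X : X \in A -> ~~ (H <= X)%VS.
Proof. by move=> XA; apply: contra HA => s; rewrite (hyperplane_sub dH (hA' XA) s). Qed.

Lemma mem_restriction_add Y : Y \in AH <-> exists2 X, X \in A & Y = pre X.
Proof.
rewrite mem_restriction; split=> [[X []]|[X XA ->]].
  by rewrite !inE => /orP[/eqP->|XA _ ->]; [rewrite subvv|exists X].
by exists X; split; rewrite ?HneA // !inE XA orbT.
Qed.

(** [fib Y] collects the hyperplanes of [A] with trace [Y] on [H]. Since the restriction keeps one
    hyperplane per trace, [L Y] drops one of them; the product of the forms in all the [L Y] is
    Terao's polynomial, of degree |A| - |A^H|. *)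
Let fib (Y : {vspace W}) : seq {vspace V} := [seq X <- A | pre X == Y].
Let L (Y : {vspace W}) : seq {vspace V} := behead (fib Y).

Let fibE Y : Y \in AH -> exists X, [/\ fib Y = X :: L Y, X \in A & pre X = Y].
Proof.
move=> /mem_restriction_add[X0 X0A e].
have X0f : X0 \in fib Y by rewrite mem_filter e eqxx.
rewrite /L; case e1: (fib Y) X0f => [//|X l] _; exists X.
have : X \in fib Y by rewrite e1 mem_head.
by rewrite mem_filter => /andP[/eqP].
Qed.

Let LA Y X : X \in L Y -> X \in A /\ pre X = Y.
Proof. by move=> /mem_behead; rewrite mem_filter => /andP[/eqP]. Qed.

Lemma card_fibers : (\sum_(Y <- AH) size (L Y) + #|` AH| = #|` A|)%N.
Proof.
have -> : #|` AH| = (\sum_(Y <- AH) 1)%N by rewrite sum1_size.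
rewrite -big_split /= big_seq.
rewrite (eq_bigr (fun Y => \sum_(X <- A) (pre X == Y))%N); last first.
  move=> Y /fibE[X [e _ _]]; rewrite addn1.
  have -> : (size (L Y)).+1 = size (fib Y) by rewrite e.
  by rewrite size_filter -sum1_count big_mkcond /=; apply: eq_bigr => Z _; case: eqP.
rewrite -big_seq exchange_big /= -sum1_size big_seq [RHS]big_seq.
apply: eq_bigr => X XA.
have XAH : pre X \in AH by apply/mem_restriction_add; exists X.
rewrite (bigD1_seq (pre X)) ?fset_uniq //= eqxx big1 // => Y /negPf.
by rewrite eq_sym => ->.
Qed.

(** Let [X1] be the hyperplane dropped from a fiber, and write F X1 (eta v) = F X1 v * g v. On every
    other member of the fiber, [F X1] is a nonzero multiple of [al], so [al (eta v) - al v * g v]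
    vanishes there and is divisible by the forms of [L Y]. On [H], where [al] is zero, this gives
    divisibility of [al (eta v)]. *)
Lemma terao_polynomial al : form_for H al ->
  exists (D : nat) (B : V -> K), [/\ (D + #|` AH| = #|` A|)%N, polyfun B, homfun D B &
    forall eta, logvf A eta -> exists2 u, polyfun u & forall v, v \in H -> al (eta v) = u v * B v].
Proof.
move=> [eH [hal ale hH]].
have [F [hF hform]] := forms_choice hA'.
have hAH : is_arrangement AH by apply: is_arrangement_restriction.
have LAs Y : {subset L Y <= A} by move=> X /LA[].
exists (\sum_(Y <- AH) size (L Y))%N, (fun v => \prod_(Y <- AH) \prod_(X <- L Y) F X v); split.
- exact: card_fibers.
- by apply: polyfun_prod => Y; apply: polyfun_prod.
- move=> c v; rewrite (big_morph _ (exprD c) (expr0 c)) -big_split; apply: eq_bigr => Y _ /=.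
  rewrite -[size _]sum1_size (big_morph _ (exprD c) (expr0 c)) -big_split /= big_seq [RHS]big_seq.
  by apply: eq_bigr => X /LA[/hform[e [h _ _]] _]; rewrite linZ // expr1.
move=> eta [etaP etaA].
have key Y : Y \in AH -> exists2 k, polyfun k &
    forall v, v \in H -> al (eta v) = k v * \prod_(X <- L Y) F X v.
  move=> /fibE[X1 [fE X1A X1Y]].
  have [e1 [hb be hX1]] := hform _ X1A.
  have [|g hg gE] := polyfun_div_ker hb be (etaP _ hb).
    by move=> v bv; apply/eqP; rewrite -hX1; apply: etaA => //; rewrite hX1 bv.
  have uf : uniq (X1 :: L Y) by rewrite -fE filter_uniq // fset_uniq.
  have hf : polyfun (fun v => al (eta v) - al v * g v).
    by apply: polyfunB; [exact: etaP|apply: polyfunM => //; exact: polyfun_lin].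
  have [|X v XL vX|k hk fk] := vanish_prod hF hA' hform _ (LAs Y) hf.
  - by move: uf => /andP[].
  - (* F X1 and al are proportional on X, because X and X1 have the same trace on H *)
    have [XA XY] := LA XL.
    have /subvPn[v0 v0X] := AneH XA; rewrite hH => av0.
    have bE w : w \in X -> F X1 w = F X1 v0 / al v0 * al w.
      move=> wX; have h0 : al (w - al w / al v0 *: v0) = 0.
        by rewrite linB // linZ // divfK // subrr.
      have : w - al w / al v0 *: v0 \in X1.
        rewrite -(vsval_preim_eq (etrans XY (esym X1Y))) ?hH ?h0 //.
        by rewrite memvB // memvZ.
      by rewrite hX1 linB // linZ // subr_eq0 => /eqP ->; ring.
    have c0 : F X1 v0 / al v0 != 0.
      apply/eqP => c0; move: uf; rewrite cons_uniq => /andP[/negP[]].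
      have -> // : X1 = X; apply/esym/hyperplane_sub; rewrite ?hA' //.
      by apply/subvP => w wX; rewrite hX1 bE // c0 mul0r.
    apply: (mulfI c0); rewrite mulr0 mulrBr -bE ?etaA // gE (bE v) //; ring.
  - exists k => // v vH; rewrite -fk; move: vH; rewrite hH => /eqP ->.
    by rewrite mul0r subr0.
(* For different traces the products are coprime on [H], so the divisibilities combine one trace at
   a time. *)
suff h (ys : seq {vspace W}) : uniq ys -> {subset ys <= AH} -> exists2 u, polyfun u &
    forall v, v \in H -> al (eta v) = u v * \prod_(Y <- ys) \prod_(X <- L Y) F X v.
  by apply: h => //; apply: fset_uniq.
elim: ys => [|Y ys IH] /=.
  move=> _ _. exists (fun v => al (eta v)) => [|v _]; first exact: etaP.
  by rewrite big_nil mulr1.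
move=> /andP[Yys uys] sub.
have [|u hu uE] := IH uys; first by move=> Z Zys; apply: sub; rewrite inE Zys orbT.
have YA : Y \in AH by apply: sub; rewrite mem_head.
have [k hk kE] := key _ YA; have [X1 [fE X1A X1Y]] := fibE YA.
have [|X v XL vH vX||X XL|v vH|g hg gE] := @cancel_prod _ _ F hF H X1 (L Y) u
  (fun v => \prod_(Y <- ys) \prod_(X <- L Y) F X v) k _ _ hu _ hk.
- by move=> X /LAs XA; split; [exact: hform|exact: HneA].
- by rewrite (vsval_preim_eq (etrans X1Y (esym (LA XL).2))).
- by apply: polyfun_prod => Z; apply: polyfun_prod.
- have [XA XY] := LA XL.
  have [||v] := prod_neq0_on (H := (H :&: X)%VS) (L := ys) (f := fun Z v => \prod_(X <- L Z) F X v).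
  + by move=> Z; apply: polyfun_prod.
  + move=> Z Zys; apply: prod_neq0_on => // X2 X2L; have [X2A X2Z] := LA X2L.
    have [e2 [_ _ hX2]] := hform _ X2A.
    suff /subvPn[v vX vX2] : ~~ (H :&: X <= X2)%VS by exists v; rewrite // -hX2.
    apply: contra Yys => /subvP s; suff -> : Y = Z by [].
    apply: hyperplane_sub; [exact: hAH|apply: hAH; apply: sub; rewrite inE Zys orbT //|].
    apply/subvP => w; rewrite -XY -X2Z !mem_vsval_preim => wX; apply: s.
    by rewrite memv_cap subvsP.
  + by rewrite memv_cap => /andP[vH vX] v0; exists v.
- by rewrite -uE // kE.
- exists g => // v vH; rewrite uE // gE // big_cons; ring.
Qed.

End Terao.

Section LogComb.
Variables (K : numFieldType) (V : vectType K) (A : {fset {vspace V}}).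

Lemma logvfZ (g : V -> K) phi : polyfun g -> logvf A phi -> logvf A (fun v => g v *: phi v).
Proof.
move=> hg [h1 h2]; split; first exact: polymapZ.
by move=> X XA v vX; rewrite memvZ // h2.
Qed.

Lemma logvfD phi psi : logvf A phi -> logvf A psi -> logvf A (fun v => phi v + psi v).
Proof.
move=> [h1 h2] [h3 h4]; split; first exact: polymapD.
by move=> X XA v vX; rewrite memvD // ?h2 ?h4.
Qed.

Lemma logvf_sum (I : finType) (phi : I -> V -> V) :
  (forall i, logvf A (phi i)) -> logvf A (fun v => \sum_i phi i v).
Proof.
move=> h; split; first by apply: polymap_sum => i; case: (h i).
by move=> X XA v vX; apply: memv_suml => i _; case: (h i) => _; apply.
Qed.

End LogComb.

(** * Basis exchange in the addition theorem *)

Section Addition.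
Variables (K : numFieldType) (V : vectType K) (A : {fset {vspace V}}) (H : {vspace V}).
Variables (I J : finType) (d : I -> nat) (d' : J -> nat) (b : nat).
Variables (th : I -> V -> V) (phi : J -> subvs_of H -> subvs_of H).
Hypothesis hA : is_arrangement (H |` A).
Hypothesis HA : H \notin A.
Local Notation W := (subvs_of H).
Local Notation AH := (restriction (H |` A) H).
Hypothesis hth : fbasis d A th.
Hypothesis hphi : fbasis d' AH phi.
Hypothesis hdd : perm_eq [seq d i | i <- enum I] (b :: [seq d' j | j <- enum J]).

(* Otherwise the th i of degree at most b restrict to H; as they outnumber the
   phi j of degree at most b, they satisfy a nontrivial relation on H, which
   contradicts the freeness of the th i after division by the form of H. *)
Lemma addition_pivot al : form_for H al -> exists i0, (d i0 <= b)%N /\ exists2 v, v \in H & al (th i0 v) != 0.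
Proof.
move=> [e [hal ale hH]]; have [t1 t2 t3 t4] := hth; have [p1 p2 p3 p4] := hphi.
apply: boolp.contrapT => no.
have thH i v : (d i <= b)%N -> v \in H -> th i v \in H.
  move=> di vH; rewrite hH; apply/negPn/negP => h; apply: no.
  by exists i; split=> //; exists v.
pose psi i (u : W) : W := vsproj H (th i (vsval u)).
have psiE i u : (d i <= b)%N -> vsval (psi i u) = th i (vsval u).
  by move=> di; rewrite vsprojK // thH // subvsP.
have pval : polymap (vsval : W -> V) by apply: polymap_linear.
have pproj : polymap (vsproj H : V -> W) by apply: polymap_linear.
have psi_log i : (d i <= b)%N -> logvf AH (psi i).
  move=> di; split.
    apply: (polymap_comp _ pproj); apply: (polymap_comp pval); exact: (t1 i).1.
  move=> Y /(mem_restriction_add hA HA)[X XA ->] u; rewrite !mem_vsval_preim psiE // => uX.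
  exact: (t1 i).2.
have /fin_all_exists[g hg] : forall i, exists g : J -> W -> K, [/\ forall j, polyfun (g j),
    forall j u, (b < d' j)%N -> g j u = 0 &
    (d i <= b)%N -> forall u, psi i u = \sum_j g j u *: phi j u].
  move=> i; case: (leqP (d i) b) => di; last first.
    by exists (fun _ _ => 0); split=> // j; apply: polyfun_const.
  have [g [g1 g2]] := p3 _ (psi_log i di).
  have [|g' [q1 q2 q3]] := homogeneous_coef (D := d i) _ p2 g1 g2.
    by move=> c u; rewrite /psi linearZ /= t2 linearZ.
  exists g'; split=> // j u bj; apply: q2; exact: leq_ltn_trans bj.
pose P := [set i | (d i <= b)%N]; pose Q := [set j | (d' j <= b)%N].
(* By [hdd] the degrees of the [th i] are those of the [phi j] together with [b] itself, so one more
   of them is at most [b]. *)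
have cPQ : (#|Q| < #|P|)%N.
  have cE (T : finType) (f : T -> nat) : #|[set t | (f t <= b)%N]| = count (fun x => x <= b)%N [seq f t | t <- enum T].
    by rewrite cardsE cardE count_map -size_filter enumT /enum_mem; congr size; apply: eq_filter.
  rewrite !cE (permP hdd) /= leqnn add1n //.
have [|c [c1 [i1 [u1 cu1]] c3 c4]] := @polyfun_dependence _ _ _ _ g P Q _ cPQ.
  by move=> i j; case: (hg i).
pose ct i v := c i (vsproj H v).
have hct i : polyfun (ct i) by apply: (polyfun_comp pproj).
have eta0 v : al v = 0 -> \sum_i ct i v *: th i v = 0.
  move=> av; have vH : v \in H by rewrite hH av.
  pose u := vsproj H v; have uE : vsval u = v by rewrite vsprojK.
  have -> : \sum_i ct i v *: th i v = vsval (\sum_i c i u *: psi i u).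
    rewrite linear_sum; apply: eq_bigr => i _; rewrite linearZ /=.
    case: (leqP (d i) b) => di; first by rewrite psiE // uE.
    by rewrite /ct -/u c3 ?inE -?ltnNge // !scale0r.
  rewrite (_ : \sum_i _ = 0) ?linear0 //.
  rewrite (eq_bigr (fun i => \sum_j (c i u * g i j u) *: phi j u)).
    rewrite exchange_big big1 // => j _; rewrite -scaler_suml.
    case: (leqP (d' j) b) => dj; first by rewrite c4 ?inE // scale0r.
    by rewrite big1 ?scale0r // => i _; case: (hg i) => _ -> // _; rewrite mulr0.
  move=> i _; case: (leqP (d i) b) => di.
    case: (hg i) => _ _ -> //; rewrite scaler_sumr; apply: eq_bigr => j _.
    by rewrite scalerA.
  by rewrite c3 ?inE -?ltnNge // scale0r big1 // => j _; rewrite mul0r scale0r.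
have eta_log : logvf A (fun v => \sum_i ct i v *: th i v).
  by apply: logvf_sum => i; apply: logvfZ.
have [eta' heta' etaE] := polymap_div_ker hal ale eta_log.1 eta0.
have log' : logvf A eta'.
  split=> // X XA v vX.
  have XA' : X \in H |` A by rewrite !inE XA orbT.
  have [be [e' [hbe be' hX]]] := hyperplane_form (hA XA').
  have /subvPn[w wX wH] : ~~ (X <= H)%VS.
    apply: contra HA => s; rewrite -(hyperplane_sub (hA XA') _ s) //.
    by apply: hA; rewrite !inE eqxx.
  rewrite hH in wH; rewrite hX; apply/eqP.
  apply: (polyfun_domain (f := al) (g := fun v => be (eta' v)) _ _ _ wX wH vX).
  - exact: polyfun_lin.
  - exact: heta'.
  - move=> y yX; rewrite -(linZ _ _ hbe) -etaE; apply/eqP; rewrite -hX.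
    exact: eta_log.2.
have [h [h1 h2]] := t3 _ log'.
have Z i v : ct i v - al v * h i v = 0.
  apply: (t4 (fun i v => ct i v - al v * h i v)) => {i v} [i|v].
    by apply: polyfunB => //; apply: polyfunM => //; apply: polyfun_lin.
  under eq_bigr do rewrite scalerBl.
  rewrite sumrB etaE h2 scaler_sumr; apply/eqP; rewrite subr_eq0; apply/eqP.
  by apply: eq_bigr => i _; rewrite scalerA.
have au1 : al (vsval u1) = 0 by apply/eqP; rewrite -hH subvsP.
by move: cu1; have := Z i1 (vsval u1); rewrite au1 mul0r subr0 /ct vsvalK => ->; rewrite eqxx.
Qed.

Hypothesis hcard : (b + #|` AH| = #|` A|)%N.

(** Terao's polynomial [B] has degree [b] by [hcard]. The pivot [th i0] has degree at most [b], and
    [al (th i0 v)] is a multiple of [B] that is nonzero on [H]: the degree is exactly [b] and the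
    quotient a nonzero constant. Then [th i0] is multiplied by [al], and the other elements are
    corrected by multiples of it. *)
Lemma fbasis_addition : exists i0 th', d i0 = b /\
  fbasis (fun i => d i + (i == i0))%N (H |` A) th'.
Proof.
have [al hal0] : exists al, form_for H al by apply: hyperplane_form; apply: hA; rewrite !inE eqxx.
have [e [hal ale hH]] := hal0; have [t1 t2 t3 t4] := hth.
have [i0 [di0 [v0 v0H av0]]] := addition_pivot hal0.
have [D [B [DE hB hBD Bdiv]]] := terao_polynomial hA HA hal0.
have {DE} DE : D = b by apply/eqP; rewrite -(eqn_add2r #|` AH|) DE hcard.
rewrite {}DE in hBD.
have /fin_all_exists[u hu] : forall i, exists u, [/\ polyfun u, homfun (d i - b) u,
    forall v, v \in H -> al (th i v) = u v * B v & (d i < b)%N -> forall v, u v = 0].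
  move=> i; have [u pu uE] := Bdiv _ (t1 i).
  apply: (homfun_quotient (f := fun v => al (th i v)) _ hBD pu uE).
  by move=> c v; rewrite t2 linZ.
have db : d i0 = b.
  apply/eqP; rewrite eqn_leq di0 leqNgt; apply/negP => lt.
  by case: (hu i0) => _ _ uE u0; move: av0; rewrite uE // u0 // mul0r eqxx.
(* A homogeneous function of degree 0 is constant: scaling by 0 compares any point with the
   origin. *)
have uc v : u i0 v = u i0 0.
  case: (hu i0) => _ h _ _; have := h 0 v.
  by rewrite db subnn expr0 mul1r scale0r.
set c := u i0 0.
have c0 : c != 0.
  by case: (hu i0) => _ _ uE _; apply: contraNneq av0 => e0; rewrite uE // uc -/c e0 mul0r.
(* al (th i0 v) = c * B v on H, hence th i - w i *: th i0 is tangent to H. *)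
pose w i v := u i v / c.
have hw i : polyfun (w i) by apply: polyfunM; [case: (hu i)|exact: polyfun_const].
pose th' i v := if i == i0 then al v *: th i0 v else th i v - w i v *: th i0 v.
have th'log i : logvf (H |` A) (th' i).
  have pal := polyfun_lin hal.
  rewrite /th'; case: eqP => [_|ii0].
    split; first by apply: polymapZ => //; case: (t1 i0).
    move=> X; rewrite !inE => /orP[/eqP->|XA] v vX; last by rewrite memvZ // (t1 i0).2.
    have al0 : al v = 0 by apply/eqP; rewrite -hH.
    by rewrite al0 scale0r mem0v.
  have l1 : logvf A (fun v => th i v - w i v *: th i0 v).
    have := logvfD (t1 i) (logvfZ (polyfunN (hw i)) (t1 i0)).
    by move=> [q1 q2]; split; [apply: polymap_ext q1 => v|move=> X XA v /(q2 X XA)]; rewrite scaleNr.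
  split; first by case: l1.
  move=> X; rewrite !inE => /orP[/eqP->|XA] v vX; last exact: l1.2.
  have [_ _ ui _] := hu i; have [_ _ u0 _] := hu i0.
  rewrite hH linB // linZ // ui // u0 //.
  by rewrite uc -/c /w mulrA divfK // subrr.
have tailP (g : I -> V -> K) : (forall i, polyfun (g i)) ->
    polyfun (fun v => \sum_(i | i != i0) g i v * w i v).
  move=> hg; apply: (polyfun_ext (f := fun v => \sum_i (i != i0)%:R * (g i v * w i v))).
    by move=> v; rewrite [RHS]big_mkcond; apply: eq_bigr => i _; case: ifP; rewrite ?mul1r ?mul0r.
  by apply: polyfun_sum => i; apply: polyfunM; [exact: polyfun_const|apply: polyfunM].
exists i0, th'; split=> //; split=> //.
- move=> i k v; rewrite /th'; case: eqP => [->|ii0].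
    by rewrite linZ // t2 scalerA addn1 exprS scalerA; congr (_ *: _); ring.
  rewrite addn0 t2 t2 db scalerBr; congr (_ - _); rewrite !scalerA; congr (_ *: _).
  case: (hu i) => _ hi _ ui0; rewrite /w hi; case: (leqP b (d i)) => bi.
    by rewrite -[in RHS](subnK bi) exprD; ring.
  by rewrite ui0 //; ring.
- move=> eta heta.
  have le : logvf A eta by split=> [|X XA]; [case: heta|apply: heta.2; rewrite !inE XA orbT].
  have [g [hg gE]] := t3 _ le.
  (* Coefficient of [th i0] once the other [th i] are expressed through [th']. As [eta] and these
     [th' i] are tangent to [H], whereas [al (th i0 v)] is not identically zero on it, this
     coefficient vanishes on [H] and is divisible by [al]. *)
  pose h v := g i0 v + \sum_(i | i != i0) g i v * w i v.
  have hh : polyfun h by apply: polyfunD => //; apply: tailP.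
  have etaE v : eta v = \sum_(i | i != i0) g i v *: th' i v + h v *: th i0 v.
    rewrite gE (bigD1 i0) //= /h scalerDl addrCA; congr (_ + _).
    rewrite scaler_suml -big_split; apply: eq_bigr => i ii0.
    by rewrite /th' /= (negPf ii0) scalerBr !scalerA subrK.
  have h0 v : al v = 0 -> h v = 0.
    move=> av; have vH : v \in H by rewrite hH av.
    apply: (polyfun_domain (f := fun v => al (th i0 v)) _ hh _ v0H av0 vH).
      exact: (t1 i0).1.
    move=> y yH; have := heta.2 H; rewrite !inE eqxx => /(_ isT _ yH).
    move=> ey; have : h y *: th i0 y \in H.
      rewrite -[_ *: _](addKr (\sum_(i | i != i0) g i y *: th' i y)) -etaE memvD // memvN.
      apply: memv_suml => i _; rewrite memvZ //; have [_ ] := th'log i; apply=> //.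
      by rewrite !inE eqxx.
    by rewrite hH linZ // mulrC => /eqP.
  have [h' ph' hE] := polyfun_div_ker hal ale hh h0.
  exists (fun i => if i == i0 then h' else g i); split=> [i|v]; first by case: eqP.
  rewrite etaE [RHS](bigD1 i0) //= eqxx /th' eqxx [RHS]addrC; congr (_ + _); last first.
    by rewrite hE scalerA mulrC.
  by apply: eq_bigr => i ii0; rewrite (negPf ii0).
- move=> g hg g0.
  pose G i v := if i == i0 then g i0 v * al v - \sum_(k | k != i0) g k v * w k v else g i v.
  have G0 : forall i v, G i v = 0.
    apply: t4 => [i|v].
      rewrite /G; case: eqP => // _; apply: polyfunB; last exact: tailP.
      by apply: polyfunM => //; apply: polyfun_lin.
    rewrite -[RHS](g0 v) (bigD1 i0) //= [RHS](bigD1 i0) //= /G /th' eqxx.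
    rewrite scalerBl -scalerA -addrA; congr (_ + _).
    rewrite scaler_suml -sumrN -big_split; apply: eq_bigr => i /negPf ->.
    by rewrite /= scalerBr !scalerA addrC.
  have gz i v : i != i0 -> g i v = 0 by move=> /negPf ii0; have := G0 i v; rewrite /G ii0.
  move=> i v; have [->|/gz //] := eqVneq i i0.
  apply: (polyfun_domain (f := al) (g := g i0) _ _ _ (memvf e) _ (memvf v)) => //.
  + exact: polyfun_lin.
  + move=> y _; have := G0 i0 y; rewrite /G eqxx big1 ?subr0 1?mulrC // => k /gz ->.
    by rewrite mul0r.
  + by rewrite ale oner_eq0.
Qed.

End Addition.

(** * Pullbacks *)

Section Pullback.
Variable K : numFieldType.
Implicit Types U V W : vectType K.

(** Covers two operations at once: restriction, along an inclusion, and product with a line, along a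
    surjection with one-dimensional kernel. Hyperplanes containing the image are dropped, since
    their preimage is the whole space. *)
Definition pull U V (p : 'Hom(U, V)) (A : {fset {vspace V}}) : {fset {vspace U}} :=
  [fset (p @^-1: H)%VS | H in A & ~~ (limg p <= H)%VS].

Lemma limg_subP U V (p : 'Hom(U, V)) (H : {vspace V}) : reflect (forall u, p u \in H) (limg p <= H)%VS.
Proof.
apply: (iffP subvP) => [h u|h v /memv_imgP[u _ ->] //].
by apply: h; rewrite memv_img // memvf.
Qed.

Lemma mem_pull U V (p : 'Hom(U, V)) A Y : Y \in pull p A <->
  exists H, [/\ H \in A, ~~ (limg p <= H)%VS & Y = (p @^-1: H)%VS].
Proof.
split=> [/imfsetP[H /=]|[H [HA XH ->]]].
  by rewrite !inE => /andP[HA XH] ->; exists H.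
by apply/imfsetP; exists H => //=; rewrite !inE HA XH.
Qed.

Lemma lpreim_comp U V W (q : 'Hom(U, V)) (p : 'Hom(V, W)) H :
  (q @^-1: (p @^-1: H) = (p \o q) @^-1: H)%VS.
Proof. by apply/vspaceP => u; rewrite -!memv_preim comp_lfunE. Qed.

Lemma pull_comp U V W (q : 'Hom(U, V)) (p : 'Hom(V, W)) A : pull q (pull p A) = pull (p \o q)%VF A.
Proof.
have sub H : (limg q <= p @^-1: H)%VS = (limg (p \o q)%VF <= H)%VS.
  by apply/limg_subP/limg_subP => h u; have := h u; rewrite -memv_preim comp_lfunE.
apply/fsetP => Y; apply/idP/idP => /mem_pull[].
  move=> _ [/mem_pull[H [HA _ ->]] h ->]; rewrite lpreim_comp; apply/mem_pull.
  by exists H; rewrite -sub.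
move=> H [HA h ->]; apply/mem_pull; exists (p @^-1: H)%VS; rewrite sub lpreim_comp; split=> //.
apply/mem_pull; exists H; split=> //; apply: contra h => /limg_subP h.
by apply/limg_subP => u; rewrite comp_lfunE.
Qed.

Lemma restrictionE V (A : {fset {vspace V}}) X : restriction A X = pull (linfun (vsval : subvs_of X -> V)) A.
Proof.
have e H : (limg (linfun (vsval : subvs_of X -> V)) <= H)%VS = (X <= H)%VS.
  apply/limg_subP/subvP => h; first by move=> v vX; have := h (vsproj X v); rewrite lfunE /= vsprojK.
  by move=> u; rewrite lfunE h // subvsP.
by apply/fsetP => Y; apply/idP/idP => [/mem_restriction|/mem_pull] [H [HA h ->]];
  [apply/mem_pull|apply/mem_restriction]; exists H; rewrite ?e // -e.
Qed.

Lemma is_arrangement_pull U V (p : 'Hom(U, V)) A : is_arrangement A -> is_arrangement (pull p A).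
Proof.
move=> hA Y /mem_pull[H [/hA /hyperplane_form[al [e [hal ale hH]]] nH ->]].
have /subvPn[v /memv_imgP[u _ ->] vH] := nH.
apply: (form_hyperplane (al := fun u => al (p u)) (e := u)).
- by move=> a u1 u2; rewrite linearP hal.
- by rewrite -hH.
- by move=> w; rewrite -memv_preim hH.
Qed.

Lemma pull_surj_logvf U V (p : 'Hom(U, V)) A (H : {vspace V}) : H \in A ->
  (p @^-1: H)%VS \in pull p A \/ forall u, p u \in H.
Proof.
move=> HA; case: (boolP (limg p <= H)%VS) => [/limg_subP|]; first by right.
by left; apply/mem_pull; exists H.
Qed.

Lemma fbasis_pull_iso U V (p : 'Hom(U, V)) (q : 'Hom(V, U)) A (I : finType) (d : I -> nat) phi :
  cancel p q -> cancel q p -> fbasis d A phi -> fbasis d (pull p A) (fun i u => q (phi i (p u))).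
Proof.
move=> pq qp [h1 h2 h3 h4].
have hp : polymap p by apply: polymap_linear.
have hq : polymap q by apply: polymap_linear.
split.
- move=> i; split; first by apply: (polymap_comp _ hq); apply: (polymap_comp hp); case: (h1 i).
  move=> Y /mem_pull[H [HA _ ->]] u; rewrite -!memv_preim qp => uH.
  exact: (h1 i).2.
- by move=> i c u; rewrite linearZ /= h2 linearZ.
- move=> eta [e1 e2].
  have [|g [hg gE]] := h3 (fun v => p (eta (q v))).
    split; first by apply: (polymap_comp _ hp); apply: (polymap_comp hq).
    move=> H HA v vH; have [Y|h] := pull_surj_logvf p HA; last exact: h.
    by rewrite memv_preim; apply: e2 => //; rewrite -memv_preim qp.
  exists (fun i u => g i (p u)); split=> [i|u]; first exact: (polyfun_comp hp).
  have := congr1 q (gE (p u)); rewrite !pq => ->; rewrite linear_sum.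
  by apply: eq_bigr => i _; rewrite linearZ.
- move=> g hg g0 i u; rewrite -[u]pq.
  apply: (h4 (fun i v => g i (q v))) => [j|v]; first exact: (polyfun_comp hq).
  have := congr1 p (g0 (q v)); rewrite linear0 linear_sum => e; rewrite -[RHS]e.
  by apply: eq_bigr => j _; rewrite linearZ /= !qp.
Qed.

Definition optcase (I : finType) (T : Type) (x : T) (f : I -> T) (o : option I) : T :=
  if o is Some i then f i else x.

Lemma big_option (M : nmodType) (I : finType) (F : option I -> M) :
  \sum_o F o = F None + \sum_i F (Some i).
Proof.
rewrite (bigD1 None) //=; congr (_ + _).
rewrite (reindex_omap Some id) //=; last by case.
by apply: eq_bigl => i; rewrite eqxx.
Qed.

(** Product with the line spanned by [k]: the constant field [k], of degree 0, joins the lifted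
    basis. The V-component of a logarithmic field is expanded in powers of the coordinate [y], and
    each coefficient is logarithmic for [A]. *)
Lemma fbasis_pull_line U V (p : 'Hom(U, V)) (s : 'Hom(V, U)) (k : U) (y : U -> K) A
    (I : finType) (d : I -> nat) phi :
  is_arrangement A -> cancel s p -> lin y -> y k = 1 -> p k = 0 -> (forall v, y (s v) = 0) ->
  (forall u, u = s (p u) + y u *: k) ->
  fbasis d A phi ->
  fbasis (optcase 0%N d) (pull p A) (optcase (fun _ => k) (fun i u => s (phi i (p u)))).
Proof.
move=> hA sp hy yk pk ys uE [h1 h2 h3 h4].
have hp : polymap p by apply: polymap_linear.
have hs : polymap s by apply: polymap_linear.
have psk v t : p (s v + t *: k) = v by rewrite linearD linearZ /= sp pk scaler0 addr0.
have ysk v t : y (s v + t *: k) = t by rewrite linD // linZ // ys yk add0r mulr1.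
split.
- case=> [i|] /=; split.
  + by apply: (polymap_comp _ hs); apply: (polymap_comp hp); case: (h1 i).
  + move=> Y /mem_pull[H [HA _ ->]] u; rewrite -!memv_preim sp => uH.
    exact: (h1 i).2.
  + exact: polymap_const.
  + by move=> Y /mem_pull[H [HA _ ->]] u _; rewrite -memv_preim pk mem0v.
- by case=> [i|] c u /=; rewrite ?expr0 ?scale1r // linearZ /= h2 linearZ.
- move=> eta [e1 e2]; set b := vbasis {:V}.
  have: forall i, exists P : (V -> {poly K}) * nat,
    [/\ forall v t, coord b i (p (eta (s v + t *: k))) = (P.1 v).[t],
        forall m, polyfun (fun v => (P.1 v)`_m) & forall v, (size (P.1 v) <= P.2)%N].
    move=> i; have [|P [n hP]] := polyfun_pencil hs (polymap_const V k) (f := fun u => coord b i (p (eta u))) _.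
      by apply: (polymap_comp e1 hp); apply: lin_coord.
    by exists (P, n).
  move=> /fin_all_exists[P hP]; pose N := \max_i (P i).2.
  pose et m v := \sum_i ((P i).1 v)`_m *: b`_i.
  have etaE v t : p (eta (s v + t *: k)) = \sum_(m < N) t ^+ m *: et m v.
    rewrite [LHS]vbasis_expand.
    rewrite (eq_bigr (fun i => \sum_(m < N) (((P i).1 v)`_m * t ^+ m) *: b`_i)); last first.
      move=> i _; case: (hP i) => -> _ sz; rewrite -scaler_suml; congr (_ *: _).
      by apply: horner_coef_wide; apply: (leq_trans (sz v)); apply: leq_bigmax.
    rewrite exchange_big; apply: eq_bigr => m _; rewrite scaler_sumr; apply: eq_bigr => i _.
    by rewrite scalerA mulrC.
  have et_log m : (m < N)%N -> logvf A (et m).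
    move=> mN; split.
      by apply: polymap_sum => i; apply: polymapZ; [case: (hP i)|apply: polymap_const].
    move=> H HA v vH; have [al [e [hal ale hH]]] := hyperplane_form (hA _ HA).
    pose Q : {poly K} := \poly_(m < N) al (et m v).
    have Q0 : Q = 0.
      apply: poly_horner_eq0 => t; rewrite horner_poly.
      have <- : al (p (eta (s v + t *: k))) = \sum_(i < N) al (et i v) * t ^+ i.
        by rewrite etaE lin_sum //; apply: eq_bigr => j _; rewrite linZ // mulrC.
      apply/eqP; rewrite -hH; have [Y|] := pull_surj_logvf p HA; last by apply.
      by rewrite memv_preim; apply: e2 => //; rewrite -memv_preim psk.
    by rewrite hH; have := congr1 (fun q : {poly K} => q`_m) Q0; rewrite coef_poly mN coef0 => ->.
  have: forall m : 'I_N, exists g : I -> V -> K,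
    (forall i, polyfun (g i)) /\ forall v, et m v = \sum_i g i v *: phi i v.
    by move=> m; apply: h3; apply: et_log.
  move=> /fin_all_exists[g hg].
  exists (optcase (fun u => y (eta u)) (fun i u => \sum_(m < N) y u ^+ m * g m i (p u))); split.
    case=> [i|] /=; last exact: e1.
    apply: polyfun_sum => m; apply: polyfunM; last by apply: (polyfun_comp hp); case: (hg m).
    by apply: polyfunX; apply: polyfun_lin.
  move=> u; rewrite big_option /= [LHS]uE addrC; congr (_ + _).
  rewrite {1}[u]uE etaE linear_sum.
  rewrite (eq_bigr (fun m : 'I_N => \sum_i (y u ^+ m * g m i (p u)) *: s (phi i (p u)))); last first.
    move=> m _; case: (hg m) => _ ->; rewrite linearZ linear_sum /= scaler_sumr.
    by apply: eq_bigr => i _; rewrite linearZ /= scalerA.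
  by rewrite exchange_big; apply: eq_bigr => i _; rewrite scaler_suml.
- move=> g hg g0.
  have gs i u : g (Some i) u = 0.
    rewrite [u]uE; move: (y u) (p u) => t v.
    apply: (h4 (fun i v => g (Some i) (s v + t *: k))) => {i v} [i|v].
      by apply: (polyfun_comp _ (hg _)); apply: polymapD => //; apply: polymap_const.
    have := congr1 p (g0 (s v + t *: k)); rewrite big_option /= linear0 linearD linearZ /= pk scaler0 add0r.
    rewrite linear_sum => e; rewrite -[RHS]e.
    by apply: eq_bigr => i _; rewrite linearZ /= sp psk.
  case=> [i|] u //; have := g0 u; rewrite big_option big1 ?addr0 /=.
    by move=> /(congr1 y); rewrite linZ // yk mulr1 lin0.
  by move=> i _; rewrite gs scale0r.
Qed.

End Pullback.

(** * Inductively free arrangements with their exponents *)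

Section Good.
Variable K : numFieldType.
Implicit Types U V W : vectType K.

Lemma map_nth_enum_ord (T : Type) (x0 : T) (s : seq T) : [seq nth x0 s (i : 'I_(size s)) | i <- enum 'I_(size s)] = s.
Proof. by rewrite (map_comp (nth x0 s) val) val_enum_ord -/(mkseq _ _) mkseq_nth. Qed.

Lemma pull_surj U V (p : 'Hom(U, V)) : limg p = fullv -> cancel (p^-1)%VF p.
Proof. by move=> hp v; apply: limg_lfunVK; rewrite hp memvf. Qed.

Lemma free_pull U V (p : 'Hom(U, V)) A es : limg p = fullv -> (\dim (lker p) <= 1)%N ->
  is_arrangement A -> free_with_exponents A es ->
  free_with_exponents (pull p A) (nseq (\dim (lker p)) 0%N ++ es).
Proof.
move=> hp dp hA /(free_fbasis hA)[phi hphi].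
have sp := pull_surj hp; have hpA := is_arrangement_pull (p := p) hA.
have [k0|k1] : \dim (lker p) = 0%N \/ \dim (lker p) = 1%N by move: dp; case: (\dim _) => [|[|]]; auto.
  rewrite k0; apply: (fbasis_free hpA (fbasis_pull_iso _ sp hphi)); last by rewrite map_nth_enum_ord.
  by apply: lker0_lfunK; rewrite -dimv_eq0 k0.
have [k kp kE] : exists2 k, k != 0 & lker p = <[k]>%VS.
  exists (vpick (lker p)); first by rewrite vpick0 -dimv_eq0 k1.
  apply/eqP; rewrite eq_sym eqEdim k1 dim_vline vpick0 -dimv_eq0 k1 andbT -memvE.
  exact: memv_pick.
have [f fl fk] := lin_dual kp.
have pk : p k = 0 by apply/eqP; rewrite -memv_ker kE memv_line.
pose y u := f (u - (p^-1)%VF (p u)).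
have hy : lin y.
  move=> a u v; rewrite /y -fl; congr f.
  by rewrite [p _]linearP [(p^-1)%VF _]linearP /= scalerBr opprD addrACA.
rewrite k1; apply: (fbasis_free hpA (fbasis_pull_line hA sp hy _ pk _ _ hphi)).
- by rewrite /y pk linear0 subr0.
- by move=> v; rewrite /y sp subrr (lin0 fl).
- move=> u; have : u - (p^-1)%VF (p u) \in lker p by rewrite memv_ker linearB /= sp subrr.
  rewrite kE => /vlineP[c cE].
  by rewrite /y cE linZ // fk mulr1 -cE addrC subrK.
- rewrite enumT unlock /= -enumT.
  by rewrite -map_comp /= -[X in perm_eq (_ :: X)](map_nth_enum_ord 0%N).
Qed.

Lemma dim_lker_restr U V (p : 'Hom(U, V)) (X : {vspace V}) (p' : 'Hom(subvs_of (p @^-1: X), subvs_of X)) :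
  (forall u, vsval (p' u) = p (vsval u)) -> \dim (lker p') = \dim (lker p).
Proof.
move=> pE; set i := linfun (vsval : subvs_of (p @^-1: X) -> U).
have iE u : i u = vsval u by rewrite lfunE.
have i0 : lker i == 0%VS by apply/lker0P => u v; rewrite !iE; apply: subvs_inj.
rewrite -(limg_dim_eq (f := i)) ?(eqP i0) ?capv0 //; congr (\dim _).
apply/vspaceP => u; apply/memv_imgP/idP => [[w wk ->]|uk].
  move: wk; rewrite !memv_ker iE -pE => /eqP ->; rewrite linear0 //.
have uX : u \in (p @^-1: X)%VS by move: uk; rewrite memv_ker -memv_preim => /eqP ->; rewrite mem0v.
exists (vsproj _ u); last by rewrite iE vsprojK.
rewrite memv_ker; apply/eqP/subvs_inj; rewrite pE vsprojK // linear0; apply/eqP.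
by rewrite -memv_ker.
Qed.

Lemma pullD1 U V (p : 'Hom(U, V)) A H : limg p = fullv -> is_arrangement A -> H \in A ->
  pull p A `\ (p @^-1: H)%VS = pull p (A `\ H).
Proof.
move=> hp hA HA; have sp := pull_surj hp.
apply/fsetP => Y; rewrite !inE; apply/andP/idP => [[YH /mem_pull[X [XA hX YX]]]|/mem_pull[X []]].
  apply/mem_pull; exists X; split=> //; rewrite !inE XA andbT.
  by apply: contraNneq YH => <-; rewrite YX.
rewrite !inE => /andP[XH XA] hX ->; split; last by apply/mem_pull; exists X.
apply: contraNneq XH => e; apply/eqP/vspaceP => v.
by have := congr1 (fun Y : {vspace U} => (p^-1)%VF v \in Y) e; rewrite -!memv_preim sp.
Qed.

(** The restriction of the pullback to the preimage of [H] is the pullback of the restriction along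
    the induced map [p']. The kernel of [p] lies in every preimage, so [p'] has a kernel of the same
    dimension and the induction hypothesis applies to it. *)
Lemma inductively_free_pull V (A : {fset {vspace V}}) : inductively_free A -> is_arrangement A ->
  forall U (p : 'Hom(U, V)), limg p = fullv -> (\dim (lker p) <= 1)%N -> inductively_free (pull p A).
Proof.
elim=> {V A} [V _ U p hp dp|V A H es es' HA _ IH1 _ IH2 f1 f2 inc hA U p hp dp].
  rewrite (_ : pull p _ = fset0); first exact: IF_empty.
  by apply/fsetP => Y; rewrite in_fset0; apply/negP => /mem_pull[X []]; rewrite in_fset0.
have hA1 : is_arrangement (A `\ H) by move=> X; rewrite !inE => /andP[_]; apply: hA.
have hA2 := is_arrangement_restriction (X := H) hA.
have lp (X : {vspace V}) : ~~ (limg p <= X)%VS = (X != fullv).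
  rewrite hp; congr negb; apply/idP/eqP => [s|->]; last exact: subvv.
  by apply/eqP; rewrite eqEsubv subvf s.
have Hf : H != fullv by apply/eqP => e; have := hA _ HA; rewrite e; lia.
pose X := (p @^-1: H)%VS.
pose p' : 'Hom(subvs_of X, subvs_of H) := (linfun (vsproj H) \o (p \o linfun vsval))%VF.
have p'E u : vsval (p' u) = p (vsval u).
  by rewrite !comp_lfunE !lfunE /= vsprojK // memv_preim subvsP.
have hp' : limg p' = fullv.
  apply/vspaceP => v; rewrite memvf; have sp := pull_surj hp.
  have wX : (p^-1)%VF (vsval v) \in X by rewrite -memv_preim sp subvsP.
  apply/memv_imgP; exists (vsproj X ((p^-1)%VF (vsval v))); rewrite ?memvf //.
  by apply: subvs_inj; rewrite p'E vsprojK // sp.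
have dp' : \dim (lker p') = \dim (lker p) by apply: dim_lker_restr.
have rE : restriction (pull p A) X = pull p' (restriction A H).
  rewrite !restrictionE !pull_comp; congr pull; apply/lfunP => u.
  by rewrite [LHS]comp_lfunE [RHS]comp_lfunE [RHS]lfunE /= p'E lfunE.
have g1 := free_pull hp dp hA1 f1.
have g2 : free_with_exponents (restriction (pull p A) X) (nseq (\dim (lker p)) 0%N ++ es').
  by rewrite rE -dp'; apply: free_pull; rewrite ?dp'.
apply: (IF_add (H := X) (es := nseq (\dim (lker p)) 0%N ++ es) _ _ _ _ g2); first last.
- by move=> e; rewrite !count_cat leq_add2l; apply: inc.
- rewrite pullD1 //; exact: g1.
- by rewrite rE; apply: IH2 => //; rewrite dp'.
- by rewrite pullD1 //; apply: IH1.
- by apply/mem_pull; exists H; rewrite lp.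
Qed.

(** The cardinality is carried along with freeness because it determines the degree of Terao's
    polynomial when a hyperplane is added. *)
Definition good V (A : {fset {vspace V}}) (es : seq nat) : Prop :=
  [/\ is_arrangement A, inductively_free A, free_with_exponents A es & #|` A| = sumn es].

Lemma good_perm V (A : {fset {vspace V}}) es es' : perm_eq es es' -> good A es -> good A es'.
Proof.
move=> pe [h1 h2 h3 h4]; split=> //; last by rewrite h4; apply: perm_sumn.
have [phi hphi] := free_fbasis h1 h3.
by apply: (fbasis_free h1 hphi); rewrite map_nth_enum_ord perm_sym.
Qed.

Lemma good_pull U V (p : 'Hom(U, V)) A es : limg p = fullv -> (\dim (lker p) <= 1)%N ->
  good A es -> good (pull p A) (nseq (\dim (lker p)) 0%N ++ es).
Proof.
move=> hp dp [h1 h2 h3 h4]; split.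
- exact: is_arrangement_pull.
- exact: inductively_free_pull.
- exact: free_pull.
have -> : pull p A = [fset (p @^-1: H)%VS | H in A].
  apply/fsetP => Y; apply/idP/imfsetP => [/mem_pull[H [HA _ ->]]|[H /= HA ->]]; first by exists H.
  apply/mem_pull; exists H; split=> //; rewrite hp; apply/negP => s.
  have := h1 _ HA; have -> : H = fullv by apply/eqP; rewrite eqEsubv s subvf.
  by move/eqP; rewrite eqn_leq ltnn.
rewrite card_imfset /= ?h4 ?sumn_cat ?sumn_nseq ?mul0n // => H1 H2 e.
have sp := pull_surj hp; apply/vspaceP => v.
by have := congr1 (fun Y : {vspace U} => (p^-1)%VF v \in Y) e; rewrite -!memv_preim sp.
Qed.

Lemma good_empty V : \dim {:V} = 0%N -> good (fset0 : {fset {vspace V}}) [::].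
Proof.
move=> d0; have hA : is_arrangement (fset0 : {fset {vspace V}}) by [].
split=> //; first exact: IF_empty.
apply: (fbasis_free hA (I := void) (d := fun _ : void => 0%N) (phi := fun i : void => match i with end)); last first.
  by rewrite enumT unlock.
split; [by case|by case| |by move=> g _ _ []].
move=> eta _; exists (fun i : void => match i with end); split=> [[]|v].
rewrite big_pred0 => [|[]]; apply/eqP; rewrite -memv0.
have -> : (0%VS : {vspace V}) = fullv by apply/esym/eqP; rewrite -dimv_eq0 d0.
exact: memvf.
Qed.

Lemma perm_incr (I : finType) (d : I -> nat) i0 b es : d i0 = b ->
  perm_eq (b :: es) [seq d i | i <- enum I] ->
  perm_eq (b.+1 :: es) [seq (d i + (i == i0))%N | i <- enum I].
Proof.
move=> db; have i0I : i0 \in enum I by rewrite mem_enum.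
rewrite !(permPr (perm_map _ (perm_to_rem i0I))) /= db eqxx addn1 !perm_cons => h.
rewrite (permPl h) (_ : [seq (d i + (i == i0))%N | i <- rem i0 (enum I)] = map d (rem i0 (enum I))) //.
have hm : {in rem i0 (enum I), (fun i => d i + (i == i0))%N =1 d}; last exact: (iffLR (eq_in_map _ _ _) hm).
move=> i; rewrite mem_rem_uniq ?enum_uniq // !inE => /andP[/negPf -> _].
by rewrite addn0.
Qed.

Lemma good_add V (A : {fset {vspace V}}) H b es : is_arrangement (H |` A) -> H \notin A ->
  good A (b :: es) -> good (restriction (H |` A) H) es -> good (H |` A) (b.+1 :: es).
Proof.
move=> hA HA [h1 h2 h3 h4] [k1 k2 k3 k4].
have D : (H |` A) `\ H = A by rewrite fsetU1K.
split=> //.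
- apply: (IF_add (H := H) (es := b :: es) (es' := es)); rewrite ?D ?inE ?eqxx //.
  by move=> e /=; apply: leq_addl.
- have [th hth] := free_fbasis h1 h3; have [phi hphi] := free_fbasis k1 k3.
  have [||i0 [th' [di0 hth']]] := fbasis_addition hA HA hth hphi (b := b).
  + by rewrite !map_nth_enum_ord.
  + by rewrite h4 k4.
  apply: (fbasis_free hA hth'); apply: perm_incr => //.
  by rewrite map_nth_enum_ord.
- by rewrite cardfsU1 HA h4.
Qed.

End Good.

(** * Flags of restrictions *)

Section Flags.
Variable K : numFieldType.
Implicit Types U V W : vectType K.

(** Recursive form of a flag: each member is a hyperplane of the preceding restriction. Since
    exponents are listed with the dropped one last, the prefixes [take d es] appear by
    themselves. *)
Inductive flagged : forall V, {fset {vspace V}} -> seq nat -> Prop :=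
| flagged_line V (A : {fset {vspace V}}) e : \dim {:V} = 1%N -> good A [:: e] -> flagged A [:: e]
| flagged_step V (A : {fset {vspace V}}) H es e :
    H \in A -> good A (rcons es e) -> flagged (restriction A H) es -> flagged A (rcons es e).

Lemma memv_bigcap_seq V (B : seq {vspace V}) v :
  (v \in (\bigcap_(H <- B) H)%VS) = all (fun H : {vspace V} => v \in H) B.
Proof.
elim: B => [|H B IH]; first by rewrite big_nil memvf.
by rewrite big_cons memv_cap IH.
Qed.

Lemma good_iso U V (A : {fset {vspace V}}) (p : 'Hom(U, V)) es :
  (forall v, exists u, p u = v) -> injective p -> good A es -> good (pull p A) es.
Proof.
move=> sp ip hA.
have k0 : \dim (lker p) = 0%N by apply/eqP; rewrite dimv_eq0; apply/lker0P.
have hp : limg p = fullv.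
  by apply/vspaceP => v; rewrite memvf; have [u <-] := sp v; rewrite memv_img ?memvf.
by have := good_pull hp _ hA; rewrite k0 => /(_ isT).
Qed.

Lemma good_restriction_full V (A : {fset {vspace V}}) es : good A es -> good (restriction A fullv) es.
Proof.
move=> hA; rewrite restrictionE; apply: good_iso hA => [v|u v].
  by exists (vsproj fullv v); rewrite lfunE /= vsprojK ?memvf.
by rewrite !lfunE; apply: subvs_inj.
Qed.

(** A subspace of [H] and its image in [V] are different types, so iterated and direct restriction
    can only be compared through the isomorphism [q]. *)
Lemma good_restriction2 V (A : {fset {vspace V}}) H (Y : {vspace subvs_of H}) es :
  good (restriction (restriction A H) Y) es ->
  good (restriction A (linfun (vsval : subvs_of H -> V) @: Y)%VS) es.
Proof.
set X := (_ @: Y)%VS => hG.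
have vX (y : subvs_of H) : y \in Y -> vsval y \in X.
  by move=> yY; rewrite -[vsval y](lfunE (vsval : {linear _ -> V})) memv_img.
pose q : 'Hom(subvs_of X, subvs_of Y) := (linfun (vsproj Y) \o (linfun (vsproj H) \o linfun vsval))%VF.
have qE u : vsval (vsval (q u)) = vsval u.
  have /memv_imgP[y yY yE] := subvsP u.
  by rewrite !comp_lfunE !lfunE /= yE lfunE /= vsvalK vsprojK.
have -> : restriction A X = pull q (restriction (restriction A H) Y).
  rewrite !restrictionE !pull_comp; congr pull; apply/lfunP => u.
  by rewrite [RHS]comp_lfunE [(_ \o q)%VF u]comp_lfunE [LHS]lfunE -[LHS](qE u); move: (q u) => w; rewrite !lfunE.
apply: good_iso hG => [y|u v e]; last by apply: subvs_inj; rewrite -!qE e.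
exists (vsproj X (vsval (vsval y))); apply/subvs_inj/subvs_inj.
by rewrite qE vsprojK // vX // subvsP.
Qed.

Lemma flagged_flag V (A : {fset {vspace V}}) es : flagged A es ->
  [/\ size es = \dim {:V}, good A es
    & exists X : nat -> {vspace V},
      [/\ X (\dim {:V}) = fullv,
          forall d, (1 <= d < \dim {:V})%N -> (X d <= X d.+1)%VS
        & forall d, (1 <= d <= \dim {:V})%N ->
            [/\ in_lattice A (X d), \dim (X d) = d & good (restriction A (X d)) (take d es)]]].
Proof.
have full U (B : {fset {vspace U}}) : in_lattice B fullv.
  by exists fset0; rewrite ?fsub0set // big_nil.
elim=> {V A es} [V A e d1 hA|V A H es e HA hA _ [sz hG [Y [Y1 Y2 Y3]]]].
  split=> //; exists (fun=> fullv); rewrite d1; split=> // d hd.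
  have -> : d = 1%N by lia.
  by split=> //; apply: good_restriction_full.
have hAr : is_arrangement A by case: hA.
have dH := hAr _ HA; have dW : \dim {:subvs_of H} = \dim H by rewrite dimvf.
rewrite dW in sz Y1 Y2 Y3.
pose j := linfun (vsval : subvs_of H -> V).
have jE u : j u = vsval u by rewrite lfunE.
have j0 : lker j == 0%VS by apply/lker0P => u v; rewrite !jE; apply: subvs_inj.
rewrite size_rcons sz -dH; split=> //.
exists (fun d => if (d <= \dim H)%N then (j @: Y d)%VS else fullv); rewrite ltnn; split=> //.
  move=> d hd; rewrite (_ : (d <= \dim H)%N); last by lia.
  by case: leqP => h; [apply: subvf|apply: limgS; apply: Y2; lia].
move=> d hd; case: leqP => h; last first.
  have -> : d = (\dim H).+1 by lia.
  split=> //; rewrite take_oversize ?size_rcons ?sz //; exact: good_restriction_full.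
have [|[B BA YE] dY gY] := Y3 d; first by lia.
split.
(* All hyperplanes through the subspace: [H] is among them, and so are hyperplanes of [A] inducing
   those that cut out [Y d] in [H]. *)
- exists [fset H' in A | (j @: Y d <= H')%VS].
    by apply/fsubsetP => X; rewrite !inE => /andP[].
  apply/vspaceP => v; rewrite memv_bigcap_seq; apply/idP/allP => [vY X|hv].
    by rewrite !inE => /andP[_ /subvP]; apply.
  have vH : v \in H.
    apply: hv; rewrite !inE HA; apply/subvP => w /memv_imgP[y _ ->].
    by rewrite jE subvsP.
  rewrite -(vsprojK vH) -jE memv_img // YE memv_bigcap_seq; apply/allP => C CB.
  have /mem_restriction[X [XA HX CE]] := fsubsetP BA _ CB.
  rewrite CE mem_vsval_preim vsprojK //; apply: hv; rewrite !inE XA.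
  apply/subvP => w /memv_imgP[y yY ->]; rewrite jE -mem_vsval_preim -CE.
  by move: yY; rewrite YE memv_bigcap_seq => /allP; apply.
- by rewrite limg_dim_eq // (eqP j0) capv0.
- have -> : take d (rcons es e) = take d es by rewrite -cats1 takel_cat // sz.
  exact: good_restriction2.
Qed.

Lemma flagged_ind_flag_accurate V (A : {fset {vspace V}}) es :
  sorted leq es -> flagged A es -> ind_flag_accurate A.
Proof.
move=> hs /flagged_flag[_ [h1 h2 h3 _] [X [X1 X2 X3]]].
split=> //; exists es; split=> //; exists X; split=> // d /X3[? ? [_ k2 k3 _]]; split=> //.
Qed.

End Flags.

Section Forms.
Variables (K : numFieldType) (U V : vectType K) (g : U -> V).
Hypothesis hg : linear g.
HB.instance Definition _ := GRing.isSemilinear.Build K U V _ g (GRing.semilinear_linear hg).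
Lemma linear_lfun : exists L : 'Hom(U, V), L =1 g.
Proof. by exists (linfun g) => u; rewrite lfunE. Qed.
End Forms.

Lemma ker_form (K : numFieldType) (V : vectType K) (f : V -> K) : lin f ->
  exists H : {vspace V}, forall v, (v \in H) = (f v == 0).
Proof.
move=> hf; have [L hL] := @linear_lfun K V K^o f hf.
by exists (lker L) => v; rewrite memv_ker hL.
Qed.

(** * Gain graphs *)

Section GainGraphs.
Variable K : numFieldType.
Implicit Types (V : vectType K) (s : nat -> bool) (E : nat -> nat -> int -> bool) (es : seq nat).

(** The [x i] with [s i], together with [z], form linear coordinates, and [x 0] is zero, which makes
    coordinate hyperplanes edges to the vertex 0. Indexing by all of [nat] lets a restriction keep
    its labels and only shrink [s]. *)
Definition coordsys V s (x : nat -> V -> K) (z : V -> K) : Prop :=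
  [/\ (forall i, lin (x i)) /\ lin z, forall v, x 0%N v = 0, s 0%N = false,
      forall v, (forall i, s i -> x i v = 0) -> z v = 0 -> v = 0
    & forall (c : nat -> K) c0, exists v, (forall i, s i -> x i v = c i) /\ z v = c0].

Definition vert s i : bool := (i == 0%N) || s i.

Definition edge_hyp V (x : nat -> V -> K) (z : V -> K) i j (t : int) (H : {vspace V}) : Prop :=
  forall v, (v \in H) = (x i v == x j v + t%:~R * z v).

Definition infinity_hyp V (z : V -> K) (H : {vspace V}) : Prop := forall v, (v \in H) = (z v == 0).

Definition realizes V s (x : nat -> V -> K) (z : V -> K) E (A : {fset {vspace V}}) : Prop :=
  forall H, H \in A <-> infinity_hyp z H \/
    exists i j t, [/\ vert s i, vert s j, i != j, E i j t & edge_hyp x z i j t H].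

Definition symgain E : Prop := forall i j t, E i j t = E j i (- t).

(* E i j t encodes the hyperplane x_i = x_j + t z, where x_0 = 0; the
   hyperplane z = 0 is always present. *)
Definition gain_prop (Q : forall V, {fset {vspace V}} -> Prop) s E : Prop :=
  forall V x z (A : {fset {vspace V}}), coordsys s x z -> realizes s x z E A -> Q V A.

Definition gain_free s E es := gain_prop (fun V A => good A es) s E.
Definition gain_flag s E es := gain_prop (fun V A => flagged A es) s E.

Definition remv s i : nat -> bool := fun k => s k && (k != i).

(** On x_i = x_j + t0 z, an edge x_u = x_i + t z reads x_u = x_j + (t + t0) z. Loops created at [j]
    are harmless, as [realizes] asks for distinct ends. *)
Definition contract E i j (t0 : int) : nat -> nat -> int -> bool := fun u v t =>
  [|| E u v t, (v == j) && E u i (t - t0) | (u == j) && E i v (t + t0)].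

Lemma gain_prop_ext Q s s' E E' : s =1 s' ->
  (forall i j t, vert s i -> vert s j -> i != j -> E i j t = E' i j t) ->
  gain_prop Q s E -> gain_prop Q s' E'.
Proof.
move=> ss' EE' h V x z A [c1 c2 c3 c4 c5] hA; apply: (h V x z A).
  split=> //; first by rewrite ss'.
    by move=> v h0 zv; apply: c4 => // i; rewrite -ss'; apply: h0.
  by move=> c c0; have [v [v1 v2]] := c5 c c0; exists v; split=> // i; rewrite ss'; apply: v1.
have vv i : vert s i = vert s' i by rewrite /vert ss'.
move=> H; rewrite hA; split=> [] [?|[i [j [t [h1 h2 h3 h4 h5]]]]]; try (by left); right.
  by exists i, j, t; rewrite !vv EE' ?vv.
by exists i, j, t; rewrite -!vv -EE'.
Qed.

Lemma gain_free_perm s E es es' : perm_eq es es' -> gain_free s E es -> gain_free s E es'.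
Proof. by move=> pe h V x z A cs hA; apply: (good_perm pe); apply: h cs hA. Qed.

Section Coordinates.
Variables (V : vectType K) (s : nat -> bool) (x : nat -> V -> K) (z : V -> K).
Hypothesis cs : coordsys s x z.

Lemma coord_point (c : nat -> K) c0 : c 0%N = 0 ->
  exists v, (forall i, vert s i -> x i v = c i) /\ z v = c0.
Proof.
move=> h0; have [_ c2 _ _ c5] := cs; have [v [v1 v2]] := c5 c c0; exists v; split=> // i.
by case/orP => [/eqP->|]; [rewrite c2 h0|apply: v1].
Qed.

Lemma si_neq0 i : s i -> i != 0%N.
Proof. by have [_ _ h _ _] := cs; apply: contraTneq => ->; rewrite h. Qed.

Lemma edge_lin i j (t : int) : lin (fun v => x i v - (x j v + t%:~R * z v)).
Proof. by have [[h1 h2] _ _ _ _] := cs => a u v; rewrite !h1 h2; ring. Qed.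

Lemma edge_exists i j t : exists H, edge_hyp x z i j t H.
Proof.
have [H hH] := ker_form (edge_lin i j t); exists H => v.
by rewrite hH subr_eq0.
Qed.

Lemma infinity_exists : exists H, infinity_hyp z H.
Proof. by have [[_ h] _ _ _ _] := cs; apply: ker_form. Qed.

Lemma edge_hyp_sym i j t H : edge_hyp x z i j t H -> edge_hyp x z j i (- t) H.
Proof.
move=> h v; rewrite h -subr_eq0 -[RHS]subr_eq0 -oppr_eq0; congr (_ == _).
by rewrite intrN; ring.
Qed.

Lemma edge_hyp_uniq i j t H H' : edge_hyp x z i j t H -> edge_hyp x z i j t H' -> H = H'.
Proof. by move=> h h'; apply/vspaceP => v; rewrite h h'. Qed.

Lemma infinity_hyp_uniq H H' : infinity_hyp z H -> infinity_hyp z H' -> H = H'.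
Proof. by move=> h h'; apply/vspaceP => v; rewrite h h'. Qed.

(** Put 1 at a nonzero end [m] of the edge ab, 0 elsewhere, and let [x i] copy [x j]. Such points
    inside z = 0 tell apart the underlying edges of two hyperplanes. *)
Lemma separating_point a b i j : vert s a -> vert s b -> a != b ->
  a != i -> b != i -> i != 0%N -> vert s i -> vert s j ->
  exists v, [/\ z v = 0, x a v != x b v & x i v = x j v].
Proof.
move=> va vb ab ai bi i0 vi vj.
pose m := if a == 0%N then b else a.
pose c k : K := if k == i then (j == m)%:R else (k == m)%:R.
have m0 : m != 0%N.
  by rewrite /m; case: (eqVneq a 0%N) => // a0; rewrite -a0 eq_sym.
have [|v [v1 v2]] := coord_point (c := c) 0.
  by rewrite /c eq_sym (negPf i0) eq_sym (negPf m0).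
exists v; split=> //; rewrite !v1 // /c ?eqxx ?(negPf ai) ?(negPf bi).
  rewrite /m; case: (eqVneq a 0%N) => [a0|a0].
    by rewrite (negPf ab) eqxx eq_sym oner_eq0.
  by rewrite eqxx [b == a]eq_sym (negPf ab) oner_eq0.
by rewrite if_same.
Qed.

(** The points of the hyperplane with z = 0 determine its two ends, and a point with z = 1 then
    determines the gain, integers being embedded in [K]. Deleting a hyperplane is thus deleting one
    edge. *)
Lemma edge_distinct a b t i j t0 H : vert s a -> vert s b -> a != b -> s i -> vert s j -> i != j ->
  edge_hyp x z a b t H -> edge_hyp x z i j t0 H ->
  [/\ a = i, b = j & t = t0] \/ [/\ a = j, b = i & t = - t0].
Proof.
move=> va vb ab si vj ij h1 h2.
have i0 : i != 0%N by apply: si_neq0.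
have vi : vert s i by rewrite /vert si orbT.
have key a' b' t' : vert s b' -> a' = i -> a' != b' -> edge_hyp x z a' b' t' H -> b' = j /\ t' = t0.
  move=> vb' -> ib h.
  have bj : b' = j.
    apply/eqP/negPn/negP => bj.
    have b'i : b' != i by rewrite eq_sym.
    have ji : j != i by rewrite eq_sym.
    have [v [zv xv xe]] := separating_point vb' vj bj b'i ji i0 vi vb'.
    have : v \in H by rewrite h zv mulr0 addr0 xe.
    by rewrite h2 zv mulr0 addr0 xe (negPf xv).
  split=> //; rewrite {}bj in h.
  have [|v [v1 v2]] := coord_point (c := fun k => (k == i)%:R * t'%:~R) 1.
    by rewrite eq_sym (negPf i0) mul0r.
  have : v \in H by rewrite h !v1 // v2 eqxx [j == i]eq_sym (negPf ij) mul0r mul1r add0r mulr1.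
  rewrite h2 !v1 // v2 eqxx [j == i]eq_sym (negPf ij) mul0r mul1r add0r mulr1.
  by move=> /eqP /intr_inj.
have [ai|ai] := eqVneq a i; first by left; have [] := key _ _ _ vb ai ab h1.
have [bi|bi] := eqVneq b i.
  right; have [|-> <-] := key _ _ _ va bi _ (edge_hyp_sym h1); first by rewrite eq_sym.
  by rewrite opprK.
exfalso; have [v [zv xv xe]] := separating_point va vb ab ai bi i0 vi vj.
have : v \in H by rewrite h2 zv mulr0 addr0 xe.
by rewrite h1 zv mulr0 addr0 (negPf xv).
Qed.

Lemma edge_infinity i j t H : s i -> vert s j -> i != j ->
  edge_hyp x z i j t H -> infinity_hyp z H -> False.
Proof.
move=> si vj ij h1 h2.
have i0 : i != 0%N by apply: si_neq0.
have [|v [v1 v2]] := coord_point (c := fun k => (k == i)%:R) 0.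
  by rewrite eq_sym (negPf i0).
have : v \in H by rewrite h2 v2.
have vi : vert s i by rewrite /vert si orbT.
rewrite h1 v2 !v1 // eqxx [j == i]eq_sym (negPf ij) mulr0 addr0.
by rewrite oner_eq0.
Qed.

Lemma realizes_arrangement E A : realizes s x z E A -> is_arrangement A.
Proof.
have [[c1 c1'] c2 c3 _ _] := cs => hA H /hA[hH|[i [j [t [vi vj ij _ hH]]]]].
  have [v [_ v2]] := coord_point (c := fun=> 0) 1 erefl.
  by apply: (form_hyperplane (al := z) (e := v)); rewrite // v2 oner_eq0.
wlog si : i j t vi vj ij hH / s i.
  move=> W; case/orP: (vi) => [/eqP i0|si]; last exact: (W i j t).
  case/orP: (vj) => [/eqP j0|sj]; first by rewrite i0 j0 in ij.
  by apply: (W j i (- t)); rewrite // 1?eq_sym //; apply: edge_hyp_sym.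
have i0 : i != 0%N by apply/eqP => e; rewrite e c3 in si.
have [|v [v1 v2]] := coord_point (c := fun k => (k == i)%:R) 0.
  by rewrite eq_sym (negPf i0).
apply: (form_hyperplane (al := fun v => x i v - (x j v + t%:~R * z v)) (e := v)).
- exact: edge_lin.
- by rewrite v2 !v1 // eqxx [j == i]eq_sym (negPf ij) mulr0 addr0 subr0 oner_eq0.
- by move=> w; rewrite hH subr_eq0.
Qed.

Variables (i j : nat) (t0 : int) (H : {vspace V}).
Hypotheses (si : s i) (vj : vert s j) (ij : i != j) (hH : edge_hyp x z i j t0 H).
Local Notation x' := (fun k (u : subvs_of H) => x k (vsval u)).
Local Notation z' := (fun u : subvs_of H => z (vsval u)).

Lemma vert_remv k : vert (remv s i) k = vert s k && (k != i).
Proof.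
by rewrite /vert /remv; case: eqP => //= ->; rewrite eq_sym si_neq0.
Qed.

Lemma coordsys_restriction : coordsys (remv s i) x' z'.
Proof.
have vj' : vert (remv s i) j by rewrite vert_remv vj eq_sym.
have xj0 w : (forall k, remv s i k -> x k w = 0) -> x j w = 0.
  by move=> h; have [_ c2 _ _ _] := cs; case/orP: vj' => [/eqP->|/h].
have [[c1 c1'] c2 c3 c4 c5] := cs; split=> //.
- by split=> [k|] a u v; rewrite linearP; [apply: c1|apply: c1'].
- by rewrite /remv c3.
- move=> v hv zv; apply: subvs_inj; rewrite linear0; apply: c4 => // k sk.
  have [->|ki] := eqVneq k i; last by apply: hv; rewrite /remv sk.
  by have := subvsP v; rewrite hH zv mulr0 addr0 xj0 // => /eqP.
- move=> c c0; pose c' k := if k == 0%N then 0 else c k.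
  have [v [v1 v2]] := c5 (fun k => if k == i then c' j + t0%:~R * c0 else c k) c0.
  have k0 k : remv s i k -> [/\ s k, k != 0%N & k != i].
    by move=> /andP[sk ki]; split=> //; apply/eqP => e; rewrite e c3 in sk.
  have xj : x j v = c' j.
    case/orP: (vj') => [/eqP->|/k0[sj j0 ji]]; first by rewrite c2 /c'.
    by rewrite v1 // (negPf ji) /c' (negPf j0).
  have vH : v \in H by rewrite hH v1 // eqxx xj v2.
  exists (vsproj H v); rewrite vsprojK //; split=> // k /k0[sk _ ki].
  by rewrite v1 // (negPf ki).
Qed.

Lemma realizes_restriction E A : symgain E -> realizes s x z E A ->
  realizes (remv s i) x' z' (contract E i j t0) (restriction A H).
Proof.
move=> Esym hA.
have i0 : i != 0%N by apply: si_neq0.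
have vi : vert s i by rewrite /vert si orbT.
have hHv v : v \in H -> x i v = x j v + t0%:~R * z v by rewrite hH => /eqP.
move=> Y; rewrite mem_restriction; split=> [[X [/hA hX HX ->]]|].
  case: hX => [hX|[a [b [t [va vb ab Eab hX]]]]].
    by left => u; rewrite mem_vsval_preim hX.
  wlog bi : a b t va vb ab Eab hX / b != i.
    move=> W; have [bi|] := eqVneq b i; last exact: (W a b t).
    apply: (W b a (- t)) => //; first by rewrite eq_sym.
      by rewrite Esym opprK.
      exact: edge_hyp_sym.
    by rewrite -bi.
  have [ai|ai] := eqVneq a i; last first.
    right; exists a, b, t; rewrite !vert_remv va vb ai bi ab /contract Eab; split=> // u.
    by rewrite mem_vsval_preim hX.
  have [bj|bj] := eqVneq b j.
    (* A parallel edge with another gain has trace z = 0 on [H]; with the same gain its hyperplane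
       would contain [H], against [HX]. *)
    left => u; rewrite mem_vsval_preim hX ai bj hHv ?subvsP //.
    rewrite (inj_eq (addrI _)) -subr_eq0 -mulrBl mulf_eq0 -intrB intr_eq0 subr_eq0.
    case: eqP => // tt; case/negP: HX; apply/subvP => v vH.
    by rewrite hX ai bj -tt -hH.
  right; exists j, b, (t - t0); rewrite !vert_remv vj vb bi eq_sym ij eq_sym bj /contract eqxx.
  rewrite subrK -ai Eab !orbT; split=> // u.
  rewrite mem_vsval_preim hX ai hHv ?subvsP // -subr_eq0 -[RHS]subr_eq0.
  by congr (_ == _); rewrite intrB; ring.
case=> [hY|[a [b [t [va vb ab]]]]].
  have [X hX] := infinity_exists; exists X; split.
  - by apply/hA; left.
  - pose c k : K := if k == i then t0%:~R + (j == i)%:R else 0.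
    have [|v [v1 v2]] := coord_point (c := c) 1; first by rewrite /c eq_sym (negPf i0).
    apply/negP => /subvP /(_ v); rewrite hX v2 oner_eq0 => h.
    suff : false by []; apply: h.
    by rewrite hH v2 !v1 // /c eqxx [j == i]eq_sym (negPf ij) addr0 add0r mulr1.
  - by apply/vspaceP => u; rewrite mem_vsval_preim hX hY.
move: va vb; rewrite !vert_remv => /andP[va ai] /andP[vb bi].
have [w [zw xw xiw]] := separating_point va vb ab ai bi i0 vi vj.
have wH : w \in H by rewrite hH zw mulr0 addr0 xiw.
have through a' b' t' : vert s a' -> vert s b' -> a' != b' -> E a' b' t' -> x a' w != x b' w ->
   (forall u : subvs_of H, (x a (vsval u) == x b (vsval u) + t%:~R * z (vsval u)) =
      (x a' (vsval u) == x b' (vsval u) + t'%:~R * z (vsval u))) ->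
   edge_hyp x' z' a b t Y -> exists X, [/\ X \in A, ~~ (H <= X)%VS & Y = (linfun vsval @^-1: X)%VS].
  move=> va' vb' ab' E' xw' e hY; have [X hX] := edge_exists a' b' t'; exists X; split.
  - by apply/hA; right; exists a', b', t'.
  - by apply/negP => /subvP /(_ w wH); rewrite hX zw mulr0 addr0 (negPf xw').
  - by apply/vspaceP => u; rewrite mem_vsval_preim hX hY e.
case/or3P => [Eab|/andP[/eqP bj Eai]|/andP[/eqP aj Eib]].
- exact: (through a b t).
- apply: (through a i (t - t0)) => //; first by rewrite xiw -bj.
  move=> u; rewrite hHv ?subvsP // -bj -subr_eq0 -[RHS]subr_eq0.
  by congr (_ == _); rewrite intrB; ring.
- have ib : i != b by rewrite eq_sym.
  apply: (through i b (t + t0)) => //; first by rewrite xiw -aj.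
  move=> u; rewrite hHv ?subvsP // -aj -subr_eq0 -[RHS]subr_eq0.
  by congr (_ == _); rewrite intrD; ring.
Qed.

End Coordinates.

End GainGraphs.

(** * Deletion, contraction and vertex extension of gain graphs *)

Section GainFree.
Variable K : numFieldType.
Implicit Types (V : vectType K) (s : nat -> bool) (E : nat -> nat -> int -> bool) (es : seq nat).
Local Notation gain_free := (gain_free K).
Local Notation gain_flag := (gain_flag K).

(** The addition theorem read on graphs: E is E' with one further edge, recorded in both
    orientations, and the restriction is the contraction of that edge. *)
Lemma gain_add s E E' i j t0 b es : s i -> vert s j -> i != j -> symgain E -> symgain E' ->
  ~~ E' i j t0 ->
  (forall u v t, vert s u -> vert s v -> u != v ->
     E u v t = [|| E' u v t, [&& u == i, v == j & t == t0] | [&& u == j, v == i & t == - t0]]) ->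
  gain_free s E' (b :: es) -> gain_free (remv s i) (contract E i j t0) es ->
  gain_free s E (b.+1 :: es).
Proof.
move=> si vj ij symE symE' nE' EE' h1 h2 V x z A cs hA.
have vi : vert s i by rewrite /vert si orbT.
have [H0 hH0] := edge_exists cs i j t0.
have H0A : H0 \in A.
  by apply/hA; right; exists i, j, t0; rewrite EE' // !eqxx orbT.
have hA' : realizes s x z E' (A `\ H0).
  move=> H; rewrite !inE; split=> [/andP[HH0 /hA[?|[u [v [t [vu vv uv Euv hH]]]]]]|]; first by left.
    move: Euv; rewrite EE' // => /or3P[E'uv|/and3P[/eqP ui /eqP vj' /eqP tt]|/and3P[/eqP uj /eqP vi' /eqP tt]].
    - by right; exists u, v, t.
    - by case/eqP: HH0; apply: (edge_hyp_uniq _ hH0); rewrite -ui -vj' -tt.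
    - case/eqP: HH0; apply: (edge_hyp_uniq _ hH0); rewrite -uj -vi' -[t0]opprK -tt.
      exact: edge_hyp_sym.
  case=> [hz|[u [v [t [vu vv uv E'uv hH]]]]].
    apply/andP; split; last by apply/hA; left.
    by apply/eqP => e; rewrite e in hz; apply: (edge_infinity cs si vj ij hH0 hz).
  apply/andP; split; last by apply/hA; right; exists u, v, t; rewrite EE' // E'uv.
  apply/eqP => e; rewrite e in hH; case/negP: nE'.
  case: (edge_distinct cs vu vv uv si vj ij hH hH0) => -[e1 e2 e3]; subst => //.
  by rewrite symE'.
have eA : H0 |` (A `\ H0) = A by rewrite fsetD1K.
rewrite -eA; apply: good_add; rewrite ?eA ?inE ?eqxx //.
- exact: (realizes_arrangement cs hA).
- exact: h1 cs hA'.
- by apply: h2; [apply: (coordsys_restriction cs si vj ij hH0)|apply: realizes_restriction].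
Qed.

(** A labelling [c] constant along all edges is a direction inside z = 0 contained in every
    hyperplane. The arrangement is then the product of its restriction to x_i = 0 with a line, which
    contributes the exponent 0. *)
Lemma gain_line s E i (c : nat -> int) es : s i -> symgain E -> c 0%N = 0 -> c i = 1 ->
  (forall u v t, vert s u -> vert s v -> u != v -> E u v t -> c u = c v) ->
  gain_free (remv s i) (contract E i 0 0) es -> gain_free s E (0%N :: es).
Proof.
move=> si symE c0 ci cE h V x z A cs hA.
have i0 := si_neq0 cs si; have vi : vert s i by rewrite /vert si orbT.
have [H0 hH0] := edge_exists cs i 0 0.
have H0E v : (v \in H0) = (x i v == 0).
  by have [_ c2 _ _ _] := cs; rewrite hH0 c2 add0r mul0r.
have hG : good (restriction A H0) es.
  by apply: h; [apply: (coordsys_restriction cs si _ i0 hH0)|apply: realizes_restriction].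
have [|k [k1 kz]] := coord_point cs (c := fun u => (c u)%:~R) 0; first by rewrite c0.
have [[hx hz] c2 _ _ _] := cs.
have xk : x i k = 1 by rewrite k1 // ci.
have lg : linear (fun v => v - x i v *: k).
  by move=> a u v; rewrite hx scalerDl -scalerA scalerBr opprD addrACA.
have [g gE] := linear_lfun lg.
have gH v : g v \in H0 by rewrite gE H0E linB // linZ // xk mulr1 subrr.
pose p : 'Hom(V, subvs_of H0) := (linfun (vsproj H0) \o g)%VF.
have pE v : vsval (p v) = v - x i v *: k by rewrite comp_lfunE lfunE /= vsprojK // gE.
have kA X : X \in A -> k \in X.
  move=> /hA[->|[u [v [t [vu vv uv Euv ->]]]]]; first by rewrite kz.
  by rewrite kz mulr0 addr0 !k1 // (cE u v t).
have hAr := realizes_arrangement cs hA.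
have eA : pull p (restriction A H0) = A.
  rewrite restrictionE pull_comp; set q := (_ \o p)%VF.
  have qE v : q v = v - x i v *: k by rewrite comp_lfunE lfunE /= pE.
  have qX X v : X \in A -> (q v \in X) = (v \in X).
    move=> XA; rewrite qE; apply/idP/idP => vX; last by rewrite memvB // memvZ // kA.
    by rewrite -[v](subrK (x i v *: k)) memvD // memvZ // kA.
  apply/fsetP => X; apply/idP/idP => [/mem_pull[Y [YA _ ->]]|XA].
    suff -> : (q @^-1: Y)%VS = Y by [].
    by apply/vspaceP => v; rewrite -memv_preim qX.
  apply/mem_pull; exists X; split=> //.
    have [al [e [hal ale hX]]] := hyperplane_form (hAr _ XA).
    by apply/negP => /limg_subP /(_ e); rewrite qX // hX ale oner_eq0.
  by apply/vspaceP => v; rewrite -memv_preim qX.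
have kp : lker p = <[k]>%VS.
  apply/vspaceP => v; rewrite memv_ker; apply/eqP/vlineP => [pv|[a ->]].
    exists (x i v); apply/eqP; rewrite -subr_eq0 -pE pv linear0 //.
  by apply: subvs_inj; rewrite pE linZ // xk mulr1 subrr linear0.
have dk : \dim (lker p) = 1%N.
  by rewrite kp dim_vline; case: eqP => // e; move: xk; rewrite e lin0 // => /eqP; rewrite eq_sym oner_eq0.
have fp : limg p = fullv.
  apply/vspaceP => w; rewrite memvf; apply/memv_imgP; exists (vsval w); rewrite ?memvf //.
  by apply: subvs_inj; rewrite pE; have := subvsP w; rewrite H0E => /eqP ->; rewrite scale0r subr0.
have := good_pull fp _ hG; rewrite dk eA => /(_ isT); exact.
Qed.

Lemma coordsys_line s V (x : nat -> V -> K) z : (forall i, s i = false) -> coordsys s x z ->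
  \dim {:V} = 1%N.
Proof.
move=> s0 [[_ hz] _ _ inj surj]; have [v [_ zv]] := surj (fun=> 0) 1.
have -> : fullv = <[v]>%VS.
  apply/vspaceP => w; rewrite memvf; apply/esym/vlineP; exists (z w).
  apply/eqP; rewrite -subr_eq0; apply/eqP/inj => [i|]; first by rewrite s0.
  by rewrite linB // linZ // zv mulr1 subrr.
by rewrite dim_vline; case: eqP => // e; move: zv; rewrite e lin0 // => /eqP; rewrite eq_sym oner_eq0.
Qed.

(** Only z = 0 remains, the zero subspace of a line. Adding it to the empty arrangement raises the
    exponent 0 to 1. *)
Lemma gain_free_empty s E : (forall i, s i = false) -> gain_free s E [:: 1%N].
Proof.
move=> s0 V x z A cs hA; have d1 := coordsys_line s0 cs.
have hAr := realizes_arrangement cs hA.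
have [[_ hz] _ _ inj _] := cs.
have AE : A = 0%VS |` fset0.
  have z0 : infinity_hyp z (0%VS : {vspace V}).
    move=> v; rewrite memv0; apply/eqP/eqP => [->|zv]; first exact: lin0.
    by apply: inj => // i; rewrite s0.
  apply/fsetP => X; rewrite !inE orbF; apply/idP/eqP => [/hA[hX|]|->].
  - exact: infinity_hyp_uniq hX z0.
  - by case=> i [j [t []]]; rewrite /vert !s0 !orbF => /eqP -> /eqP ->.
  - by apply/hA; left.
have d0 : \dim {:subvs_of (0%VS : {vspace V})} = 0%N.
  by transitivity (\dim (0%VS : {vspace V})); [rewrite dimvf|exact: dimv0].
rewrite AE; apply: good_add; rewrite -?AE ?inE //.
  pose p : 'Hom(V, subvs_of (0%VS : {vspace V})) := 0.
  have k1 : lker p = fullv by apply/vspaceP => v; rewrite memv_ker zero_lfunE eqxx memvf.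
  have -> : fset0 = pull p fset0.
    by apply/esym/fsetP => X; rewrite in_fset0; apply/negP => /mem_pull[Y []]; rewrite in_fset0.
  have := good_pull (p := p) _ _ (good_empty d0); rewrite k1 d1 /=; apply=> //.
  apply/vspaceP => w; rewrite memvf; apply/memv_imgP; exists 0; rewrite ?mem0v // linear0.
  by apply/eqP; rewrite -memv0; have <- : fullv = 0%VS :> {vspace subvs_of (0%VS : {vspace V})};
    [apply/eqP; rewrite -dimv_eq0 d0|rewrite memvf].
rewrite AE; suff -> : restriction (0%VS |` fset0 : {fset {vspace V}}) 0%VS = fset0 by apply: good_empty.
apply/fsetP => X; rewrite in_fset0; apply/negP => /mem_restriction[Y []].
by rewrite !inE orbF => /eqP ->; rewrite subvv.
Qed.

Lemma gain_flag_empty s E : (forall i, s i = false) -> gain_flag s E [:: 1%N].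
Proof.
move=> s0 V x z A cs hA; apply: flagged_line; first exact: coordsys_line s0 cs.
exact: gain_free_empty s0 _ _ _ _ cs hA.
Qed.

Lemma gain_flag_step s E i j t0 es e : s i -> vert s j -> i != j -> symgain E -> E i j t0 ->
  gain_free s E (rcons es e) -> gain_flag (remv s i) (contract E i j t0) es ->
  gain_flag s E (rcons es e).
Proof.
move=> si vj ij symE Eij h1 h2 V x z A cs hA.
have [H0 hH0] := edge_exists cs i j t0.
apply: (flagged_step (H := H0)).
- by apply/hA; right; exists i, j, t0; split=> //; rewrite /vert si orbT.
- exact: h1 cs hA.
- by apply: h2; [apply: (coordsys_restriction cs si vj ij hH0)|apply: realizes_restriction].
Qed.

(** A pair (u, t) in [L] stands for x_y = x_u + t z; former edges of [E] at [y] are discarded. *)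
Definition attach E y (L : seq (nat * int)) : nat -> nat -> int -> bool := fun u v t =>
  [|| [&& u != y, v != y & E u v t], (u == y) && ((v, t) \in L) | (v == y) && ((u, - t) \in L)].

Lemma attach_sym E y L : symgain E -> symgain (attach E y L).
Proof.
move=> symE u v t; rewrite /attach symE opprK; congr orb; first by rewrite andbCA.
by rewrite orbC.
Qed.

(* The modular coatom criterion: the hyperplanes through the new vertex are
   added one by one, and all the restrictions are isomorphic to the old
   arrangement. *)
Lemma gain_modular s E y L es : s y = false -> y != 0%N -> s 0%N = false -> symgain E -> uniq L ->
  (forall u t, (u, t) \in L -> vert s u) ->
  (forall u t v t', (u, t) \in L -> (v, t') \in L -> u != v -> E u v (t' - t)) ->
  gain_free s E es ->
  gain_free (fun k => s k || (k == y)) (attach E y L) (size L :: es).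
Proof.
move=> sy y0 s0 symE uL vL hL hE.
have s'y : remv (fun k => s k || (k == y)) y =1 s.
  by move=> k; rewrite /remv; case: eqP => [->|_]; rewrite ?sy ?andbF // orbF andbT.
have vy u : vert s u -> u != y.
  by rewrite /vert => /orP[/eqP->|su]; [rewrite eq_sym|apply: contraTneq su => ->; rewrite sy].
elim: L uL vL hL => [|[u t] L IH] /=.
  move=> _ _ _; apply: (gain_line (i := y) (c := fun k => (k == y)%:R)).
  - by rewrite eqxx orbT.
  - exact: attach_sym.
  - by rewrite eq_sym (negPf y0).
  - by rewrite eqxx.
  - by move=> a b r _ _ _; rewrite /attach !in_nil !andbF !orbF => /and3P[/negPf-> /negPf->].
  - apply: gain_prop_ext hE => [k|a b r va vb ab]; first by rewrite s'y.
    by rewrite /contract /attach !in_nil !eqxx /= !andbF !orbF !vy.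
move=> /andP[utL uL] vL hL.
have vu : vert s u by apply: (vL u t); rewrite mem_head.
have {}IH := IH uL (fun a r h => vL a r (mem_behead (s := (u, t) :: L) h))
  (fun a r b r' h h' => hL a r b r' (mem_behead (s := (u, t) :: L) h) (mem_behead (s := (u, t) :: L) h')).
have uy := vy _ vu.
apply: (gain_add (i := y) (j := u) (t0 := t) _ _ _ _ _ _ _ IH).
- by rewrite eqxx orbT.
- by move: vu; rewrite /vert => /orP[->|->] //=; rewrite orbT.
- by rewrite eq_sym.
- exact: attach_sym.
- exact: attach_sym.
- by rewrite /attach eqxx /= (negPf utL) (negPf uy).
- move=> a b r _ _ _; rewrite /attach !inE !xpair_eqE.
  have -> : (- r == t) = (r == - t) by rewrite eqr_oppLR.
  by case: (a == y); case: (b == y); case: (a == u); case: (b == u); case: (r == t); case: (r == - t);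
    case: (E a b r); case: ((b, r) \in L); case: ((a, - r) \in L).
- apply: gain_prop_ext hE => [k|a b r va vb ab]; first by rewrite s'y.
  rewrite /contract /attach !eqxx !(vy _ va) !(vy _ vb) !(negPf (vy _ va)) !(negPf (vy _ vb)) /= !orbF.
  (* Contracting [y] into [u] turns each remaining edge at [y] into one that [hL] already places in
     [E]. *)
  case Eab: (E a b r) => //=; apply/esym/negP => /orP[] /andP[/eqP e h].
    subst b; have := hL u t a (- (r - t)) (mem_head _ _) h; rewrite eq_sym ab => /(_ isT).
    by rewrite symE (_ : - _ = r) ?Eab //; lia.
  subst a; have := hL u t b (r + t) (mem_head _ _) h; rewrite ab => /(_ isT).
  by rewrite (_ : _ - _ = r) ?Eab //; lia.
Qed.

End GainFree.

(** [D] describes edges between positive vertices and [M] the values of each coordinate; the branch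
    i = 0 is the mirror image demanded by [symgain]. *)
Definition gain_of (D : nat -> nat -> int -> bool) (M : nat -> int -> bool) : nat -> nat -> int -> bool :=
  fun i j t => if i == 0%N then (j != 0%N) && M j (- t) else if j == 0%N then M i t else D i j t.

Lemma gain_of_sym D M : (forall i j t, D i j t = D j i (- t)) -> symgain (gain_of D M).
Proof.
by move=> h i j t; rewrite /gain_of opprK; case: eqVneq => //= _; case: eqVneq.
Qed.

Lemma iota_last m n : iota m n.+1 = iota m n ++ [:: (m + n)%N].
Proof. by rewrite -addn1 iotaD. Qed.

(** * Catalan arrangements *)

Section Catalan.
Variable K : numFieldType.
Local Notation gain_free := (gain_free K).

(** Every coordinate ranges over [-a, e], those in [S] up to e + 1. Growing [S] from the empty list
    to all vertices passes from e to e + 1 one hyperplane at a time. *)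
Definition catalan (a e : int) (S : seq nat) : nat -> nat -> int -> bool :=
  gain_of (fun _ _ t => (-1 <= t <= 1)) (fun i t => - a <= t <= e + (i \in S)%:Z).

Lemma catalan_sym a e S : symgain (catalan a e S).
Proof. by apply: gain_of_sym => _ _ t; apply/idP/idP; lia. Qed.

Lemma remv_mem (L : seq nat) i : uniq L -> remv (fun k => k \in L) i =1 (fun k => k \in rem i L).
Proof. by move=> uL k; rewrite /remv mem_rem_uniq // !inE andbC. Qed.

(** Fixing x_i = e + 1 gives every other coordinate the values e, e + 1 and e + 2. The extra value e
    + 1 of the vertices in [S] is absorbed, so all restrictions along the chain have the same
    exponents [es], and each addition raises [b] by one. *)
Lemma catalan_chain (L S : seq nat) a e a' e' b es : uniq L -> 0%N \notin L ->
  0 <= a + e + 1 -> (forall t : int, (- a' <= t <= e') = (- a <= t <= e) || (e <= t <= e + 2)) ->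
  gain_free (fun k => k \in L) (catalan a e [::]) (b :: es) ->
  (forall i, i \in L -> gain_free (fun k => k \in rem i L) (catalan a' e' [::]) es) ->
  uniq S -> {subset S <= L} -> gain_free (fun k => k \in L) (catalan a e S) ((b + size S)%N :: es).
Proof.
move=> uL L0 ae0 ae' hb hR; elim: S => [|i S IH]; first by rewrite addn0.
move=> /andP[iS uS] sub; have iL : i \in L by apply: sub; rewrite mem_head.
have i0 : i != 0%N by apply: contraNneq L0 => <-.
have {}IH := IH uS (fun k kS => sub k (mem_behead (s := i :: S) kS)).
rewrite /= addnS; apply: (gain_add (i := i) (j := 0%N) (t0 := e + 1) _ _ _ _ _ _ _ IH) => //.
- exact: catalan_sym.
- exact: catalan_sym.
- by rewrite /catalan /gain_of (negPf i0) /= (negPf iS); lia.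
- move=> u v t vu vv uv; rewrite /catalan /gain_of !inE.
  have [u0|u0] := eqVneq u 0%N; have [v0|v0] := eqVneq v 0%N; subst => //=.
  + by rewrite !(eq_sym 0%N) (negPf i0) /=; have [->|_] := eqVneq v i; rewrite ?(negPf iS) /=; lia.
  + by have [->|_] := eqVneq u i; rewrite ?(negPf iS) /=; lia.
  + by rewrite !andbF !orbF.
- apply: gain_prop_ext (hR i iL) => [k|u v t]; first by rewrite remv_mem.
  have nz k : vert (fun k => k \in rem i L) k -> k != i.
    rewrite /vert mem_rem_uniq // !inE => /orP[/eqP->|/andP[] //]; by rewrite eq_sym.
  move=> /nz ui /nz vi uv; rewrite /contract /catalan /gain_of !inE.
  have := ae' t; have := ae' (- t).
  have [u0|u0] := eqVneq u 0%N; have [v0|v0] := eqVneq v 0%N; subst => //=.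
  + rewrite (negPf i0) (negPf vi) /=; case: (v \in S) => /=; lia.
  + rewrite (negPf i0) (negPf ui) /=; case: (u \in S) => /=; lia.
  + by rewrite /= !orbF.
Qed.

Lemma catalan_free n (L : seq nat) : size L = n -> uniq L -> 0%N \notin L ->
  forall (N : nat) a e, (0 < N)%N -> a + e + 1 = N%:Z ->
  gain_free (fun k => k \in L) (catalan a e [::]) (1%N :: iota (N + n - 1) n).
Proof.
elim: n L => [|n IHn] L.
  by move=> /size0nil -> _ _ N a e _ _; apply: gain_free_empty.
move=> sL uL L0; have remP i : i \in L -> [/\ size (rem i L) = n, uniq (rem i L) & 0%N \notin rem i L].
  move=> iL; rewrite size_rem // sL rem_uniq //; split=> //.
  by apply: contra L0; apply: mem_rem.
have IHr i N a e : i \in L -> (0 < N)%N -> a + e + 1 = N%:Z ->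
    gain_free (fun k => k \in rem i L) (catalan a e [::]) (1%N :: iota (N + n - 1) n).
  by move=> /remP[h1 h2 h3]; apply: IHn.
elim=> [//|N IHN] a e _ ae.
(* The range up to e is the range up to e - 1 with the next value added at every vertex, that is,
   with [S] equal to [L]. *)
have ext : forall i j t, vert (fun k => k \in L) i -> vert (fun k => k \in L) j -> i != j ->
    catalan a (e - 1) L i j t = catalan a e [::] i j t.
  move=> i j t vi vj ij; rewrite /catalan /gain_of !inE.
  have [i0|i0] := eqVneq i 0%N; have [j0|j0] := eqVneq j 0%N; subst => //=.
    by move: vj; rewrite /vert (negPf j0) /= => ->; lia.
  by move: vi; rewrite /vert (negPf i0) /= => ->; lia.
apply: (gain_prop_ext (fun _ => erefl) ext).
have [N0|N0] := posnP N; last first.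
  (* With N values the exponents are 1, N+n, ..., N+2n. The n+1 additions raise N+n to N+2n+1; the
     others are the exponents for N+2 values on n vertices. *)
  have h := IHN a (e - 1) N0 ltac:(lia).
  apply: (gain_free_perm _ (catalan_chain (a' := a) (e' := e + 1) (b := (N + n)%N)
     (es := 1%N :: iota (N + n).+1 n) uL L0 _ _ _ _ uL (fun _ => id))).
  - rewrite sL (_ : N.+1 + n.+1 - 1 = (N + n).+1)%N; last by lia.
    rewrite iota_last (_ : (N + n).+1 + n = N + n + n.+1)%N; last by lia.
    by apply/permP => q; rewrite /= count_cat /=; lia.
  - lia.
  - by move=> t; apply/idP/idP; lia.
  - apply: (gain_free_perm _ h); rewrite (_ : N + n.+1 - 1 = N + n)%N; last by lia.
    by apply/permP => q /=; lia.
  - move=> i iL; have := IHr i N.+2 a (e + 1) iL isT ltac:(lia).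
    by rewrite (_ : N.+2 + n - 1 = (N + n).+1)%N; last by lia.
have [i0 i0L] : exists i0, i0 \in L.
  by case: (L) sL => [//|i0 L'] _; exists i0; rewrite mem_head.
have i00 : i0 != 0%N by apply: contraNneq L0 => <-.
(* Starting from an empty range, the exponent to raise is 0, and a contraction creates exactly the
   values e - 1, e, e + 1; hence [a']. *)
apply: (gain_free_perm _ (catalan_chain (a' := 1 - e) (e' := e + 1) (b := 0%N)
     (es := 1%N :: iota n.+2 n) uL L0 _ _ _ _ uL (fun _ => id))).
- rewrite sL N0 add0n (_ : 1 + n.+1 - 1 = n.+1)%N; last by lia.
  by apply/permP => q /=; lia.
- lia.
- by move=> t; apply/idP/idP; lia.
- (* Without the hyperplanes x_i = s, setting x_i0 = 0 only removes the diagonal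
     line and leaves the same family on one vertex less, with the range [-1, 1]. *)
  apply: (gain_line (i := i0) (c := fun k => (k != 0%N)%:R)) => //.
  + exact: catalan_sym.
  + by rewrite i00.
  + move=> u v t vu vv uv; rewrite /catalan /gain_of !inE.
    by have [u0|u0] := eqVneq u 0%N; have [v0|v0] := eqVneq v 0%N; subst => //=; lia.
  + have := IHr i0 3%N 1 1 i0L isT erefl; rewrite (_ : 3 + n - 1 = n.+2)%N; last by lia.
    apply: gain_prop_ext => [k|u v t]; first by rewrite remv_mem.
    have nz k : vert (fun k => k \in rem i0 L) k -> k != i0.
      rewrite /vert mem_rem_uniq // !inE => /orP[/eqP->|/andP[] //]; by rewrite eq_sym.
    move=> /nz ui /nz vi uv; rewrite /contract /catalan /gain_of !inE.
    have [u0|u0] := eqVneq u 0%N; have [v0|v0] := eqVneq v 0%N; subst => //=.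
    * by rewrite (negPf i00) /=; lia.
    * by rewrite (negPf i00) /=; lia.
    * by rewrite /= !orbF.
- move=> i iL; have := IHr i 3%N (1 - e) (e + 1) iL isT ltac:(lia).
  by rewrite (_ : 3 + n - 1 = n.+2)%N; last by lia.
Qed.

(** Stopping the chain at [S] raises the exponent N + n only [size S] times. In the application [S]
    consists of the indices above p. *)
Lemma catalan_free_upper n (L S : seq nat) (N : nat) a e :
  size L = n.+1 -> uniq L -> 0%N \notin L -> (0 < N)%N -> a + e + 1 = N%:Z ->
  uniq S -> {subset S <= L} ->
  gain_free (fun k => k \in L) (catalan a e S) ((N + n + size S)%N :: 1%N :: iota (N + n).+1 n).
Proof.
move=> sL uL L0 N0 ae uS sub.
apply: (catalan_chain (a' := a) (e' := e + 2) uL L0 _ _ _ _ uS sub).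
- lia.
- by move=> t; apply/idP/idP; lia.
- apply: (gain_free_perm _ (catalan_free sL uL L0 N0 ae)).
  rewrite (_ : N + n.+1 - 1 = N + n)%N; last by lia.
  by apply/permP => q /=; lia.
- move=> i iL.
  have := @catalan_free n (rem i L) _ _ _ N.+2 a (e + 2) isT ltac:(lia).
  rewrite (_ : N.+2 + n - 1 = (N + n).+1)%N; last by lia.
  apply; first by rewrite size_rem // sL.
    exact: rem_uniq.
  by apply: contra L0; apply: mem_rem.
Qed.

End Catalan.

(** If j indices exceed p, they carry the lowest steps Q, ..., Q+j-1. Moving each of these up by one
    gives Q+1, ..., Q+j, the same multiset as replacing Q by Q+j. *)
Lemma perm_staircase Q n tau p r : r = (tau + n.+1)%N ->
  perm_eq ((Q + size [seq i <- iota tau.+1 n.+1 | (p < i)%N])%N :: iota Q.+1 n)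
          [seq (Q + (r - i) + (p < i))%N | i <- iota tau.+1 n.+1].
Proof.
elim: n tau => [|n IH] tau rE.
  by rewrite /= (_ : r - tau.+1 = 0)%N ?addn0; [case: (p < tau.+1)%N|lia].
have iE : iota tau.+1 n.+2 = tau.+1 :: iota tau.+2 n.+1 by [].
have := IH tau.+1 ltac:(lia).
set S := size _; set T := [seq _ | i <- _] => hT.
have -> : [seq (Q + (r - i) + (p < i))%N | i <- iota tau.+1 n.+2] = (Q + n.+1 + (p < tau.+1))%N :: T.
  by rewrite /T iE map_cons (_ : r - tau.+1 = n.+1)%N //; lia.
have -> : size [seq i <- iota tau.+1 n.+2 | (p < i)%N] = ((p < tau.+1) + S)%N.
  by rewrite /S iE [filter _ (_ :: _)]/=; case: (p < tau.+1)%N.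
have eS : (p < tau.+1)%N -> S = n.+1.
  move=> h; rewrite /S (@eq_in_filter _ _ predT) ?filter_predT ?size_iota // => i.
  by rewrite mem_iota /=; lia.
apply/permP => q; have /permP/(_ q) := hT; rewrite iota_last /= count_cat /= => <-.
rewrite addSnnS; case: ltnP eS => [_ /(_ isT) ->|_ _].
  by rewrite [(true + _)%N]addnC [(Q + (_ + _))%N]addnA; lia.
by rewrite [(false + _)%N]add0n [(Q + n.+1 + false)%N]addn0; lia.
Qed.

Definition zrange (a : int) n : seq int := [seq a + j%:Z | j <- iota 0 n].

Lemma mem_zrange a n t : (t \in zrange a n) = (a <= t < a + n%:Z).
Proof.
apply/mapP/idP => [[j]|at_]; first by rewrite mem_iota => jn ->; lia.
by exists `|t - a|%N; [rewrite mem_iota|]; lia.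
Qed.

Lemma zrange_uniq a n : uniq (zrange a n).
Proof. by rewrite map_inj_uniq ?iota_uniq // => i j; lia. Qed.

Lemma size_zrange a n : size (zrange a n) = n.
Proof. by rewrite size_map size_iota. Qed.

(** * The interpolating family *)

Section Family.
Variable K : numFieldType.
Local Notation gain_free := (gain_free K).
Local Notation gain_flag := (gain_flag K).

(** Modular extension with a prescribed target [E']: [E] need only agree with it on the old
    vertices, and the edges at [y] are split into [U], towards [s], and [T], towards the vertex
    0. *)
Lemma gain_modular_seq s E E' y (U : seq (nat * int)) (T : seq int) n es :
  s y = false -> y != 0%N -> s 0%N = false -> symgain E -> symgain E' -> uniq U -> uniq T ->
  (forall u t, ((u, t) \in U) = s u && E' y u t) ->
  (forall t, (t \in T) = E' y 0%N t) ->
  (size U + size T = n)%N ->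
  (forall u v t, vert s u -> vert s v -> u != v -> E u v t = E' u v t) ->
  (forall u t v t', vert s u -> vert s v -> u != v -> E' y u t -> E' y v t' -> E u v (t' - t)) ->
  gain_free s E es -> gain_free (fun k => s k || (k == y)) E' (n :: es).
Proof.
move=> sy y0 s0 symE symE' uU uT hU hT sz EE' hmod hE.
pose L := U ++ [seq (0%N, t) | t <- T].
have memL u t : ((u, t) \in L) = vert s u && E' y u t.
  rewrite mem_cat hU /vert; have [->|u0] := eqVneq u 0%N.
    by rewrite s0 /= mem_map ?hT // => a b [].
  rewrite (_ : _ \in _ = false) ?orbF //.
  by apply/mapP => [[a _ [e _]]]; rewrite e in u0.
have uL : uniq L.
  rewrite cat_uniq uU map_inj_uniq ?uT; last by move=> a b [].
  by rewrite andbT; apply/hasPn => _ /mapP[t _ ->]; rewrite /= hU s0.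
have := gain_modular sy y0 s0 symE uL _ _ hE.
rewrite /L size_cat size_map sz -/L => H.
have {}H := H (fun u t hu => proj1 (andP (etrans (esym (memL u t)) hu))).
have vyn u : vert (fun k => s k || (k == y)) u -> u != y -> vert s u.
  by rewrite /vert => + /negPf uy; rewrite uy orbF.
have vy u : vert s u -> u != y.
  by rewrite /vert => /orP[/eqP->|su]; [rewrite eq_sym|apply: contraTneq su => ->; rewrite sy].
apply: gain_prop_ext (H _) => [//|u v t vu vv uv|u t v t'].
  rewrite /attach !memL; have [uy|uy] := eqVneq u y; have [vy'|vy'] := eqVneq v y; subst => //=.
  - by rewrite eqxx in uv.
  - by rewrite orbF (vyn _ vv).
  - by rewrite (vyn _ vu) //= -symE'.
  - by rewrite !orbF EE' ?vyn.
by rewrite !memL => /andP[vu eu] /andP[vv ev] uv; apply: hmod.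
Qed.

Variables (l r p m c : nat) (h : bool).
Hypotheses (c0 : (0 < c)%N) (r0 : (0 < r)%N) (hrl : (r + h <= l)%N).

(* The arrangement R is the case h = false, r = l - k + 1, and Rhat is the case
   h = true, r = l - k; when h holds, w = r.+1 is the vertex with the hyperplanes
   x_w - x_i = 1 (otherwise w = 0 is a dummy value, as fam_diff is only used on
   positive indices). *)
Let w : nat := if h then r.+1 else 0%N.

Definition fam_diff (i j : nat) (t : int) : bool :=
  [|| t == 0, [&& (i <= r)%N, (j <= r)%N & (t == 1) || (t == -1)],
      [&& i == w, (j <= r)%N & t == 1] | [&& j == w, (i <= r)%N & t == -1]].

(* The first tau coordinates have been eliminated, each at the lower end of its range. *)
Definition fam_coord (tau i : nat) (t : int) : bool :=
  if (i <= r)%N then - (c + l + tau)%:Z + r%:Z <= t <= (m + (p < i) + l)%:Z - (r + h)%:Z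
  else (- (c + (l - i))%:Z <= t <= (m + (p < i) + (l - i))%:Z) ||
       (r%:Z - (c + l + minn tau r)%:Z + 1 <= t <= r%:Z - (c + l)%:Z + (tau - r)%:Z).

Definition fam tau := gain_of fam_diff (fam_coord tau).

(** Independent of [tau], because an elimination trades an edge for a coordinate value, and
    nonincreasing in i, so that eliminating the lowest index drops the largest exponent. *)
Definition fam_exp i : nat := (m + c + l + (l - i) + (p < i))%N.

Lemma fam_sym tau : symgain (fam tau).
Proof.
clear c0 r0 hrl; apply: gain_of_sym => i j t.
by rewrite /fam_diff; apply/idP/idP; lia.
Qed.

Local Notation seg tau n := (fun i => (tau < i <= n)%N).

Lemma seg_extend tau n : (tau <= n)%N -> (fun k => seg tau n k || (k == n.+1)) =1 seg tau n.+1.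
Proof. by move=> h' k; apply/idP/idP; lia. Qed.

(** The new vertex has only edges of gain 0 to the earlier positive ones, and its range lies in each
    of theirs: this is modularity. The last hypothesis keeps out the vertex [w] as long as its edges
    of gain 1 exist. *)
Lemma fam_step tau n : (tau <= n)%N -> (r <= n)%N -> (n < l)%N -> (r + h <= n)%N || (r <= tau)%N ->
  gain_free (seg tau n) (fam tau) (1%N :: map fam_exp (iota tau.+1 (n - tau))) ->
  gain_free (seg tau n.+1) (fam tau) (1%N :: map fam_exp (iota tau.+1 (n.+1 - tau))).
Proof.
move=> tn rn nl hn hE.
apply: (gain_free_perm (es := fam_exp n.+1 :: 1%N :: map fam_exp (iota tau.+1 (n - tau)))).
  rewrite subSn // iota_last map_cat (_ : tau.+1 + (n - tau) = n.+1)%N; last by lia.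
  by apply/permP => q; rewrite /= count_cat /=; lia.
apply: gain_prop_ext (seg_extend tn) (fun _ _ _ _ _ _ => erefl) _.
(* [T] is the disjoint union of the [tau] inherited values and the original range. Together with the
   n - tau edges they number [fam_exp n.+1]. *)
apply: (gain_modular_seq (E := fam tau) (U := [seq (u, 0 : int) | u <- iota tau.+1 (n - tau)])
  (T := zrange (r%:Z - (c + l + minn tau r)%:Z + 1) tau ++
        zrange (- (c + (l - n.+1))%:Z) (c + (l - n.+1) + (m + (p < n.+1) + (l - n.+1)) + 1)%N)) => //.
- lia.
- exact: fam_sym.
- exact: fam_sym.
- by rewrite map_inj_uniq ?iota_uniq // => a b [].
- rewrite cat_uniq !zrange_uniq andbT /=; apply/hasPn => t; rewrite !mem_zrange; lia.
- move=> u t; apply/mapP/idP => [[k]|].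
    rewrite mem_iota /fam /gain_of /fam_diff => hk [-> ->] /=.
    by case: eqVneq => k0 /=; lia.
  move=> /andP[hu]; rewrite /fam /gain_of /fam_diff /= (_ : (u == 0)%N = false); last by lia.
  by move=> ht; exists u; [rewrite mem_iota; lia|congr pair; move: ht; rewrite /w; case: (h) hn => /=; lia].
- move=> t; rewrite mem_cat !mem_zrange /fam /gain_of /= /fam_coord ifF; last by lia.
  by apply/idP/idP; lia.
- by rewrite size_cat !size_zrange size_map size_iota /fam_exp; lia.
move=> u t v t' vu vv uv; rewrite /fam /gain_of /=.
have [u0|u0] := eqVneq u 0%N; have [v0|v0] := eqVneq v 0%N; subst => //=.
- move: vv; rewrite /vert /fam_diff /fam_coord /w => vv.
  by case: (h) hrl hn => /= hrl' hn'; case: ifP; case: ifP => /=; lia.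
- move: vu; rewrite /vert /fam_diff /fam_coord /w => vu.
  by case: (h) hrl hn => /= hrl' hn'; case: ifP; case: ifP => /=; lia.
- move: vu vv; rewrite /vert /fam_diff /w => vu vv.
  by case: (h) hrl hn => /= hrl' hn'; lia.
Qed.

Lemma fam_catalan tau (e : int) : (tau < r)%N -> e = (m + l)%:Z - (r + h)%:Z ->
  forall i j t, vert (seg tau r) i -> vert (seg tau r) j -> i != j ->
  catalan ((c + l + tau)%:Z - r%:Z) e [seq i <- iota tau.+1 (r - tau) | (p < i)%N] i j t = fam tau i j t.
Proof.
move=> tr -> i j t; rewrite /vert /catalan /fam /gain_of /fam_diff /fam_coord /w => vi vj ij.
have [i0|i0] := eqVneq i 0%N; have [j0|j0] := eqVneq j 0%N; subst => //=.
- by rewrite ifT ?mem_filter ?mem_iota; lia.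
- by rewrite ifT ?mem_filter ?mem_iota; lia.
- by case: (h) => /=; lia.
Qed.

(** Up to r this is a Catalan arrangement extended at the indices above p; N counts the common
    values and Q = N + n is the exponent that gets raised. With [h], the vertex r + 1 must be joined
    as well. *)
Lemma fam_block tau : (tau < r)%N ->
  gain_free (seg tau (r + h)) (fam tau) (1%N :: map fam_exp (iota tau.+1 (r + h - tau))).
Proof.
move=> tr; pose n := (r - tau.+1)%N; have nE : (r - tau = n.+1)%N by rewrite /n; lia.
pose e : int := (m + l)%:Z - (r + h)%:Z.
pose a : int := (c + l + tau)%:Z - r%:Z.
pose S := [seq i <- iota tau.+1 (r - tau) | (p < i)%N].
pose N := (c + l - r + tau + (m + l - (r + h)) + 1)%N.
pose Q := (N + n)%N.
have L0 : 0%N \notin iota tau.+1 n.+1 by rewrite mem_iota.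
have segL : (fun k => k \in iota tau.+1 n.+1) =1 seg tau r.
  by move=> k; rewrite mem_iota; apply/idP/idP; lia.
have aeN : a + e + 1 = N%:Z by rewrite /a /e /N; lia.
have N0 : (0 < N)%N by rewrite /N; lia.
have hcat : gain_free (seg tau r) (fam tau) ((Q + size S)%N :: 1%N :: iota Q.+1 n).
  apply: (gain_prop_ext segL (E := catalan a e S)).
    have vs k : vert (fun k => k \in iota tau.+1 n.+1) k -> vert (seg tau r) k by rewrite /vert /= -segL.
    by move=> i j t /vs vi /vs vj ij; apply: fam_catalan.
  apply: catalan_free_upper aeN _ _; rewrite ?size_iota ?iota_uniq //.
    exact/filter_uniq/iota_uniq.
  by rewrite /S nE; apply: mem_subseq; apply: filter_subseq.
have QE : Q = (m + c + l + (l - (r + h)))%N by rewrite /Q /N /n; lia.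
have hh : h \/ ~~ h by case: (h); [left|right].
case: hh => hE; last first.
  have h0 : (h : nat) = 0%N by move: hE; case: (h).
  rewrite h0 addn0; apply: gain_free_perm hcat.
  have := @perm_staircase Q n tau p r ltac:(lia); rewrite -nE -/S => /permP hp.
  apply/permP => q; have := hp q => /= hq.
  have -> : map fam_exp (iota tau.+1 (r - tau)) = [seq (Q + (r - i) + (p < i))%N | i <- iota tau.+1 (r - tau)].
    by apply: (iffLR (eq_in_map _ _ _)) => i; rewrite mem_iota /fam_exp QE h0; lia.
  by rewrite -hq; lia.
have h1 : (h : nat) = 1%N by rewrite hE.
have wE : w = r.+1 by rewrite /w hE.
(* The range of x_{r+1} is cut at e. Its edges of gains 0 and 1 turn a value t into t and t - 1 for
   a block coordinate, and both lie in every block range exactly because t stays between the lower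
   end plus one and e. *)
pose fam' := gain_of fam_diff (fun i t => if i == r.+1 then r%:Z - (c + l + tau)%:Z + 1 <= t <= e else fam_coord tau i t).
have sym' : symgain fam' by apply: gain_of_sym => i j t; rewrite /fam_diff; apply/idP/idP; lia.
have hfam' : gain_free (seg tau r.+1) fam' ((Q + n).+1 :: (Q + size S)%N :: 1%N :: iota Q.+1 n).
  apply: gain_prop_ext (seg_extend (ltnW tr)) (fun _ _ _ _ _ _ => erefl) _.
  apply: (gain_modular_seq (E := fam tau) (U := [seq (u, 0 : int) | u <- iota tau.+1 n.+1] ++ [seq (u, 1 : int) | u <- iota tau.+1 n.+1])
    (T := zrange (r%:Z - (c + l + tau)%:Z + 1) (N - 1)) _ _ _ _ _ _ _ _ _ _ _ _ hcat) => //.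
  - lia.
  - exact: fam_sym.
  - rewrite cat_uniq !map_inj_uniq; [|by move=> ? ? []|by move=> ? ? []].
    rewrite iota_uniq andbT andTb; apply/hasPn => _ /mapP[k _ ->].
    by apply/negP => /mapP[k' _ []].
  - exact: zrange_uniq.
  - move=> u t; rewrite (_ : (_ \in _) = (tau < u <= r)%N && ((t == 0) || (t == 1))); last first.
      rewrite mem_cat; apply/orP/andP => [[] /mapP[k]|[hu /orP[] /eqP ->]].
      + by rewrite mem_iota => hk [-> ->]; split; lia.
      + by rewrite mem_iota => hk [-> ->]; split; lia.
      + by left; apply/mapP; exists u; rewrite // mem_iota; lia.
      + by right; apply/mapP; exists u; rewrite // mem_iota; lia.
    rewrite /fam' /gain_of /fam_diff /= wE eqxx.
    have [hu|//] := boolP (tau < u <= r)%N.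
    by rewrite (_ : (u == 0)%N = false) /=; lia.
  - by move=> t; rewrite mem_zrange /fam' /gain_of /= eqxx; apply/idP/idP; rewrite /e /N; lia.
  - by rewrite size_zrange size_cat !size_map size_iota /Q; lia.
  - move=> u v t; rewrite /vert /fam /fam' /gain_of => vu vv uv.
    by have [u0|u0] := eqVneq u 0%N; have [v0|v0] := eqVneq v 0%N; subst => //=; rewrite ifF //; lia.
  - move=> u t v t'; rewrite /vert /fam /fam' /gain_of /= eqxx /fam_diff /fam_coord wE => vu vv uv.
    have [u0|u0] := eqVneq u 0%N; have [v0|v0] := eqVneq v 0%N; subst => //=.
    + by rewrite ifT /e; lia.
    + by rewrite ifT /e; lia.
    + by lia.
pose S' := [seq i <- iota tau.+1 n.+2 | (p < i)%N].
have sS' : size S' = (size S + (p < r.+1))%N.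
  rewrite /S' iota_last filter_cat size_cat /S nE /= (_ : tau.+1 + n.+1 = r.+1)%N; last by lia.
  by case: (p < r.+1)%N.
suff hfin : gain_free (seg tau r.+1) (fam tau) ((Q + size S')%N :: (Q + n).+1 :: 1%N :: iota Q.+1 n).
  rewrite h1 addn1; apply: gain_free_perm hfin.
  have := @perm_staircase Q n.+1 tau p r.+1 ltac:(lia); rewrite -/S'.
  set T := [seq _ | i <- _] => /permP hp.
  have -> : (r.+1 - tau = n.+2)%N by lia.
  have -> : map fam_exp (iota tau.+1 n.+2) = T.
    by apply: (iffLR (eq_in_map _ _ _)) => i; rewrite mem_iota /fam_exp QE h1; lia.
  by apply/permP => q; have := hp q; rewrite iota_last /= count_cat /= addSn; lia.
have vfam u v t : (p < r.+1)%N = false -> vert (seg tau r.+1) u -> vert (seg tau r.+1) v -> u != v -> fam' u v t = fam tau u v t.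
  rewrite /vert /fam /fam' /gain_of /fam_coord => pr vu vv uv.
  have [u0|u0] := eqVneq u 0%N; have [v0|v0] := eqVneq v 0%N; subst => //=.
    by case: eqP => // ->; rewrite pr ifF /e; lia.
  by case: eqP => // ->; rewrite pr ifF /e; lia.
have [pr|pr] := boolP (p < r.+1)%N; last first.
  apply: (gain_prop_ext (fun _ => erefl) (fun u v t => vfam u v t (negPf pr))).
  apply: gain_free_perm hfam'; rewrite sS' (negPf pr) addn0.
  by apply/permP => q /=; lia.
rewrite sS' pr addn1 addnS.
(* The remaining value e + 1 of x_{r+1}. Contracting it gives e and e + 1 to every block coordinate,
   which levels the upper ends whatever p is: the restriction is a Catalan arrangement with N + 1
   values. *)
apply: (gain_add (E' := fam') (i := r.+1) (j := 0%N) (t0 := e + 1)) => //.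
- lia.
- exact: fam_sym.
- by rewrite /fam' /gain_of /= eqxx; lia.
- move=> u v t; rewrite /vert /fam /fam' /gain_of /fam_coord => vu vv uv.
  have [u0|u0] := eqVneq u 0%N; have [v0|v0] := eqVneq v 0%N; subst => //=.
  + case: eqP => [->|vr]; first by rewrite pr ifF /e; lia.
    by lia.
  + case: eqP => [->|ur]; first by rewrite pr ifF /e; lia.
    by lia.
  + by rewrite !andbF !orbF.
- by apply: gain_free_perm hfam'; apply/permP => q /=; lia.
have hc := @catalan_free K n.+1 (iota tau.+1 n.+1) _ _ L0 N.+1 a (e + 1) isT ltac:(lia).
have {}hc := hc (size_iota _ _) (iota_uniq _ _).
apply: (gain_free_perm (es := 1%N :: iota (N.+1 + n.+1 - 1) n.+1)).
  rewrite (_ : N.+1 + n.+1 - 1 = Q.+1)%N; last by rewrite /Q; lia.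
  by rewrite iota_last; apply/permP => q; rewrite /= count_cat /= addSn; lia.
apply: gain_prop_ext hc => [k|u v t]; first by rewrite mem_iota /remv; apply/idP/idP; lia.
rewrite /vert !mem_iota /contract /fam /catalan /gain_of /fam_diff /fam_coord wE => vu vv uv.
have [u0|u0] := eqVneq u 0%N; have [v0|v0] := eqVneq v 0%N; subst => //=.
- by rewrite ifT /a /e; lia.
- by rewrite ifT /a /e; lia.
- by rewrite !orbF; lia.
Qed.

Lemma fam_free tau : (tau <= l)%N ->
  gain_free (seg tau l) (fam tau) (1%N :: map fam_exp (iota tau.+1 (l - tau))).
Proof.
(* Vertices are joined by [fam_step] after the block, including [w], as long as a block vertex is
   left, and from the empty graph otherwise. *)
move=> tl; pose n0 := if (tau < r)%N then (r + h)%N else tau.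
have base : gain_free (seg tau n0) (fam tau) (1%N :: map fam_exp (iota tau.+1 (n0 - tau))).
  rewrite /n0; case: ltnP => tr; first exact: fam_block.
  by rewrite subnn; apply: gain_free_empty => k; apply/negP; lia.
have n0l : (n0 <= l)%N by rewrite /n0; case: ltnP => _; lia.
suff H n : (n0 + n <= l)%N -> gain_free (seg tau (n0 + n)) (fam tau)
    (1%N :: map fam_exp (iota tau.+1 (n0 + n - tau))).
  by have := H (l - n0)%N; rewrite subnKC //; apply.
elim: n => [|n IH] hn; first by rewrite addn0.
rewrite addnS; apply: fam_step; try (by rewrite /n0; case: ltnP; lia).
by apply: IH; lia.
Qed.

Lemma fam_flag tau : (tau <= l)%N ->
  gain_flag (seg tau l) (fam tau) (1%N :: rev (map fam_exp (iota tau.+1 (l - tau)))).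
Proof.
move: {2}(l - tau)%N (erefl (l - tau)%N) => n; elim: n tau => [|n IH] tau nE tl.
  by rewrite nE; apply: gain_flag_empty => k; apply/negP; lia.
have tl' : (tau < l)%N by lia.
have hf := fam_free tl.
rewrite nE /= rev_cons -rcons_cons.
have nE' : (l - tau.+1 = n)%N by lia.
(* After the block, [t0] is the lower end of the original range, not of the inherited values. The
   inherited values are common to all later coordinates, so fixing at one of them would create
   nothing new, whereas [t0] is new for each of them. *)
pose t0 : int := if (tau < r)%N then r%:Z - (c + l + tau)%:Z else - (c + (l - tau.+1))%:Z.
apply: (gain_flag_step (i := tau.+1) (j := 0%N) (t0 := t0)) => //.
- by lia.
- exact: fam_sym.
- rewrite /fam /gain_of /= /fam_coord /t0.
  by case: ifP => tr; rewrite ?tr; case: (h) hrl => /=; lia.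
- apply: gain_free_perm hf; rewrite nE rcons_cons perm_cons /= -rev_cons perm_sym.
  by rewrite perm_rev.
- have := IH tau.+1 nE' tl'; rewrite nE'.
  apply: gain_prop_ext => [k|u v t]; first by rewrite /remv; apply/idP/idP; lia.
  rewrite /vert /contract /fam /gain_of /fam_diff /fam_coord /t0 /w => vu vv uv.
  have [u0|u0] := eqVneq u 0%N; have [v0|v0] := eqVneq v 0%N; subst => //=.
  + by case: (h) hrl => /= hrl'; case: (leqP v r) => vr; case: (ltnP tau r) => tr /=; lia.
  + by case: (h) hrl => /= hrl'; case: (leqP u r) => ur; case: (ltnP tau r) => tr /=; lia.
  + by rewrite !orbF.
Qed.

End Family.

(** * Cones *)

Section Cones.
Variables (K : numFieldType) (l : nat).
Local Notation V := 'rV[K]_(l + 1).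
Local Notation seg := (fun i => (0 < i <= l)%N).

(** [x_ K l i] is the zero row for i = 0, which supplies the zero function required at the vertex
    0. *)
Definition cone_x (i : nat) (v : V) : K := (lsubmx v *m (x_ K l i)^T) 0 0.
Definition cone_z (v : V) : K := (rsubmx v : 'rV_1) 0 0.

Lemma cone_xE (j : 'I_l) v : cone_x j.+1 v = lsubmx v 0 j.
Proof.
rewrite /cone_x mxE (bigD1 j) //= !mxE eqxx mulr1 big1 ?addr0 // => i ij.
by rewrite !mxE eqSS -(inj_eq val_inj) /= in ij *; rewrite (negPf ij) mulr0.
Qed.

Lemma cone_coordsys : coordsys seg cone_x cone_z.
Proof.
split=> //.
- split=> [i|] a u v; rewrite /cone_x /cone_z linearP ?mulmxDl -?scalemxAl !mxE //.
- move=> v; rewrite /cone_x mxE big1 // => j _; rewrite !mxE mulr0 //.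
- move=> v h0 z0; rewrite -[v]hsubmxK; apply/eqP; rewrite row_mx_eq0; apply/andP; split; apply/eqP/rowP => j.
    by rewrite -cone_xE h0 ?ltn_ord // mxE.
  by rewrite ord1 [RHS]mxE; exact: z0.
- move=> c c0; exists (row_mx (\row_j c j.+1) c0%:M); split.
    case=> [//|i] /= hi; have := cone_xE (Ordinal hi) => /= ->.
    by rewrite row_mxKl mxE.
  by rewrite /cone_z row_mxKr mxE eqxx.
Qed.

Lemma mem_kernel_hyperplane (a : 'rV[K]_l) (s : K) v :
  (v \in kernel_hyperplane (row_mx a s%:M)) = ((lsubmx v *m a^T) 0 0 + s * cone_z v == 0).
Proof.
rewrite memv_ker lfunE /= -[v in LHS]hsubmxK tr_row_mx mul_row_col.
rewrite tr_scalar_mx mul_mx_scalar; set M := (X in X == 0).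
have -> : (lsubmx v *m a^T) 0 0 + s * cone_z v = M 0 0 by rewrite [RHS]mxE [X in _ = _ + X]mxE.
apply/eqP/eqP => [->|h]; first by rewrite mxE.
by apply/matrixP => i j; rewrite !ord1 h mxE.
Qed.

Local Notation hyp e := (kernel_hyperplane (row_mx e.1 (- e.2)%:M)).

Lemma hyp_diff_edge i j (t : int) : edge_hyp cone_x cone_z i j t (hyp (hyp_diff K l i j t)).
Proof.
move=> v; rewrite mem_kernel_hyperplane /= linearB /= mulmxBr !mxE -!/(cone_x _ _).
rewrite -[RHS]subr_eq0; congr (_ == _).
rewrite /cone_x !mxE; ring.
Qed.

Lemma hyp_coord_edge i (t : int) : edge_hyp cone_x cone_z i 0 t (hyp (hyp_coord K l i t)).
Proof.
move=> v; have [_ -> _ _ _] := cone_coordsys.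
rewrite mem_kernel_hyperplane /= add0r -[RHS]subr_eq0; congr (_ == _).
by rewrite mulNr.
Qed.

Lemma infinity_cone : infinity_hyp cone_z (kernel_hyperplane (row_mx (0 : 'rV[K]_l) 1)).
Proof.
move=> v; rewrite -[1]/(1%:M) mem_kernel_hyperplane trmx0 mulmx0 mxE add0r mul1r //.
Qed.

(** The affine lists contain each difference in a single orientation, so [E] has to be matched only
    up to reversal of an edge. *)
Lemma realizes_cone (A : affine_arrangement K l) (E : nat -> nat -> int -> bool) :
  (forall e, e \in A -> exists i j t, [/\ vert seg i, vert seg j, i != j, E i j t
      & e = hyp_diff K l i j t \/ j = 0%N /\ e = hyp_coord K l i t]) ->
  (forall i t, seg i -> E i 0%N t -> hyp_coord K l i t \in A) ->
  (forall i j t, seg i -> seg j -> i != j -> E i j t ->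
     hyp_diff K l i j t \in A \/ hyp_diff K l j i (- t) \in A) ->
  symgain E -> realizes seg cone_x cone_z E (cone A).
Proof.
move=> h1 h2 h3 symE H; rewrite /cone !inE; split.
  case/orP => [/eqP ->|/imfsetP[e /= eA ->]]; first by left; apply: infinity_cone.
  have [i [j [t [vi vj ij Et hE]]]] := h1 e eA; right; exists i, j, t; split=> //.
  by case: hE => [->|[-> ->]]; [apply: hyp_diff_edge|apply: hyp_coord_edge].
have memA e : e \in A -> H = hyp e -> (H == kernel_hyperplane (row_mx 0 1)) ||
    (H \in [fset kernel_hyperplane (row_mx e.1 (- e.2)%:M) | e in A]).
  by move=> eA ->; apply/orP; right; apply/imfsetP; exists e.
case=> [hz|[i [j [t [vi vj ij Et hH]]]]].
  by apply/orP; left; apply/eqP; apply: infinity_hyp_uniq hz infinity_cone.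
have [j0|j0] := eqVneq j 0%N.
  subst j; have si : seg i by move: vi; rewrite /vert (negPf ij).
  by apply: (memA _ (h2 i t si Et)); apply: (edge_hyp_uniq hH); apply: hyp_coord_edge.
have sj : seg j by move: vj; rewrite /vert (negPf j0).
have [i0|i0] := eqVneq i 0%N.
  subst i; rewrite symE in Et; apply: (memA _ (h2 j (- t) sj Et)).
  by apply: (edge_hyp_uniq (edge_hyp_sym hH)); apply: hyp_coord_edge.
have si : seg i by move: vi; rewrite /vert (negPf i0).
case: (h3 i j t si sj ij Et) => hA; apply: (memA _ hA).
  by apply: (edge_hyp_uniq hH); apply: hyp_diff_edge.
by apply: (edge_hyp_uniq (edge_hyp_sym hH)); apply: hyp_diff_edge.
Qed.

Variables (p k c m : nat).
Hypotheses (c0 : (0 < c)%N) (kl : (0 < k <= l)%N).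

(** With r = l - k + 1, [mu_] is k up to r and l - i + 1 beyond, which gives the two branches of
    [fam_coord]; for tau = 0 the interval of inherited values is empty. *)
Lemma realizes_R :
  realizes seg cone_x cone_z (fam l (l - k + 1) p m c false 0) (cone (arr_R K l p k c m)).
Proof.
apply: realizes_cone; last exact: fam_sym.
- move=> e; rewrite !mem_cat => /or4P[] /allpairsPdep[a [b []]]; rewrite !mem_index_iota.
  + move=> ha hb ->; exists b, a, 0; rewrite /vert /fam /gain_of /fam_diff.
    by rewrite !ifF; [split; [lia|lia|lia|lia|left]|lia|lia].
  + move=> ha hb ->; exists b, a, 1; rewrite /vert /fam /gain_of /fam_diff.
    by rewrite !ifF; [split; [lia|lia|lia|lia|left]|lia|lia].
  + move=> ha hb ->; exists b, a, (-1); rewrite /vert /fam /gain_of /fam_diff.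
    by rewrite !ifF; [split; [lia|lia|lia|lia|left]|lia|lia].
  + rewrite mem_int_range => ha hb ->; exists a, 0%N, b; rewrite /vert /fam /gain_of /fam_coord.
    rewrite ifF; last by lia.
    split; [lia|lia|lia| |by right].
    by move: hb; rewrite /d_ /mu_ /=; case: ifP; case: ifP; lia.
- move=> i t /= si; rewrite /fam /gain_of ifF /= /fam_coord; last by lia.
  move=> ht; rewrite !mem_cat; apply/or4P/Or44/allpairsPdep; exists i, t.
  rewrite mem_index_iota mem_int_range; split=> //.
  by move: ht; rewrite /d_ /mu_; case: ifP; case: ifP; lia.
- move=> i j t /= si sj ij; rewrite /fam /gain_of ifF ?ifF /fam_diff; [|lia|lia].
  wlog lt_ij : i j t si sj ij / (i < j)%N.
    move=> W ht; have [lt|lt] := ltnP i j; first exact: W.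
    by have [||||||] := W j i (- t); rewrite ?opprK; auto; lia.
  move=> ht; left; rewrite !mem_cat; apply/or4P.
  have [t0|[t0|t0]] : t = 0 \/ t = 1 \/ t = -1 by lia.
  + by apply/Or41/allpairsPdep; exists j, i; rewrite !mem_index_iota t0; split=> //; lia.
  + by apply/Or42/allpairsPdep; exists j, i; rewrite !mem_index_iota t0; split=> //; lia.
  + by apply/Or43/allpairsPdep; exists j, i; rewrite !mem_index_iota t0; split=> //; lia.
Qed.

Lemma realizes_Rhat : (k < l)%N ->
  realizes seg cone_x cone_z (fam l (l - k) p m c true 0) (cone (arr_Rhat K l p k c m)).
Proof.
move=> kl'; apply: realizes_cone; last exact: fam_sym.
- move=> e; rewrite !mem_cat => /or4P[||| /orP[]].
  + move=> /allpairsPdep[a [b []]]; rewrite !mem_index_iota => ha hb ->; exists b, a, 0.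
    rewrite /vert /fam /gain_of /fam_diff.
    by rewrite !ifF; [split; [lia|lia|lia|lia|left]|lia|lia].
  + move=> /allpairsPdep[a [b []]]; rewrite !mem_index_iota => ha hb ->; exists b, a, 1.
    rewrite /vert /fam /gain_of /fam_diff.
    by rewrite !ifF; [split; [lia|lia|lia|lia|left]|lia|lia].
  + move=> /allpairsPdep[a [b []]]; rewrite !mem_index_iota => ha hb ->; exists b, a, (-1).
    rewrite /vert /fam /gain_of /fam_diff.
    by rewrite !ifF; [split; [lia|lia|lia|lia|left]|lia|lia].
  + move=> /mapP[b]; rewrite mem_index_iota => hb ->; exists (l - k + 1)%N, b, 1.
    rewrite /vert /fam /gain_of /fam_diff.
    by rewrite !ifF; [split; [lia|lia|lia|lia|left]|lia|lia].
  + move=> /allpairsPdep[a [b []]]; rewrite mem_index_iota mem_int_range => ha hb ->.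
    exists a, 0%N, b; rewrite /vert /fam /gain_of /fam_coord.
    rewrite ifF; last by lia.
    split; [lia|lia|lia| |by right].
    by move: hb; rewrite /d_ /=; case: ifP; case: ifP; lia.
- move=> i t /= si; rewrite /fam /gain_of ifF /= /fam_coord; last by lia.
  move=> ht; rewrite !mem_cat; apply/or4P/Or44/orP; right; apply/allpairsPdep; exists i, t.
  rewrite mem_index_iota mem_int_range; split=> //.
  by move: ht; rewrite /d_; case: ifP; case: ifP; lia.
- move=> i j t /= si sj ij; rewrite /fam /gain_of ifF ?ifF /fam_diff; [|lia|lia].
  wlog lt_ij : i j t si sj ij / (i < j)%N.
    move=> W ht; have [lt|lt] := ltnP i j; first exact: W.
    by have [||||||] := W j i (- t); rewrite ?opprK; auto; lia.
  move=> ht; rewrite !mem_cat.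
  (* As i < j, an edge at the special vertex j = l - k + 1 has gain -1 and is listed in the reverse
     orientation; hence the last case goes to the right. *)
  have [t0|[[t0 jr]|[[t0 jr]|[t0 jr]]]] : t = 0 \/ (t = 1 /\ (j <= l - k)%N) \/
     (t = -1 /\ (j <= l - k)%N) \/ (t = -1 /\ j = (l - k + 1)%N) by lia.
  + by left; apply/or4P/Or41/allpairsPdep; exists j, i; rewrite !mem_index_iota t0; split=> //; lia.
  + by left; apply/or4P/Or42/allpairsPdep; exists j, i; rewrite !mem_index_iota t0; split=> //; lia.
  + by left; apply/or4P/Or43/allpairsPdep; exists j, i; rewrite !mem_index_iota t0; split=> //; lia.
  + right; apply/or4P/Or44/orP; left; apply/mapP; exists i; rewrite ?mem_index_iota ?t0 ?jr ?opprK //.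
    by lia.
Qed.

End Cones.

(** * Order of the exponents and conclusion *)

Lemma sorted_fam_exp l p m c : (0 < c)%N -> sorted leq (1%N :: rev (map (fam_exp l p m c) (iota 1 l))).
Proof.
move=> c0; rewrite -rev_rcons rev_sorted; apply/(sortedP 0%N) => i.
rewrite size_rcons size_map size_iota ltnS => il.
have nthE j : (j < l)%N -> nth 0%N (map (fam_exp l p m c) (iota 1 l)) j = fam_exp l p m c j.+1.
  by move=> jl; rewrite (nth_map 0%N) ?size_iota // nth_iota.
rewrite /= !nth_rcons size_map size_iota il (nthE i) //; case: (ltnP i.+1 l) => il'.
  by rewrite nthE // /fam_exp; lia.
by rewrite ifT /fam_exp; lia.
Qed.

(** The staircase identity with Q = m + l + c, which is q + 1: the l - p indices above p turn the
    lowest step into q + l - p + 1. *)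
Lemma perm_cone_exponents l p m c : (0 < l)%N -> (0 < c)%N -> (p <= l)%N ->
  perm_eq (1%N :: map (fam_exp l p m c) (iota 1 l)) (cone_exponents l p c m).
Proof.
move=> l0 c0 pl; rewrite /cone_exponents perm_cons.
have -> : map (fam_exp l p m c) (iota 1 l) = [seq (m + l + c + (l - i) + (p < i))%N | i <- iota 1 l].
  by apply: eq_map => i; rewrite /fam_exp; lia.
have := @perm_staircase (m + l + c) l.-1 0 p l ltac:(lia); rewrite prednK // perm_sym => h.
rewrite (permPl h); apply/permP => q.
have -> : size [seq i <- iota 1 l | (p < i)%N] = (l - p)%N.
  rewrite -[X in iota 1 X](subnKC pl) iotaD filter_cat size_cat.
  rewrite (@eq_in_filter _ _ pred0) ?filter_pred0; last by move=> i; rewrite mem_iota /=; lia.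
  rewrite (@eq_in_filter _ _ predT) ?filter_predT ?size_iota //; by move=> i; rewrite mem_iota /=; lia.
have -> : [seq (m + l + c - 1 + j)%N | j <- index_iota 2 l.+1] = iota (m + l + c).+1 l.-1.
  rewrite /index_iota (_ : l.+1 - 2 = l.-1)%N; last by lia.
  rewrite -(iotaDl (m + l + c - 1) 2) /=; congr iota; lia.
by rewrite /= (_ : m + l + c - 1 + l - p + 1 = m + l + c + (l - p))%N; last by lia.
Qed.

Theorem theorem7p31 (R : realType) (m c k l p : nat) :
  (1 <= c)%N -> (1 <= k <= l)%N -> (p <= l)%N ->
  (ind_flag_accurate (cone (arr_R R l p k c m))
   /\ free_with_exponents (cone (arr_R R l p k c m))
        (cone_exponents l p c m))
  /\ ((k <= l - 1)%N ->
      ind_flag_accurate (cone (arr_Rhat R l p k c m))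
      /\ free_with_exponents (cone (arr_Rhat R l p k c m))
           (cone_exponents l p c m)).
Proof.
move=> c0 kl pl; have l0 : (0 < l)%N by lia.
have key (A : {fset {vspace 'rV[R]_(l + 1)}}) r (h : bool) : (0 < r)%N -> (r + h <= l)%N ->
    realizes (fun i => (0 < i <= l)%N) (@cone_x R l) (@cone_z R l) (fam l r p m c h 0) A ->
    ind_flag_accurate A /\ free_with_exponents A (cone_exponents l p c m).
  move=> r0 hr hA; have cs := cone_coordsys R l.
  have hfree := @fam_free R l r p m c h c0 r0 hr 0 (leq0n l) _ _ _ _ cs hA.
  have hflag := @fam_flag R l r p m c h c0 r0 hr 0 (leq0n l) _ _ _ _ cs hA.
  rewrite subn0 in hfree hflag; split.
    by apply: flagged_ind_flag_accurate hflag; apply: sorted_fam_exp.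
  by have [] := good_perm (perm_cone_exponents m l0 c0 pl) hfree.
split=> [|kl'].
  by apply: (key _ (l - k + 1)%N false); [lia|lia|exact: realizes_R].
by apply: (key _ (l - k)%N true); [lia|lia|apply: realizes_Rhat; lia].
Qed.
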